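(* Let $(\varphi_\lambda)_{\lambda\in[0,1]}$ be a differentiable parametrized family of flows on a connected differentiable $n$-dimensional manifold $M$. Let $K_0$ be a connected isolated non-saddle set for $\varphi_0$ and suppose that $K_0$ continues to a family $(K_\lambda)_{\lambda\in[0,\delta]}$, $\delta>0$, of non-empty isolated invariant compacta ($K_\lambda$ invariant for $\varphi_\lambda$). Then the following are equivalent: (1) $K_\lambda$ is non-saddle (for $\varphi_\lambda$) for all sufficiently small $\lambda>0$; (2) there exists a connected isolating block $N$ of $K_0$ (for $\varphi_0$) such that, for all sufficiently small $\lambda>0$, $N$ is an isolating neighborhood of $K_\lambda$ for $\varphi_\lambda$ and the inclusion $i_\lambda:K_\lambda\hookrightarrow N$ induces isomorphisms in Čech cohomology with $\mathbb{Z}_2$ coefficients (in all degrees).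
   Context: A differentiable parametrized family of flows on a smooth manifold $M$ is a family of flows $\varphi_\lambda:M\times\mathbb{R}\to M$, $\lambda\in I=[0,1]$, such that the map $M\times\mathbb{R}\times I\to M$, $(x,t,\lambda)\mapsto\varphi_\lambda(x,t)$, is differentiable. For a flow $\varphi$ on $M$ write $xt=\varphi(x,t)$. A compact invariant set $K$ is isolated if it has a compact neighborhood $N$ (an isolating neighborhood; one says $N$ isolates $K$) such that $K$ is the maximal invariant set in $N$. Isolated invariant sets are assumed to be non-empty proper subsets of the phase space. An isolating block is an isolating neighborhood $N$ for which there are compact sets $N^i,N^o\subset\partial N$ (entrance and exit sets) with: (1) $\partial N=N^i\cup N^o$; (2) for every $x\in N^i$ there is $\varepsilon>0$ with $x[-\varepsilon,0)\subset M\setminus N$, and for every $x\in N^o$ there is $\delta>0$ with $x(0,\delta]\subset M\setminus N$; (3) for every $x\in\partial N\setminus N^i$ there is $\varepsilon>0$ with $x[-\varepsilon,0)\subset\mathring N$, and for every $x\in\partial N\setminus N^o$ there is $\delta>0$ with $x(0,\delta]\subset\mathring N$. An invariant compactum $K$ is saddle if there is a neighborhood $U$ of $K$ such that every neighborhood $V$ of $K$ contains a point $x$ with $x[0,\infty)\not\subset U$ and $x(-\infty,0]\not\subset U$; otherwise $K$ is non-saddle. For a closed non-degenerate subinterval $J\subset[0,1]$, a family $(K_\lambda)_{\lambda\in J}$, with $K_\lambda$ an isolated invariant set for $\varphi_\lambda$, is a continuation (of each of its members) if for each $\lambda_0\in J$ and each isolating neighborhood $N_{\lambda_0}$ of $K_{\lambda_0}$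 (for $\varphi_{\lambda_0}$) there is $\eta>0$ such that $N_{\lambda_0}$ is an isolating neighborhood of $K_\lambda$ (for $\varphi_\lambda$) for every $\lambda\in(\lambda_0-\eta,\lambda_0+\eta)\cap J$. ''$K_0$ continues to $(K_\lambda)_{\lambda\in[0,\delta]}$'' means that this family is a continuation whose member at $\lambda=0$ is $K_0$. *)

(* Defs.v *)
From HB Require Import structures.
From mathcomp Require Import all_boot all_order all_algebra.
From mathcomp Require Import generic_quotient ring.
From mathcomp Require Import all_classical all_reals all_analysis.

Set Implicit Arguments.
Unset Strict Implicit.
Unset Printing Implicit Defensive.

Import Order.TTheory GRing.Theory Num.Theory.
Import numFieldNormedType.Exports.

Local Open Scope classical_set_scope.
Local Open Scope ring_scope.

(** * Differentiable manifolds *)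

Section Manifolds.
Context {R : realType}.

Fixpoint class_Ck {V W : normedModType R} (k : nat) (U : set V) (f : V -> W) :
    Prop :=
  match k with
  | 0%N => forall x, U x -> {for x, continuous f}
  | k'.+1 => (forall x, U x -> differentiable f x) /\
             forall v : V, class_Ck k' U ('D_v f)
  end.

Definition smooth_on {V W : normedModType R} (U : set V) (f : V -> W) : Prop :=
  forall k, class_Ck k U f.

(* Frechet differentiability at [p] relative to the domain [D]: increments are
   only taken inside [D], so that it is one-sided at boundary points of [D]. *)
Definition differentiable_within {V W : normedModType R} (D : set V)
    (f : V -> W) (p : V) : Prop :=
  exists2 df : {linear V -> W}, continuous df &
    forall e : R, 0 < e ->
      \forall q \near within D (nbhs p),
        `|f q - f p - df (q - p)| <= e * `|q - p|.

Record chart (n : nat) (M : topologicalType) := Chart {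
  chart_dom : set M;
  chart_fun : M -> 'rV[R]_n;
  chart_inv : 'rV[R]_n -> M;
  chart_dom_open : open chart_dom;
  chart_img_open : open (chart_fun @` chart_dom);
  chart_funK : forall x, chart_dom x -> chart_inv (chart_fun x) = x;
  chart_fun_continuous : {within chart_dom, continuous chart_fun};
  chart_inv_continuous :
    {within chart_fun @` chart_dom, continuous chart_inv} }.

Record smooth_manifold (n : nat) (M : topologicalType)
    (A : set (chart n M)) : Prop := SmoothManifold {
  manifold_hausdorff : hausdorff_space M;
  manifold_second_countable : @second_countable M;
  atlas_covers : forall x, exists2 c, A c & chart_dom c x;
  atlas_compatible : forall c d, A c -> A d ->
    smooth_on (chart_fun c @` (chart_dom c `&` chart_dom d))
              (chart_fun d \o chart_inv c) }.

End Manifolds.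
Arguments chart : clear implicits.

(** * Flows *)

Section Flows.
Context {R : realType} {M : topologicalType}.
Implicit Types (phi : M -> R -> M) (K N U : set M).

Record is_flow phi : Prop := IsFlow {
  flow_continuous : continuous (fun p : M * R => phi p.1 p.2);
  flow0 : forall x, phi x 0 = x;
  flowD : forall x s t, phi x (s + t) = phi (phi x s) t }.

Definition flow_invariant phi K : Prop := forall x t, K x -> K (phi x t).

Record isolates phi N K : Prop := Isolates {
  isolates_compact : compact N;
  isolates_nbhd : K `<=` N°;
  isolates_invariant : flow_invariant phi K;
  isolates_maximal : forall L, flow_invariant phi L -> L `<=` N -> L `<=` K }.

Record isolated_invariant phi K : Prop := IsolatedInvariant {
  isolated_nonempty : K !=set0;
  isolated_proper : K != setT;
  isolated_compact : compact K;
  isolated_inv : flow_invariant phi K;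
  isolated_nbhd : exists N, isolates phi N K }.

Definition frontier N : set M := closure N `\` N°.

Record isolating_block phi N K : Prop := IsolatingBlock {
  block_isolates : isolates phi N K;
  block_exits : exists Ni No : set M,
    [/\ compact Ni, compact No & frontier N = Ni `|` No] /\
    [/\ forall x, Ni x -> exists2 e : R, 0 < e &
          forall t, - e <= t < 0 -> ~ N (phi x t),
        forall x, No x -> exists2 d : R, 0 < d &
          forall t, 0 < t <= d -> ~ N (phi x t),
        forall x, (frontier N `\` Ni) x -> exists2 e : R, 0 < e &
          forall t, - e <= t < 0 -> N° (phi x t)
      & forall x, (frontier N `\` No) x -> exists2 d : R, 0 < d &
          forall t, 0 < t <= d -> N° (phi x t)] }.

Definition saddle phi K : Prop :=
  exists U, K `<=` U° /\
    forall V, K `<=` V° -> exists x, [/\ V x,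
      ~ (forall t, 0 <= t -> U (phi x t))
      & ~ (forall t, t <= 0 -> U (phi x t))].

Definition non_saddle phi K : Prop := ~ saddle phi K.

(* In families, [phi l] and [K l] are only meaningful for the parameters [l] in
   the relevant interval; elsewhere the values are arbitrary. *)
Definition is_continuation (phi : R -> M -> R -> M) (a b : R)
    (K : R -> set M) : Prop :=
  [/\ 0 <= a, a < b, b <= 1,
      forall l, a <= l <= b -> isolated_invariant (phi l) (K l)
    & forall l0, a <= l0 <= b -> forall N, isolates (phi l0) N (K l0) ->
        exists2 eta : R, 0 < eta &
          forall l, a <= l <= b -> l0 - eta < l < l0 + eta ->
            isolates (phi l) N (K l)].

End Flows.

Definition param_domain {R : realType} {T : Type} : set (T * R * R) :=
  [set q | 0 <= q.2 <= 1].

(* Joint continuity is required separately because the chart [d] says nothing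
   about points outside its domain. *)
Record differentiable_family {R : realType} {n : nat} {M : topologicalType}
    (A : set (chart R n M)) (phi : R -> M -> R -> M) : Prop :=
  DifferentiableFamily {
  family_flow : forall l, 0 <= l <= 1 -> is_flow (phi l);
  family_continuous : {within (param_domain : set (M * R * R)),
    continuous (fun q : M * R * R => phi q.2 q.1.1 q.1.2)};
  family_differentiable : forall c d x t l, A c -> A d -> 0 <= l <= 1 ->
    chart_dom c x -> chart_dom d (phi l x t) ->
    differentiable_within (param_domain : set ('rV[R]_n * R * R))
      (fun q : 'rV[R]_n * R * R =>
         chart_fun d (phi q.2 (chart_inv c q.1.1) q.1.2))
      (chart_fun c x, t, l) }.

(** * Cech cohomology

   The direct limit, over all open covers ordered by refinement, of the
   cohomology of their nerves. A simplex of the nerve is an ordered, possibly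
   degenerate, list of members of the cover with a common point, a k-simplex
   being a list of size k + 1. *)

Section Cochains.
Context {G : comNzRingType}.

Definition coboundary {T : Type} (c : seq T -> G) (s : seq T) : G :=
  \sum_(i < size s) (-1) ^+ i * c (take i s ++ drop i.+1 s).

Lemma eq_coboundary {T : Type} (c d : seq T -> G) s :
  c =1 d -> coboundary c s = coboundary d s.
Proof. by move=> cd; apply: eq_bigr => i _; rewrite cd. Qed.

Lemma coboundaryD {T : Type} (c d : seq T -> G) s :
  coboundary (fun r => c r + d r) s = coboundary c s + coboundary d s.
Proof. by rewrite -big_split; apply: eq_bigr => i _; rewrite mulrDr. Qed.

Lemma coboundaryN {T : Type} (c : seq T -> G) s :
  coboundary (fun r => - c r) s = - coboundary c s.
Proof. by rewrite -sumrN; apply: eq_bigr => i _; rewrite mulrN. Qed.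

Lemma coboundary0 {T : Type} (s : seq T) :
  coboundary (fun=> 0) s = 0.
Proof. by rewrite /coboundary big1// => i _; rewrite mulr0. Qed.

Lemma coboundary_map {T U : Type} (c : seq U -> G) (p : T -> U) s :
  coboundary (fun r => c (map p r)) s = coboundary c (map p s).
Proof.
rewrite /coboundary size_map; apply: eq_bigr => i _.
by rewrite map_cat map_take map_drop.
Qed.

Lemma coboundary_cons {T : Type} (c : seq T -> G) x s :
  coboundary c (x :: s) = c s - coboundary (fun r => c (x :: r)) s.
Proof.
rewrite /coboundary big_ord_recl /= expr0 mul1r drop0; congr (_ + _).
by rewrite -sumrN; apply: eq_bigr => i _; rewrite /= exprS mulN1r mulNr.
Qed.

Fixpoint prism {T U : Type} (p q : T -> U) (c : seq U -> G) (s : seq T) : G :=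
  if s is x :: s' then
    c (p x :: q x :: map q s') - prism p q (fun r => c (p x :: r)) s'
  else 0.

Lemma prismB {T U : Type} (p q : T -> U) (c d : seq U -> G) s :
  prism p q (fun r => c r - d r) s = prism p q c s - prism p q d s.
Proof.
elim: s c d => [|x s IH] c d /=; first by rewrite subr0.
by rewrite IH; ring.
Qed.

Lemma eq_prism {T U : Type} (p q : T -> U) (c d : seq U -> G) s :
  c =1 d -> prism p q c s = prism p q d s.
Proof.
elim: s c d => [//|x s IH] c d cd /=.
by rewrite cd; congr (_ - _); apply: IH => r.
Qed.

Lemma prism_homotopy {T U : Type} (p q : T -> U) (c : seq U -> G) s :
  coboundary (prism p q c) s + prism p q (coboundary c) s =
  c (map q s) - c (map p s).
Proof.
elim: s c => [|x s IH] c.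
  by rewrite /coboundary big_ord0 /= addr0 subrr.
rewrite coboundary_cons /=.
rewrite coboundaryD coboundaryN (coboundary_map (fun r => c (p x :: q x :: r))).
rewrite !coboundary_cons.
have -> : prism p q (fun r => coboundary c (p x :: r)) s =
    prism p q (fun r => c r - coboundary (fun r => c (p x :: r)) r) s.
  by apply: eq_prism => r; rewrite coboundary_cons.
rewrite prismB.
have := IH (fun r => c (p x :: r)).
set h1 := coboundary (prism _ _ _) s.
set h2 := prism p q (coboundary _) s.
set k := prism p q c s; set d := coboundary _ (map q s).
move=> E.
transitivity (c (q x :: map q s) - c (p x :: map q s) + (h1 + h2)); first by ring.
by rewrite E; ring.
Qed.

End Cochains.

Section CechCohomology.
Context {G : comNzRingType}.

Record open_cover (X : topologicalType) := OpenCover {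
  cover_sets :> set (set X);
  cover_open : forall U, cover_sets U -> open U;
  cover_covers : forall x, exists2 U, cover_sets U & U x }.

Definition simplex {X : topologicalType} (S : set (set X)) (k : nat)
    (s : seq (set X)) : Prop :=
  [/\ size s = k.+1, forall U, U \in s -> S U
    & exists x, forall U, U \in s -> U x].

(* [p] is a projection of the cover [T] of [X] to the pullback along [f] of the
   cover [S] of [Y]; the usual refinement of covers is the case [f = id]. *)
Definition refines {X Y : topologicalType} (f : X -> Y) (T : set (set X))
    (S : set (set Y)) (p : set X -> set Y) : Prop :=
  forall V, T V -> S (p V) /\ V `<=` f @^-1` p V.

Definition is_cocycle {X : topologicalType} (S : set (set X)) (k : nat)
    (c : seq (set X) -> G) : Prop :=
  forall s, simplex S k.+1 s -> coboundary c s = 0.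

(* The condition [e [::] = 0] makes the (-1)-cochains trivial, so that the
   cohomology is not reduced. *)
Definition is_coboundary {X : topologicalType} (S : set (set X)) (k : nat)
    (c : seq (set X) -> G) : Prop :=
  exists2 e : seq (set X) -> G, e [::] = 0 &
    forall s, simplex S k s -> c s = coboundary e s.

Record cocycle (X : topologicalType) (k : nat) := Cocycle {
  cocycle_cover : open_cover X;
  cocycle_fun :> seq (set X) -> G;
  cocycleP : is_cocycle cocycle_cover k cocycle_fun }.

HB.instance Definition _ X k := gen_eqMixin (cocycle X k).
HB.instance Definition _ X k := gen_choiceMixin (cocycle X k).

(* [f] pulls the class of [a] back to the class of [b]. *)
Definition cech_rel {X Y : topologicalType} (f : X -> Y) (k : nat)
    (a : cocycle Y k) (b : cocycle X k) : Prop :=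
  exists (S : open_cover X) (p : set X -> set Y) (q : set X -> set X),
    [/\ refines f S (cocycle_cover a) p, refines id S (cocycle_cover b) q
      & is_coboundary S k (fun s => a (map p s) - b (map q s))].

Lemma is_coboundaryB {X : topologicalType} (S : set (set X)) k c d :
  is_coboundary S k c -> is_coboundary S k d ->
  is_coboundary S k (fun s => c s - d s).
Proof.
move=> [e e0 ec] [g g0 gd]; exists (fun s => e s - g s).
  by rewrite e0 g0 subrr.
by move=> s Ss; rewrite coboundaryD coboundaryN ec ?gd.
Qed.

Lemma is_coboundary0 {X : topologicalType} (S : set (set X)) k c :
  (forall s, c s = 0) -> is_coboundary S k c.
Proof. by move=> c0; exists (fun=> 0) => // s _; rewrite coboundary0. Qed.

Lemma eq_is_coboundary {X : topologicalType} (S : set (set X)) k c d :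
  c =1 d -> is_coboundary S k c -> is_coboundary S k d.
Proof. by move=> cd [e e0 ec]; exists e => // s /ec; rewrite cd. Qed.

Lemma is_coboundaryN {X : topologicalType} (S : set (set X)) k c :
  is_coboundary S k c -> is_coboundary S k (fun s => - c s).
Proof.
have z : is_coboundary S k (fun=> 0) by exact: is_coboundary0.
by move=> cS; apply: eq_is_coboundary (is_coboundaryB z cS) => s; rewrite sub0r.
Qed.

Lemma is_coboundaryD {X : topologicalType} (S : set (set X)) k c d :
  is_coboundary S k c -> is_coboundary S k d ->
  is_coboundary S k (fun s => c s + d s).
Proof.
move=> cS /is_coboundaryN dS; apply: eq_is_coboundary (is_coboundaryB cS dS).
by move=> s; rewrite opprK.
Qed.

Lemma refines_comp {X Y Z : topologicalType} (f : X -> Y) (g : Y -> Z)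
    S T U p q :
  refines f S T p -> refines g T U q -> refines (g \o f) S U (q \o p).
Proof.
move=> pf qg V SV; have [Tp Vp] := pf V SV; have [Uq pq] := qg _ Tp.
by split=> // x /Vp /pq.
Qed.

Lemma simplex_map {X Y : topologicalType} (f : X -> Y) S T p k s :
  refines f T S p -> simplex T k s -> simplex S k (map p s).
Proof.
move=> pf [ss Ts [x sx]]; split; first by rewrite size_map.
  by move=> U /mapP[V /Ts /pf[? _] ->].
by exists (f x) => U /mapP[V Vs ->]; have [_] := pf _ (Ts _ Vs); apply; exact: sx.
Qed.

Lemma is_cocycle_map {X Y : topologicalType} (f : X -> Y) S T p k c :
  refines f T S p -> is_cocycle S k c -> is_cocycle T k (fun s => c (map p s)).
Proof.
by move=> pf cS s sT; rewrite coboundary_map; apply/cS/(simplex_map pf).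
Qed.

Lemma is_coboundary_map {X Y : topologicalType} (f : X -> Y) S T p k c :
  refines f T S p -> is_coboundary S k c ->
  is_coboundary T k (fun s => c (map p s)).
Proof.
move=> pf [e e0 ec]; exists (fun s => e (map p s)) => // s sT.
by rewrite coboundary_map ec//; exact: simplex_map pf _.
Qed.

Lemma prism_eq0 {T U : Type} (p q : T -> U) (c : seq U -> G) s :
  (forall a x b, s = a ++ x :: b ->
    c (map p a ++ p x :: q x :: map q b) = 0) -> prism p q c s = 0.
Proof.
elim: s c => [//|x s IH] c c0 /=; rewrite (c0 [::] x s)// sub0r IH ?oppr0//.
by move=> a y b sE; apply: (c0 (x :: a) y b); rewrite sE.
Qed.

Lemma contiguous {X Y : topologicalType} (f : X -> Y) S T p q k c :
  refines f T S p -> refines f T S q -> is_cocycle S k c ->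
  is_coboundary T k (fun s => c (map p s) - c (map q s)).
Proof.
move=> pf qf cS; exists (prism q p c) => // s sT.
rewrite -(prism_homotopy q p) prism_eq0 ?addr0// => a x b sE.
move: sT => [ss Ts [y sy]]; apply: cS; split.
- move: ss; rewrite sE !size_cat /= !size_map => <-.
  by rewrite !addnS.
- move=> U; rewrite mem_cat !inE => /or4P[/mapP[V Va ->]|/eqP->|/eqP->|].
  + by have [] := qf V (Ts V _); rewrite // sE mem_cat Va.
  + by have [] := qf x (Ts x _); rewrite // sE mem_cat mem_head orbT.
  + by have [] := pf x (Ts x _); rewrite // sE mem_cat mem_head orbT.
  + move=> /mapP[V Vb ->].
    by have [] := pf V (Ts V _); rewrite // sE mem_cat inE Vb !orbT.
- have qy V : V \in s -> q V (f y).
    by move=> Vs; have [_] := qf V (Ts V Vs); apply; exact: sy.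
  have py V : V \in s -> p V (f y).
    by move=> Vs; have [_] := pf V (Ts V Vs); apply; exact: sy.
  exists (f y) => U.
  rewrite mem_cat !inE => /or4P[/mapP[V Va ->]|/eqP->|/eqP->|].
  + by apply: qy; rewrite // sE mem_cat Va.
  + by apply: qy; rewrite // sE mem_cat mem_head orbT.
  + by apply: py; rewrite // sE mem_cat mem_head orbT.
  + by move=> /mapP[V Vb ->]; apply: py; rewrite // sE mem_cat inE Vb !orbT.
Qed.

Section Meet.
Context {X : topologicalType} (S T : open_cover X).

Let meet_sets : set (set X) :=
  [set W | exists2 U, cover_sets S U & exists2 V, cover_sets T V & W = U `&` V].

Let meet_open U : meet_sets U -> open U.
Proof. by move=> [A /cover_open oA [B /cover_open oB ->]]; exact: openI. Qed.

Let meet_covers x : exists2 U, meet_sets U & U x.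
Proof.
have [U SU Ux] := cover_covers S x; have [V TV Vx] := cover_covers T x.
by exists (U `&` V) => //; exists U => //; exists V.
Qed.

Definition cover_meet := OpenCover meet_open meet_covers.

Definition meet_left (W : set X) : set X := xget setT [set U | cover_sets S U /\ W `<=` U].
Definition meet_right (W : set X) : set X := xget setT [set V | cover_sets T V /\ W `<=` V].

Lemma meet_leftP : refines id cover_meet S meet_left.
Proof.
move=> W [U SU [V TV ->]]; rewrite /meet_left.
by case: xgetP => [Z _ //|] /(_ U) []; split=> // x [].
Qed.

Lemma meet_rightP : refines id cover_meet T meet_right.
Proof.
move=> W [U SU [V TV ->]]; rewrite /meet_right.
by case: xgetP => [Z _ //|] /(_ V) []; split=> // x [].
Qed.

End Meet.

Lemma refines_id {X : topologicalType} (S : set (set X)) : refines id S S id.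
Proof. by move=> V SV; split. Qed.

Lemma cech_rel_trans {X Y : topologicalType} (f : X -> Y) k
    (a : cocycle Y k) (b c : cocycle X k) :
  cech_rel f a b -> cech_rel id b c -> cech_rel f a c.
Proof.
move=> [S1 [p1 [q1 [pa1 qb1 e1]]]] [S2 [p2 [q2 [pb2 qc2 e2]]]].
have r1 := @meet_leftP _ S1 S2; have r2 := @meet_rightP _ S1 S2.
exists (cover_meet S1 S2), (p1 \o meet_left S1), (q2 \o meet_right S2).
split; [exact: refines_comp r1 pa1|exact: refines_comp r2 qc2|].
have := contiguous (refines_comp r1 qb1) (refines_comp r2 pb2) (@cocycleP _ _ b).
move=> /(is_coboundaryD (is_coboundary_map r1 e1)).
move=> /is_coboundaryD /(_ (is_coboundary_map r2 e2)).
apply: eq_is_coboundary => s.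
rewrite (map_comp p1) (map_comp q1) (map_comp p2) (map_comp q2).
by rewrite !subrKA.
Qed.

Lemma cech_rel_refl {X : topologicalType} k (a : cocycle X k) :
  cech_rel id a a.
Proof.
exists (cocycle_cover a), id, id; split; [exact: refines_id..|].
by apply: is_coboundary0 => s; rewrite subrr.
Qed.

Lemma cech_rel_sym {X : topologicalType} k (a b : cocycle X k) :
  cech_rel id a b -> cech_rel id b a.
Proof.
move=> [S [p [q [pa qb /is_coboundaryN ab]]]]; exists S, q, p; split=> //.
by apply: eq_is_coboundary ab => s; rewrite opprB.
Qed.

Definition cech_relb {X : topologicalType} k (a b : cocycle X k) : bool :=
  `[< cech_rel id a b >].

Lemma cech_relb_equiv {X : topologicalType} k :
  equiv_class_of (@cech_relb X k).
Proof.
split.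
- by move=> a; apply/asboolP/cech_rel_refl.
- by move=> a b; apply/asboolP/asboolP => /cech_rel_sym.
- by move=> b a c /asboolP ab /asboolP bc; apply/asboolP/(cech_rel_trans ab).
Qed.

Canonical cech_equiv {X : topologicalType} k :=
  EquivRelPack (@cech_relb_equiv X k).

Definition cech_cohomology (X : topologicalType) (k : nat) : Type :=
  {eq_quot (@cech_equiv X k)}%qT.

HB.instance Definition _ X k := Choice.on (cech_cohomology X k).
HB.instance Definition _ X k := EqQuotient.on (cech_cohomology X k).

Definition cech_class {X : topologicalType} k (a : cocycle X k) :
  cech_cohomology X k := (\pi_(cech_cohomology X k) a)%qT.

Lemma cech_classP {X : topologicalType} k (a b : cocycle X k) :
  cech_class a = cech_class b <-> cech_rel id a b.
Proof. by split=> [/eqquotP/asboolP|ab]; last exact/eqquotP/asboolP. Qed.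

Lemma cech_repr {X : topologicalType} k (x : cech_cohomology X k) :
  cech_class (repr x) = x.
Proof. exact: reprK. Qed.

Definition cover_full (X : topologicalType) : open_cover X.
Proof.
exists [set setT] => [U ->|x]; first exact: openT.
by exists setT.
Defined.

Lemma cocycle0_subproof (X : topologicalType) k :
  is_cocycle (cover_full X) k (fun=> 0).
Proof. by move=> s _; rewrite coboundary0. Qed.

Definition cocycle0 X k := Cocycle (@cocycle0_subproof X k).

Lemma is_cocycleN {X : topologicalType} (S : set (set X)) k c :
  is_cocycle S k c -> is_cocycle S k (fun s => - c s).
Proof. by move=> cS s /cS; rewrite coboundaryN => ->; rewrite oppr0. Qed.

Lemma is_cocycleD {X : topologicalType} (S : set (set X)) k c d :
  is_cocycle S k c -> is_cocycle S k d -> is_cocycle S k (fun s => c s + d s).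
Proof. by move=> cS dS s sS; rewrite coboundaryD cS ?dS ?addr0. Qed.

Definition cocycleN {X : topologicalType} k (a : cocycle X k) : cocycle X k :=
  Cocycle (is_cocycleN (@cocycleP _ _ a)).

Definition cocycleD {X : topologicalType} k (a b : cocycle X k) : cocycle X k :=
  Cocycle (is_cocycleD
    (is_cocycle_map (@meet_leftP _ (cocycle_cover a) (cocycle_cover b))
       (@cocycleP _ _ a))
    (is_cocycle_map (@meet_rightP _ (cocycle_cover a) (cocycle_cover b))
       (@cocycleP _ _ b))).

Lemma refines_meet {X Y : topologicalType} (f : X -> Y) S T W p q :
  refines f W (cover_sets S) p -> refines f W (cover_sets T) q ->
  refines f W (cover_meet S T) (fun V => p V `&` q V).
Proof.
move=> pf qf V WV; have [Sp Vp] := pf V WV; have [Tq Vq] := qf V WV; split.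
  by exists (p V) => //; exists (q V).
by move=> x Vx; split; [exact: Vp|exact: Vq].
Qed.

Lemma cech_relD {X Y : topologicalType} (f : X -> Y) k
    (a a' : cocycle Y k) (b b' : cocycle X k) :
  cech_rel f a b -> cech_rel f a' b' ->
  cech_rel f (cocycleD a a') (cocycleD b b').
Proof.
move=> [S1 [p1 [q1 [pa qb e]]]] [S2 [p2 [q2 [pa' qb' e']]]].
have r1 := @meet_leftP _ S1 S2; have r2 := @meet_rightP _ S1 S2.
have {}pa := refines_comp r1 pa; have {}qb := refines_comp r1 qb.
have {}pa' := refines_comp r2 pa'; have {}qb' := refines_comp r2 qb'.
have P := refines_meet pa pa'; have Q := refines_meet qb qb'.
do 3 eexists; split; [exact: P|exact: Q|].
have {}e := is_coboundary_map r1 e; have {}e' := is_coboundary_map r2 e'.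
have c1 := contiguous (refines_comp P (@meet_leftP _ _ _)) pa (@cocycleP _ _ a).
have c2 := contiguous (refines_comp P (@meet_rightP _ _ _)) pa' (@cocycleP _ _ a').
have c3 := contiguous qb (refines_comp Q (@meet_leftP _ _ _)) (@cocycleP _ _ b).
have c4 := contiguous qb' (refines_comp Q (@meet_rightP _ _ _)) (@cocycleP _ _ b').
apply: eq_is_coboundary (is_coboundaryD (is_coboundaryD (is_coboundaryD c1 e) c3)
  (is_coboundaryD (is_coboundaryD c2 e') c4)) => s /=.
by rewrite -!map_comp; ring.
Qed.

Lemma cech_relN {X Y : topologicalType} (f : X -> Y) k
    (a : cocycle Y k) (b : cocycle X k) :
  cech_rel f a b -> cech_rel f (cocycleN a) (cocycleN b).
Proof.
move=> [S [p [q [pa qb /is_coboundaryN ab]]]]; exists S, p, q; split=> //.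
by apply: eq_is_coboundary ab => s /=; rewrite opprB opprK addrC.
Qed.

Lemma cech_addA_subproof {X : topologicalType} k (a b c : cocycle X k) :
  cech_rel id (cocycleD a (cocycleD b c)) (cocycleD (cocycleD a b) c).
Proof.
set A := cocycle_cover a; set B := cocycle_cover b; set C := cocycle_cover c.
have l := @meet_leftP _ A (cover_meet B C).
have r := @meet_rightP _ A (cover_meet B C).
have rl := refines_comp r (@meet_leftP _ B C).
have rr := refines_comp r (@meet_rightP _ B C).
have Ql := refines_meet l rl; have Q := refines_meet Ql rr.
exists (cover_meet A (cover_meet B C)); do 2 eexists.
split; [exact: refines_id|exact: Q|].
have Q1 := refines_comp Q (@meet_leftP _ _ _).
have c1 := contiguous l (refines_comp Q1 (@meet_leftP _ _ _)) (@cocycleP _ _ a).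
have c2 := contiguous rl (refines_comp Q1 (@meet_rightP _ _ _)) (@cocycleP _ _ b).
have c3 := contiguous rr (refines_comp Q (@meet_rightP _ _ _)) (@cocycleP _ _ c).
apply: eq_is_coboundary (is_coboundaryD (is_coboundaryD c1 c2) c3) => s /=.
by rewrite map_id -!map_comp; ring.
Qed.

Lemma cech_addC_subproof {X : topologicalType} k (a b : cocycle X k) :
  cech_rel id (cocycleD a b) (cocycleD b a).
Proof.
set A := cocycle_cover a; set B := cocycle_cover b.
have l := @meet_leftP _ A B; have r := @meet_rightP _ A B.
have Q := refines_meet r l.
exists (cover_meet A B); do 2 eexists; split; [exact: refines_id|exact: Q|].
have c1 := contiguous l (refines_comp Q (@meet_rightP _ _ _)) (@cocycleP _ _ a).
have c2 := contiguous r (refines_comp Q (@meet_leftP _ _ _)) (@cocycleP _ _ b).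
apply: eq_is_coboundary (is_coboundaryD c1 c2) => s /=.
by rewrite map_id -!map_comp; ring.
Qed.

Lemma cech_add0_subproof {X : topologicalType} k (a : cocycle X k) :
  cech_rel id (cocycleD (cocycle0 X k) a) a.
Proof.
exists (cover_meet (cover_full X) (cocycle_cover a)); do 2 eexists.
split; [exact: refines_id|exact: meet_rightP|].
by apply: is_coboundary0 => s /=; rewrite map_id add0r subrr.
Qed.

Lemma cech_addN_subproof {X : topologicalType} k (a : cocycle X k) :
  cech_rel id (cocycleD (cocycleN a) a) (cocycle0 X k).
Proof.
set A := cocycle_cover a.
have l := @meet_leftP _ A A; have r := @meet_rightP _ A A.
exists (cover_meet A A), id, (fun=> setT); split; [exact: refines_id|by []|].
apply: eq_is_coboundary (contiguous r l (@cocycleP _ _ a)) => s /=.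
by rewrite map_id subr0 addrC.
Qed.

Section CechGroup.
Context {X : topologicalType} {k : nat}.
Implicit Types x y z : cech_cohomology X k.

Definition cech_zero : cech_cohomology X k := cech_class (cocycle0 X k).

Definition cech_opp x : cech_cohomology X k := cech_class (cocycleN (repr x)).

Definition cech_add x y : cech_cohomology X k :=
  cech_class (cocycleD (repr x) (repr y)).

Lemma cech_rel_repr (a : cocycle X k) : cech_rel id (repr (cech_class a)) a.
Proof. by apply/cech_classP; rewrite cech_repr. Qed.

Lemma cech_addE (a b : cocycle X k) :
  cech_add (cech_class a) (cech_class b) = cech_class (cocycleD a b).
Proof. by apply/cech_classP/cech_relD; exact: cech_rel_repr. Qed.

Lemma cech_oppE (a : cocycle X k) :
  cech_opp (cech_class a) = cech_class (cocycleN a).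
Proof. by apply/cech_classP/cech_relN; exact: cech_rel_repr. Qed.

Lemma cech_addA : associative cech_add.
Proof.
move=> x y z; rewrite -[x]cech_repr -[y]cech_repr -[z]cech_repr !cech_addE.
exact/cech_classP/cech_addA_subproof.
Qed.

Lemma cech_addC : commutative cech_add.
Proof.
move=> x y; rewrite -[x]cech_repr -[y]cech_repr !cech_addE.
exact/cech_classP/cech_addC_subproof.
Qed.

Lemma cech_add0 : left_id cech_zero cech_add.
Proof.
move=> x; rewrite -[x]cech_repr cech_addE.
exact/cech_classP/cech_add0_subproof.
Qed.

Lemma cech_addN : left_inverse cech_zero cech_opp cech_add.
Proof.
move=> x; rewrite -[x]cech_repr cech_oppE cech_addE.
exact/cech_classP/cech_addN_subproof.
Qed.

HB.instance Definition _ := GRing.isZmodule.Build (cech_cohomology X k)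
  cech_addA cech_addC cech_add0 cech_addN.

End CechGroup.

Section Pullback.
Context {X Y : topologicalType} (f : continuousType X Y).

Section PullbackCover.
Context (S : open_cover Y).

Let pullback_sets : set (set X) :=
  [set f @^-1` U | U in cover_sets S].

Let pullback_open V : pullback_sets V -> open V.
Proof.
move=> [U /cover_open oU <-]; move/continuousP: (@cts_fun _ _ f); exact.
Qed.

Let pullback_covers x : exists2 V, pullback_sets V & V x.
Proof.
have [U SU Ufx] := cover_covers S (f x).
by exists (f @^-1` U) => //; exists U.
Qed.

Definition cover_pullback := OpenCover pullback_open pullback_covers.

Definition pullback_proj (V : set X) : set Y :=
  xget setT [set U | cover_sets S U /\ V `<=` f @^-1` U].

Lemma pullback_projP : refines f cover_pullback S pullback_proj.
Proof.
move=> V [U SU <-]; rewrite /pullback_proj.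
by case: xgetP => [Z _ //|] /(_ U) []; split.
Qed.

End PullbackCover.

Definition cocycle_pullback k (a : cocycle Y k) : cocycle X k :=
  Cocycle (is_cocycle_map (@pullback_projP (cocycle_cover a)) (@cocycleP _ _ a)).

Lemma cech_rel_pullback k (a : cocycle Y k) : cech_rel f a (cocycle_pullback a).
Proof.
exists (cover_pullback (cocycle_cover a)); do 2 eexists.
split; [exact: pullback_projP|exact: refines_id|].
by apply: is_coboundary0 => s /=; rewrite map_id subrr.
Qed.

Definition cech_map k (x : cech_cohomology Y k) : cech_cohomology X k :=
  cech_class (cocycle_pullback (repr x)).

Lemma cech_rel_eq k (a a' : cocycle Y k) (b b' : cocycle X k) :
  cech_rel id a a' -> cech_rel f a b -> cech_rel f a' b' -> cech_rel id b b'.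
Proof.
move=> [S0 [p0 [q0 [pa0 qa0 e0]]]] [S1 [p1 [q1 [pa1 qb1 e1]]]].
move=> [S2 [p2 [q2 [pa2 qb2 e2]]]].
have u := @meet_leftP _ (cover_meet S1 S2) (cover_pullback S0).
have u1 := refines_comp u (@meet_leftP _ S1 S2).
have u2 := refines_comp u (@meet_rightP _ S1 S2).
have u0 := refines_comp (@meet_rightP _ (cover_meet S1 S2) (cover_pullback S0))
  (@pullback_projP S0).
do 3 eexists; split; [exact: refines_comp u1 qb1|exact: refines_comp u2 qb2|].
have c1 := contiguous (refines_comp u1 pa1) (refines_comp u0 pa0) (@cocycleP _ _ a).
have c2 := contiguous (refines_comp u0 qa0) (refines_comp u2 pa2) (@cocycleP _ _ a').
have {}e0 := is_coboundary_map u0 e0.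
have {}e1 := is_coboundary_map u1 e1; have {}e2 := is_coboundary_map u2 e2.
have E := is_coboundaryD (is_coboundaryD (is_coboundaryB c1 e1) e0)
  (is_coboundaryD c2 e2).
by apply: eq_is_coboundary E => s /=; rewrite -!map_comp; ring.
Qed.

Lemma cech_mapE k (a : cocycle Y k) (b : cocycle X k) :
  cech_rel f a b -> cech_map (cech_class a) = cech_class b.
Proof.
move=> ab; apply/cech_classP.
exact: cech_rel_eq (cech_rel_repr a) (cech_rel_pullback _) ab.
Qed.

Lemma cech_map_is_zmod_morphism k : zmod_morphism (@cech_map k).
Proof.
move=> x y; rewrite -[x]cech_repr -[y]cech_repr.
rewrite -[- cech_class (repr y)]/(cech_opp _) cech_oppE.
rewrite -[cech_class _ + _]/(cech_add _ _) cech_addE.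
rewrite (cech_mapE (cech_rel_pullback (repr x))).
rewrite (cech_mapE (cech_rel_pullback (repr y))).
rewrite -[- cech_class _]/(cech_opp _) cech_oppE.
rewrite -[cech_class _ + _]/(cech_add _ _) cech_addE.
by apply/cech_mapE/cech_relD/cech_relN; exact: cech_rel_pullback.
Qed.

HB.instance Definition _ k := GRing.isZmodMorphism.Build
  (cech_cohomology Y k) (cech_cohomology X k) (@cech_map k)
  (@cech_map_is_zmod_morphism k).

End Pullback.

End CechCohomology.

Arguments cech_cohomology : clear implicits.
Arguments cech_map G {X Y} f k x.

Section Inclusion.
Context {M : topologicalType} {A B : set M} (AB : A `<=` B).

Definition inclusion (x : A) : B :=
  exist _ (set_val x) (mem_set (AB (set_valP x))).

Lemma inclusion_continuous : continuous inclusion.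
Proof.
apply/continuousP => _ [V oV <-].
by exists V.
Qed.

HB.instance Definition _ := isContinuous.Build A B inclusion inclusion_continuous.

(* [cech_map] is a group morphism (see its canonical instance), so bijectivity
   is isomorphy. The types [A] and [B] carry the subspace topology. *)
Definition inclusion_cech_iso (G : comNzRingType) : Prop :=
  forall k, bijective (cech_map G inclusion k).

End Inclusion.

(* Main.v *)
Require Import Defs.
From mathcomp Require Import all_boot all_order all_algebra.
From mathcomp Require Import all_classical all_reals all_analysis.
From mathcomp Require Import ring lra.

(* Cech cohomology of compacta is computed by Alexander-Spanier cochains modulo 2.
   Let [P_l(N)] be the set of points of [N] whose forward or backward orbit under
   the flow of parameter [l] stays in [N]. Sliding along the flow deforms [P_l(N)]
   into [K_l] while fixing [K_l], so both have the same cohomology; and [K_l] is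
   non-saddle exactly when [P_l(N)] is a neighbourhood of it. A Lyapunov function
   yields connected blocks [N' < N < N''] of [K_0], each in the interior of the next
   and equal to its [P_0].

   If [K_l] is non-saddle, then a connectedness argument gives [N' <= P_l(N)] and
   [N <= P_l(N'')], since points of the entrance set of a block still leave it
   backwards before reaching a compact part of its interior. Chasing restrictions
   along [K_0 <= N' <= P_l(N) <= N <= P_l(N'')] shows that [H(N) -> H(K_l)] is an
   isomorphism.

   Conversely, if [K_l] is saddle, some [x] near it leaves [N] in both directions,
   forwards without approaching the entrance set and backwards without approaching
   the exit set. Pushing the class of the point [x] along the two half orbits
   presents it as the coboundary of a cochain carried by either one, and the
   difference of these two cochains is a cocycle vanishing on [K_l], hence a
   coboundary on [N]. Cutting it off then makes the point class the coboundary of a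
   cochain with compact support in the interior of [N], which contradicts the
   existence of the fundamental class modulo 2. *)

Set Implicit Arguments.
Unset Strict Implicit.
Unset Printing Implicit Defensive.

Import Order.TTheory GRing.Theory Num.Theory.
Import numFieldNormedType.Exports.

Local Open Scope classical_set_scope.
Local Open Scope ring_scope.

(** The obstacle is that a block of one flow is in general no block for a nearby flow. What survives
    a perturbation is the open condition [passes], imposed on the compact entrance and exit sets
    relative to a compact part of the interior. It controls only that smaller part, whence the
    nested blocks. Cochains on tuples replace continuous homotopies by finite chains of maps with
    close images, which tolerate choices that are not continuous. Smallness of tuples is measured by
    a pseudometric attached to one compact set at a time, a sum of chart coordinates cut off by bump
    functions. The fundamental class enters only through its effect: local degrees of compactly
    supported cocycles of top degree add up to zero when the cocycles do. Modulo 2 the compactly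
    supported top cohomology of a convex chart has a single nonzero class, so degrees in different
    charts agree without any orientation. *)

Lemma F2_01 (x : 'F_2) : x = 0 \/ x = 1.
Proof.
case: x => [[|[|k]]] // lt_k; [left|right]; exact: val_inj.
Qed.

Lemma addF2 (x : 'F_2) : x + x = 0.
Proof. by case: (F2_01 x) => ->; exact: val_inj. Qed.

Lemma oppF2 (x : 'F_2) : - x = x.
Proof. by apply/eqP; rewrite eq_sym -addr_eq0 addF2. Qed.

Lemma addF2_eq (x y : 'F_2) : x + y = 0 -> x = y.
Proof. by move/eqP; rewrite addr_eq0 oppF2 => /eqP. Qed.


Ltac f2case x := case: (F2_01 x) => ->.
Ltac f2done := by apply: val_inj; vm_compute.

(** * Mod 2 cochains *)

Section Cochains.
Context {T : choiceType}.
Implicit Types (f g : seq T -> 'F_2) (s t : seq T) (th : T -> bool).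

Lemma coboundaryK f s : coboundary (coboundary f) s = 0.
Proof.
elim: s f => [|x s IH] f; first by rewrite /coboundary big_ord0.
rewrite coboundary_cons (eq_coboundary s (c := fun r => coboundary f (x :: r))
  (d := fun r => f r + - coboundary (fun r => f (x :: r)) r)).
  by rewrite coboundaryD coboundaryN IH oppr0 addr0 subrr.
by move=> r; rewrite coboundary_cons.
Qed.

Lemma coboundary_nil f : coboundary f [::] = 0.
Proof. by rewrite /coboundary big_ord0. Qed.

Lemma coboundary_sum I (r : seq I) (P : pred I) (F : I -> seq T -> 'F_2) s :
  coboundary (fun t => \sum_(i <- r | P i) F i t) s =
  \sum_(i <- r | P i) coboundary (F i) s.
Proof.
elim: r => [|i r IH].
  rewrite big_nil -[RHS](coboundary0 s).
  by apply: eq_coboundary => t; rewrite big_nil.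
rewrite big_cons -IH; case: ifP => Pi.
  by rewrite -coboundaryD; apply: eq_coboundary => t; rewrite big_cons Pi.
by apply: eq_coboundary => t; rewrite big_cons Pi.
Qed.

Lemma size_face i s : (i < size s)%N -> size (take i s ++ drop i.+1 s) = (size s).-1.
Proof.
move=> lt_is; rewrite size_cat size_take size_drop lt_is.
by rewrite subnS; case: (size s) lt_is => // k lt_ik; rewrite subSn //= subnKC.
Qed.

Lemma mem_face i s x : x \in take i s ++ drop i.+1 s -> x \in s.
Proof. by rewrite mem_cat => /orP[/mem_take|/mem_drop]. Qed.

Lemma coboundary_eq_faces f g s :
  (forall i, (i < size s)%N ->
     f (take i s ++ drop i.+1 s) = g (take i s ++ drop i.+1 s)) ->
  coboundary f s = coboundary g s.
Proof. by move=> fg; apply: eq_bigr => i _; rewrite fg. Qed.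

(* [hom k f] says that [f] has degree [k - 1]; it vanishes on the empty tuple, so
   that the resulting cohomology is not reduced. *)
Definition hom k f := forall s, ~~ ((size s == k) && (0 < k)%N) -> f s = 0.

Lemma hom_nil k f : hom k f -> f [::] = 0.
Proof. by apply; case: k. Qed.

Lemma hom0 f : hom 0 f -> forall s, f s = 0.
Proof. by move=> h s; apply: h; rewrite andbF. Qed.

Lemma homD k f g : hom k f -> hom k g -> hom k (fun s => f s + g s).
Proof. by move=> hf hg s h; rewrite hf ?hg ?addr0. Qed.

Lemma hom_zero k : hom k (fun=> 0).
Proof. by []. Qed.

Lemma hom_sum k I (r : seq I) (F : I -> seq T -> 'F_2) :
  (forall i, hom k (F i)) -> hom k (fun s => \sum_(i <- r) F i s).
Proof. by move=> hF s h; apply: big1 => i _; exact: hF. Qed.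

Lemma hom_coboundary k f : hom k f -> hom k.+1 (coboundary f).
Proof.
move=> hf s; rewrite andbT => sk; apply: big1 => i _.
rewrite hf ?mulr0// size_face//.
have s_gt0 : (0 < size s)%N by exact: leq_ltn_trans (ltn_ord i).
by move: sk; rewrite -(prednK s_gt0) eqSS => /negbTE ->.
Qed.

(** Multiplication by the 0-cochain [th], evaluated at the first entry. It serves as a cutoff
    function: its jumps are harmless, since its failure to commute with the coboundary, namely
    [cup], lives only on tuples across which [th] changes. *)
Definition cut th f s : 'F_2 :=
  if s is x :: _ then if th x then f s else 0 else 0.

Lemma cut_neq0 th f s : cut th f s != 0 -> f s != 0.
Proof. by case: s => [|x s] /=; rewrite ?eqxx//; case: ifP; rewrite ?eqxx. Qed.

Lemma hom_cut k th f : hom k f -> hom k (cut th f).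
Proof.
by move=> hf [|x s] h //=; case: ifP => // _; apply: hf.
Qed.

Lemma cutD th f g s : cut th (fun t => f t + g t) s = cut th f s + cut th g s.
Proof. by case: s => [|x s] /=; rewrite ?addr0//; case: ifP; rewrite ?addr0. Qed.

Lemma eq_cut th f g s : f s = g s -> cut th f s = cut th g s.
Proof. by case: s => //= x s ->. Qed.

(* The cup product of the 1-cocycle [coboundary th] with [f], written as a
   commutator (signs are irrelevant modulo 2). *)
Definition cup th f s := coboundary (cut th f) s + cut th (coboundary f) s.

Lemma cup_nil th f : cup th f [::] = 0.
Proof. by rewrite /cup coboundary_nil add0r. Qed.

Lemma cup_cons th f x s : cup th f (x :: s) =
  cut th f s + (if th x then f s else 0).
Proof.
rewrite /cup coboundary_cons /= coboundary_cons.
case: (th x).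
  by rewrite !oppF2 addrACA addF2 addr0.
by rewrite coboundary0 subr0.
Qed.

Lemma cup_cons2 th f x y s : cup th f (x :: y :: s) =
  if th x (+) th y then f (y :: s) else 0.
Proof. by rewrite cup_cons /=; case: (th x); case: (th y); rewrite ?addr0 ?add0r ?addF2. Qed.

Lemma cup_neq0 th f s : f [::] = 0 -> cup th f s != 0 ->
  exists x y r, [/\ s = x :: y :: r, th x != th y & f (y :: r) != 0].
Proof.
move=> f0; case: s => [|x [|y r]]; rewrite ?cup_nil ?eqxx//.
  by rewrite cup_cons /= f0; case: ifP; rewrite ?addr0 ?eqxx.
rewrite cup_cons2; case E: (th x (+) th y); rewrite ?eqxx// => fy.
by exists x, y, r; split=> //; rewrite -addbT; move: E; case: (th x); case: (th y).
Qed.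

Lemma cupD th f g s : cup th (fun t => f t + g t) s = cup th f s + cup th g s.
Proof.
rewrite /cup (eq_coboundary s (d := fun t => cut th f t + cut th g t)); last first.
  by move=> t; rewrite cutD.
rewrite coboundaryD (_ : cut th (coboundary _) s = cut th (coboundary f) s +
  cut th (coboundary g) s); last by rewrite -cutD; apply: eq_cut; rewrite coboundaryD.
by rewrite addrACA.
Qed.

Lemma cup_sum I (r : seq I) th (F : I -> seq T -> 'F_2) s :
  cup th (fun t => \sum_(i <- r) F i t) s = \sum_(i <- r) cup th (F i) s.
Proof.
elim: r => [|i r IH].
  rewrite big_nil; case: s => [|x [|y s]]; rewrite ?cup_nil//.
    by rewrite cup_cons /= big_nil if_same addr0.
  by rewrite cup_cons2 big_nil if_same.
rewrite big_cons -IH -cupD; congr (cup th _ s).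
by apply/funext => t; rewrite big_cons.
Qed.

(** The Leibniz rule modulo 2. *)
Lemma coboundary_cut th f s : coboundary (cut th f) s = cup th f s + cut th (coboundary f) s.
Proof. by rewrite /cup -addrA addF2 addr0. Qed.

Lemma hom_cup k th f : hom k f -> hom k.+1 (cup th f).
Proof.
by move=> hf; apply: homD; [apply/hom_coboundary/hom_cut|apply/hom_cut/hom_coboundary].
Qed.

(** A commutator with the coboundary commutes with it, because the coboundary squares to zero. *)
Lemma coboundary_cup th f s :
  coboundary (cup th f) s = cup th (coboundary f) s.
Proof.
rewrite /cup coboundaryD coboundaryK add0r -[LHS]addr0 -[in RHS]/(cut th _ s).
rewrite -[X in _ + X](_ : cut th (coboundary (coboundary f)) s = 0)//.
by case: s => //= x s; rewrite coboundaryK if_same.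
Qed.
End Cochains.

(** * Prism operators and discrete homotopies *)

Section Prisms.
Context {T U : choiceType}.
Implicit Types (f : seq U -> 'F_2) (s : seq T).

(** This is how supports pass through homotopies: a nonzero prism exhibits one tuple of interpolated
    entries, and the last clause lets a bound on the entries of [t] be read back at every entry of
    [s]. *)
Lemma prism_neq0 (p q : T -> U) f s : prism p q f s != 0 ->
  exists t, [/\ f t != 0, size t = (size s).+1,
    forall y, y \in t -> exists2 x, x \in s & y = p x \/ y = q x &
    forall x, x \in s -> p x \in t \/ q x \in t].
Proof.
move=> nz; apply: contrapT => no_t; move/negP: nz; apply; apply/eqP.
apply: prism_eq0 => a x b sE; apply: contrapT => /eqP ft; apply: no_t.
 exists (map p a ++ p x :: q x :: map q b); split=> //.
- by rewrite sE !size_cat /= !size_map !addnS.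
- move=> y; rewrite mem_cat !inE => /or4P[/mapP[z za ->]|/eqP->|/eqP->|/mapP[z zb ->]].
  + by exists z; [rewrite sE mem_cat za|left].
  + by exists x; [rewrite sE mem_cat mem_head orbT|left].
  + by exists x; [rewrite sE mem_cat mem_head orbT|right].
  + by exists z; [rewrite sE mem_cat inE zb !orbT|right].
- move=> z; rewrite sE mem_cat inE => /or3P[za|/eqP->|zb].
  + by left; rewrite mem_cat map_f.
  + by left; rewrite mem_cat mem_head orbT.
  + by right; rewrite mem_cat !inE map_f ?orbT.
Qed.

Lemma hom_prism k (p q : T -> U) f : hom k.+1 f -> hom k (prism p q f).
Proof.
move=> hf s; apply: contraNeq => /[dup] nz /prism_neq0[t [ft st _ _]].
have : (size t == k.+1) && (0 < k.+1)%N.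
  by apply: contraT => /hf ft0; rewrite ft0 eqxx in ft.
rewrite st eqSS => /andP[/eqP <- _].
by rewrite eqxx; case: s nz {st} => //=; rewrite eqxx.
Qed.

(** The homotopy operator of a chain of maps; later uses only ask that consecutive maps have close
    images, not that they be continuous. *)
Definition prisms (g : nat -> T -> U) N f s : 'F_2 :=
  \sum_(i < N) prism (g i) (g i.+1) f s.

Lemma hom_prisms k g N f : hom k.+1 f -> hom k (prisms g N f).
Proof. by move=> hf; apply: hom_sum => i; apply: hom_prism. Qed.

Lemma prisms_homotopy g N f s :
  coboundary (prisms g N f) s + prisms g N (coboundary f) s =
  f (map (g N) s) + f (map (g 0%N) s).
Proof.
elim: N => [|N IH].
  rewrite /prisms big_ord0 addF2 addr0 -[RHS](coboundary0 s).
  by apply: eq_coboundary => t; rewrite big_ord0.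
rewrite /prisms (eq_coboundary s (d := fun t => prisms g N f t + prism (g N) (g N.+1) f t)).
  rewrite big_ord_recr /= coboundaryD addrACA IH prism_homotopy.
  rewrite oppF2 addrACA [X in X = _]addrC addrA -[X in _ = X]add0r.
  by f2case (f (map (g N) s)); f2case (f (map (g N.+1) s)); f2case (f (map (g 0%N) s)); f2done.
by move=> t; rewrite big_ord_recr.
Qed.

Lemma prisms_neq0 g N f s : prisms g N f s != 0 ->
  exists2 i, (i < N)%N & prism (g i) (g i.+1) f s != 0.
Proof.
move=> nz; apply: contrapT => no_i; move/negP: nz; apply; apply/eqP.
by apply: big1 => i _; apply: contrapT => /eqP nz; apply: no_i; exists i.
Qed.
End Prisms.

(** * Germs of cochains on small tuples *)

Section Germs.
Context {R : realType} {T : choiceType} (d : T -> T -> R).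
Implicit Types (X : set T) (P Q : seq T -> Prop) (f g : seq T -> 'F_2).

Definition small (r : R) (s : seq T) := forall x y, x \in s -> y \in s -> d x y < r.

(* Alexander-Spanier cochains are functions on tuples, considered up to equality
   on the tuples of small diameter. *)
Definition germ X P := exists2 r : R, 0 < r &
  forall s, (forall x, x \in s -> X x) -> small r s -> P s.

Lemma small_le r r' s : r <= r' -> small r s -> small r' s.
Proof. by move=> rr' ss x y xs ys; apply: lt_le_trans rr'; apply: ss. Qed.

Lemma small_sub r s t : {subset t <= s} -> small r s -> small r t.
Proof. by move=> ts ss x y /ts xs /ts ys; apply: ss. Qed.

Lemma small_seq1 r x : d x x < r -> small r [:: x].
Proof. by move=> xr y z; rewrite !mem_seq1 => /eqP-> /eqP->. Qed.

Lemma germW X P : (forall s, P s) -> germ X P.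
Proof. by move=> hP; exists 1. Qed.

Lemma germS X P Q : (forall s, (forall x, x \in s -> X x) -> P s -> Q s) ->
  germ X P -> germ X Q.
Proof. by move=> PQ [r r0 rP]; exists r => // s sX ss; apply: PQ => //; apply: rP. Qed.

Lemma germI X P Q : germ X P -> germ X Q -> germ X (fun s => P s /\ Q s).
Proof.
move=> [r r0 rP] [q q0 qQ]; exists (Num.min r q); first by rewrite lt_min r0.
move=> s sX ss; split; [apply: rP|apply: qQ] => //.
- by apply: small_le ss; rewrite ge_min lexx.
- by apply: small_le ss; rewrite ge_min lexx orbT.
Qed.

Lemma germ_subset X Y P : X `<=` Y -> germ Y P -> germ X P.
Proof. by move=> XY [r r0 rP]; exists r => // s sX; apply: rP => x /sX/XY. Qed.

(** Subtuples of small tuples are small, so a property of germs may be used on all faces at once. *)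
Lemma germ_sub X P : germ X P -> germ X (fun s => forall t, {subset t <= s} -> P t).
Proof.
move=> [r r0 rP]; exists r => // s sX ss t ts; apply: rP.
  by move=> x /ts/sX.
exact: small_sub ss.
Qed.

Lemma germ_small X r : 0 < r -> germ X (small r).
Proof. by move=> r0; exists r. Qed.

Lemma germ_mem X : germ X (fun s => forall x, x \in s -> X x).
Proof. by exists 1. Qed.

Lemma germ_coboundary X f g : germ X (fun s => f s = g s) ->
  germ X (fun s => coboundary f s = coboundary g s).
Proof.
move=> /germ_sub; apply: germS => s _ fg; apply: coboundary_eq_faces => i _.
by apply: fg => x; apply: mem_face.
Qed.

(* A face of a tuple is empty only if the tuple has one element, whence the
   role of the hypothesis on [f [::]]. *)
Lemma coboundary_neq0 f s : f [::] = 0 -> coboundary f s != 0 ->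
  exists t, [/\ f t != 0, t != [::], {subset t <= s} & size t = (size s).-1].
Proof.
move=> f0 nz; apply: contrapT => no_t; move/negP: nz; apply; apply/eqP.
apply: big1 => i _.
have [//|/eqP ft] := f (take i s ++ drop i.+1 s) =P 0; first by move=> ->; rewrite mulr0.
case: no_t; exists (take i s ++ drop i.+1 s); split=> //.
- by apply: contraNneq ft => ->; rewrite f0.
- by move=> x; apply: mem_face.
- exact: size_face.
Qed.

Definition supp X f (D : set T) :=
  germ X (fun s => f s != 0 -> forall x, x \in s -> D x).
End Germs.

(** * Compactly supported cohomology of Euclidean space *)

Section Euclidean.
Context {R : realType} {n : nat}.
Notation E := 'rV[R]_n.
Implicit Types (x y c p : E) (s t : seq E) (f g : seq E -> 'F_2) (X W D : set E).

Definition dist x y : R := `|x - y|.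

Lemma dist_sym x y : dist x y = dist y x.
Proof. exact: distrC. Qed.

Lemma dist_xx x : dist x x = 0.
Proof. by rewrite /dist subrr normr0. Qed.

Lemma dist_tri x y z : dist x z <= dist x y + dist y z.
Proof. exact: ler_distD. Qed.

Lemma coord_le x (i : 'I_n) : `|x 0 i| <= `|x|.
Proof.
rewrite [leRHS]mx_normrE.
exact: (le_bigmax _ (fun ij => `|x ij.1 ij.2|) (0, i)).
Qed.

Lemma norm_lt x r : 0 < r -> (forall i, `|x 0 i| < r) -> `|x| < r.
Proof.
move=> r0 xr; rewrite [ltLHS]mx_normrE; apply/bigmax_ltP; split=> // -[j i] _ /=.
by rewrite ord1.
Qed.

Lemma norm_le x r : 0 <= r -> (forall i, `|x 0 i| <= r) -> `|x| <= r.
Proof.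
move=> r0 xr; rewrite [leLHS]mx_normrE; apply/bigmax_leP; split=> // -[j i] _ /=.
by rewrite ord1.
Qed.

Lemma dist_coord x y i : `|x 0 i - y 0 i| <= dist x y.
Proof. by have := coord_le (x - y) i; rewrite !mxE. Qed.

Definition upd (i : 'I_n) (a : R) x : E := \row_j (if j == i then a else x 0 j).

Lemma upd_i i a x : upd i a x 0 i = a. Proof. by rewrite mxE eqxx. Qed.

Lemma upd_neq i a x j : j != i -> upd i a x 0 j = x 0 j.
Proof. by rewrite mxE => /negbTE ->. Qed.

Lemma dist_upd_id i a x : dist x (upd i a x) = `|x 0 i - a|.
Proof.
apply/eqP; rewrite eq_le; apply/andP; split.
  apply: norm_le => // j; rewrite !mxE; have [E1|_] := eqVneq j i; [by rewrite E1|].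
  by rewrite subrr normr0.
by have := dist_coord x (upd i a x) i; rewrite upd_i.
Qed.

Lemma dist_upd2 i a b x y : dist (upd i a x) (upd i b y) <= Num.max (dist x y) `|a - b|.
Proof.
apply: norm_le; first by rewrite le_max normr_ge0.
move=> j; rewrite !mxE; have [_|ji] := eqVneq j i; first by rewrite le_max lexx orbT.
by rewrite le_max dist_coord.
Qed.

Lemma dist_upd i a x y : dist (upd i a x) (upd i a y) <= dist x y.
Proof.
by apply: le_trans (dist_upd2 i a a x y) _; rewrite subrr normr0 ge_max lexx normr_ge0.
Qed.

Definition shift (v : E) (b : R) x : E := x + b *: v.

Lemma dist_shift v b x y : dist (shift v b x) (shift v b y) = dist x y.
Proof. by rewrite /dist /shift opprD addrACA subrr addr0. Qed.

Lemma dist_shift2 v b b' x y :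
  dist (shift v b x) (shift v b' y) <= dist x y + `|b - b'| * `|v|.
Proof.
rewrite /dist /shift opprD addrACA -scalerBl -normrZ; exact: ler_normD.
Qed.

(* Coordinates are indexed by [nat] so as to recur on them. *)
Definition co x (m : nat) : R := if insub m is Some i then x 0 i else 0.

Lemma coE x (i : 'I_n) : co x i = x 0 i. Proof. by rewrite /co valK. Qed.

Lemma co_dist x y m : `|co x m - co y m| <= dist x y.
Proof.
by rewrite /co; case: insubP => [i _ _|_]; rewrite ?dist_coord// subr0 normr0 normr_ge0.
Qed.

Definition above c m x : bool := co c m <= co x m.

(* The class of a point: [point_cocycle c m] represents the generator of the
   compactly supported cohomology of the first [m] coordinates, namely the cup
   product of the jumps at [c] of the coordinate half-spaces. *)
Fixpoint point_cocycle c m s : 'F_2 :=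
  if m is k.+1 then coboundary (cut (above c k) (point_cocycle c k)) s
  else (size s == 1%N)%:R.

Lemma hom_point_cocycle c m : hom m.+1 (point_cocycle c m).
Proof.
elim: m => [|m IH]; first by move=> s; rewrite andbT => /negbTE /= ->.
exact/hom_coboundary/hom_cut.
Qed.

Lemma coboundary_point_cocycle c m s : coboundary (point_cocycle c m) s = 0.
Proof.
case: m => [|m]; last exact: coboundaryK.
case: s => [|x [|y [|z s]]]; rewrite ?coboundary_nil//.
- by rewrite coboundary_cons coboundary_nil subr0.
- by rewrite !coboundary_cons coboundary_nil subr0 subrr.
- apply: big1 => i _ /=; have := size_face (ltn_ord i).
  by case: (_ ++ _) => [//|u [//|v t]] /= _; rewrite mulr0.
Qed.

Lemma point_cocycleS c m : point_cocycle c m.+1 =1 cup (above c m) (point_cocycle c m).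
Proof.
move=> s; rewrite /= coboundary_cut (_ : cut _ (coboundary _) s = 0) ?addr0//.
by case: s => //= x s; rewrite coboundary_point_cocycle if_same.
Qed.

Lemma point_cocycle_ext c c' m : (forall i, (i < m)%N -> co c i = co c' i) ->
  point_cocycle c m =1 point_cocycle c' m.
Proof.
elim: m => [//|m IH] cc' s /=; apply: eq_coboundary => -[//|x r] /=.
by rewrite /above cc'// IH// => i im; apply/cc'/ltnW.
Qed.

(** The cocycle sees coordinates only through their comparison with those of its base point. *)
Lemma point_cocycle_map c c' m (h : E -> E) s :
  (forall x i, (i < m)%N -> (co c i <= co (h x) i) = (co c' i <= co x i)) ->
  point_cocycle c m (map h s) = point_cocycle c' m s.
Proof.
elim: m s => [|m IH] s hh; first by rewrite /= size_map.
rewrite /= -coboundary_map; apply: eq_coboundary => -[//|x r] /=.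
rewrite /above hh// -[h x :: _]/(map h (x :: r)) IH// => y i im.
exact/hh/ltnW.
Qed.

(** A nonzero cup product needs a jump of every factor. *)
Lemma point_cocycle_cross c m s i : point_cocycle c m s != 0 -> (i < m)%N ->
  exists u w, [/\ u \in s, w \in s & above c i u != above c i w].
Proof.
elim: m s => [//|m IH] s; rewrite point_cocycleS => nz.
have [y [z [t [-> yz pz]]]] := cup_neq0 (hom_nil (@hom_point_cocycle c m)) nz.
rewrite ltnS leq_eqVlt => /predU1P[->|im].
  by exists y, z; rewrite mem_head inE mem_head orbT.
by have [u [w [ut wt uw]]] := IH _ pz im; exists u, w; split; rewrite // inE ?ut ?wt orbT.
Qed.

Lemma above_cross c i r x u w : dist x u < r -> dist x w < r ->
  above c i u != above c i w -> `|co x i - co c i| < r.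
Proof.
move=> xu xw; have := co_dist x u i; have := co_dist x w i.
move=> /le_lt_trans/(_ xw); rewrite ltr_norml => /andP[w1 w2].
move=> /le_lt_trans/(_ xu); rewrite ltr_norml => /andP[u1 u2].
rewrite /above ltr_norml; have [cu|uc] := leP (co c i); have [cw|wc] := leP (co c i) => // _;
  apply/andP; lra.
Qed.

Lemma point_cocycle_near c m r s : small dist r s -> point_cocycle c m s != 0 ->
  forall x i, x \in s -> (i < m)%N -> `|co x i - co c i| < r.
Proof.
move=> ss nz x i xs im; have [u [w [us ws uw]]] := point_cocycle_cross nz im.
by apply: above_cross uw; apply: ss.
Qed.
End Euclidean.

Section CompactSupports.
Context {R : realType} {n : nat}.
Notation E := 'rV[R]_n.
Implicit Types (x y c p : E) (s t : seq E) (f g : seq E -> 'F_2) (X W D : set E).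

Definition bdd D := exists L : R, forall x, D x -> `|x| <= L.

(** Positive distance from the complement of [W]; together with [bdd] it stands for relative
    compactness in [W]. *)
Definition deep D W := exists2 r : R, 0 < r & forall x y, D x -> dist x y < r -> W y.

Definition fuzz (r : R) D : set E := [set y | exists2 x, D x & dist x y < r].

(* Compactness of the support is expressed metrically; the cochain is only
   considered on tuples in [X]. *)
Definition csE X W f := exists D, [/\ bdd D, deep D W & supp dist X f D].

Lemma bddU D D' : bdd D -> bdd D' -> bdd (D `|` D').
Proof.
move=> [L hL] [L' hL']; exists (Num.max L L') => x [/hL|/hL'] h.
  by rewrite le_max h.
by rewrite le_max h orbT.
Qed.

Lemma bdd_sub D D' : D `<=` D' -> bdd D' -> bdd D.
Proof. by move=> DD [L hL]; exists L => x /DD/hL. Qed.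

Lemma bdd_fuzz r D : bdd D -> bdd (fuzz r D).
Proof.
move=> [L hL]; exists (L + r) => y [x /hL xL /ltW xy].
by rewrite -[y](subrK x); apply: le_trans (ler_normD _ _) _; rewrite addrC lerD// -/(dist y x) dist_sym.
Qed.

Lemma deepU D D' W : deep D W -> deep D' W -> deep (D `|` D') W.
Proof.
move=> [r r0 hr] [q q0 hq]; exists (Num.min r q); first by rewrite lt_min r0.
by move=> x y [Dx|Dx]; rewrite lt_min => /andP[h1 h2]; [apply: hr Dx _|apply: hq Dx _].
Qed.

Lemma deep_fuzz D W : deep D W -> exists2 r, 0 < r & deep (fuzz r D) W.
Proof.
move=> [r r0 hr]; exists (r / 2); first by rewrite divr_gt0.
exists (r / 2); first by rewrite divr_gt0.
move=> y z [x Dx xy] yz; apply: hr Dx _; apply: le_lt_trans (dist_tri x y z) _.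
by rewrite [r]splitr ltrD.
Qed.

Lemma deepE D W : deep D W -> D `<=` W.
Proof. by move=> [r r0 hr] x Dx; apply: hr Dx _; rewrite /dist subrr normr0. Qed.

Lemma deepT D : deep D setT. Proof. by exists 1. Qed.

Lemma csE_subset X X' W f : X' `<=` X -> csE X W f -> csE X' W f.
Proof. by move=> XX [D [bD dD sD]]; exists D; split=> //; apply: germ_subset sD. Qed.

Lemma csE0 X W : csE X W (fun=> 0).
Proof.
exists set0; split; [by exists 0|by exists 1|].
by apply: germW => s; rewrite eqxx.
Qed.

Lemma csED X W f g : csE X W f -> csE X W g -> csE X W (fun s => f s + g s).
Proof.
move=> [D [bD dD sD]] [D' [bD' dD' sD']]; exists (D `|` D').
split; [exact: bddU|exact: deepU|].
apply: germS (germI sD sD') => s _ [fD gD] nz x xs.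
have [f0|/eqP/fD/(_ _ xs)] := f s =P 0; last by left.
by right; apply: gD => //; move: nz; rewrite f0 add0r.
Qed.

Lemma csE_cut X W f th : csE X W f -> csE X W (cut th f).
Proof.
by move=> [D [bD dD sD]]; exists D; split=> //; apply: germS sD => s _ h /cut_neq0.
Qed.

(** The affine plane through [c] spanned by the first [m] coordinate directions; the induction on
    the dimension runs over these planes. *)
Definition slice m c : set E := [set x | forall i : 'I_n, (m <= i)%N -> x 0 i = c 0 i].

Lemma upd_slice (i : 'I_n) a c x : slice i.+1 c x -> slice i (upd i a c) (upd i a x).
Proof.
move=> cx j; rewrite !mxE leq_eqVlt => /predU1P[/val_inj->|ij]; first by rewrite eqxx.
by rewrite cx.
Qed.

Lemma slice_upd (i : 'I_n) a c : slice i (upd i a c) `<=` slice i.+1 c.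
Proof.
move=> x hx j ij; rewrite hx ?(ltnW ij)// upd_neq//.
by apply: contraTneq ij => ->; rewrite ltnn.
Qed.

Lemma slice_upd_i (i : 'I_n) a c x : slice i (upd i a c) x -> x 0 i = a.
Proof. by move=> /(_ i (leqnn _)); rewrite upd_i. Qed.

Lemma point_cocycle_upd (i : 'I_n) a p s m : (m <= i)%N ->
  point_cocycle p m (map (upd i a) s) = point_cocycle p m s.
Proof.
move=> mi; apply: point_cocycle_map => x j jm; congr (_ <= _).
rewrite /co; case: insubP => // k _ kj; rewrite upd_neq// -val_eqE /= kj.
by apply: contraTneq jm => ->; rewrite -leqNgt.
Qed.

Section Hyperplane.
Context (i : 'I_n) (a : R) (c : E).
Let X := slice i.+1 c.
Let H := slice i (upd i a c).
Let th x := a <= x 0 i.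

Let eq_cup_near f g s : f [::] = 0 -> g [::] = 0 ->
  (forall y r, {subset y :: r <= s} -> (exists2 x, x \in s & th x != th y) ->
     f (y :: r) = g (y :: r)) ->
  cup th f s = cup th g s.
Proof.
move=> f0 g0 fg; case: s fg => [|x [|y r]] fg; first by rewrite !cup_nil.
  by rewrite !cup_cons /= f0 g0.
rewrite !cup_cons2; case E : (_ (+) _) => //; apply: fg.
  by move=> z zr; rewrite inE zr orbT.
by exists x; rewrite ?mem_head//; move: E; case: (th x); case: (th y).
Qed.

Let cross_near r x y z : dist x z < r -> dist y z < r -> th x != th y -> `|z 0 i - a| < r.
Proof.
move=> /(le_lt_trans (dist_coord x z i)); rewrite ltr_norml => /andP[x1 x2].
move=> /(le_lt_trans (dist_coord y z i)); rewrite ltr_norml => /andP[y1 y2].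
by rewrite /th ltr_norml; have [?|?] := leP a (x 0 i); have [?|?] := leP a (y 0 i) => // _;
  apply/andP; lra.
Qed.

(* If [f] is [F + coboundary v] on the hyperplane, then projecting onto it
   extends this decomposition to a neighbourhood, which is all that [cup th]
   sees. *)
Lemma near_hyperplane k W f F (v : seq E -> 'F_2) (r0 : R) :
  hom k.+1 f -> csE X W f -> F [::] = 0 ->
  (forall s, F (map (upd i a) s) = F s) -> 0 < r0 ->
  germ dist X (fun s => (forall x, x \in s -> `|x 0 i - a| < r0) -> coboundary f s = 0) ->
  hom k v -> csE H W v -> germ dist H (fun s => f s = F s + coboundary v s) ->
  exists G, [/\ hom k.+1 G, csE X W G,
    germ dist X (fun s => cup th f s = cup th F s + coboundary G s)
    & forall r, 0 < r -> germ dist X (fun s => G s != 0 ->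
        forall x, x \in s -> `|x 0 i - a| < r)].
Proof.
move=> hf cf F0 Fpi r0_gt0 fcoc hv cv fv.
pose pi := upd i a.
(* The prism from the identity to the projection compares [f] with its value on projected tuples,
   where [v] is available; hence [coboundary e] is [f + F] on tuples near the hyperplane. *)
pose e s := v (map pi s) + prism id pi f s.
have he : hom k e.
  apply: homD; last exact: hom_prism.
  by move=> s; rewrite -(size_map pi); apply: hv.
have near_r r x : X x -> `|x 0 i - a| < r -> dist x (pi x) < r.
  by move=> Xx; rewrite dist_upd_id.
have piH x : X x -> H (pi x) by apply: upd_slice.
have HX : H `<=` X by apply: slice_upd.
have XpiX x : X x -> X (pi x) by move=> /piH/HX.
(* Prisms evaluate tuples that mix entries with their projections; near the hyperplane such tuples
   are still small. *)
have mixed s r q t : (forall x, x \in s -> X x) -> small dist r s ->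
    (forall x, x \in s -> `|x 0 i - a| < r) ->
    (forall y, y \in t -> exists2 x, x \in s & y = x \/ y = pi x) -> r + r <= q ->
    [/\ forall y, y \in t -> X y, small dist q t & forall y, y \in t -> `|y 0 i - a| < r].
  move=> sX ss sn ts rq; split.
  - by move=> y /ts[x xs [->|->]]; [apply: sX|apply/XpiX/sX].
  - move=> y z /ts[x xs yx] /ts[w ws zw]; apply: lt_le_trans rq.
    have r_gt0 : 0 < r by apply: le_lt_trans (sn _ xs); rewrite normr_ge0.
    have xw := ss _ _ xs ws; case: yx => ->; case: zw => ->.
    + by rewrite -[dist x w]addr0 ltrD.
    + apply: le_lt_trans (dist_tri _ w _) _; apply: ltrD => //.
      by apply: near_r; [apply: sX|apply: sn].
    + apply: le_lt_trans (dist_tri _ x _) _; apply: ltrD => //.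
      by rewrite dist_sym; apply: near_r; [apply: sX|apply: sn].
    + apply: le_lt_trans (dist_upd _ _ _ _) _.
      by rewrite -[dist x w]addr0 ltrD.
  - move=> y /ts[x xs [->|->]]; first exact: sn.
    by rewrite upd_i subrr normr0; apply: le_lt_trans (sn _ xs); rewrite normr_ge0.
have [q q_gt0 hq] := fcoc; have [u u_gt0 hu] := fv.
pose r1 := Num.min (Num.min (q / 2) r0) u.
have r1_gt0 : 0 < r1 by rewrite !lt_min divr_gt0// r0_gt0 u_gt0.
have [r1q r1r0 r1u] : [/\ r1 + r1 <= q, r1 <= r0 & r1 <= u].
  rewrite /r1; split; last by rewrite ge_min lexx orbT.
    rewrite [q in leRHS]splitr; apply: lerD; by rewrite !ge_min lexx.
  by rewrite !ge_min lexx orbT.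
have dec s : (forall x, x \in s -> X x) -> small dist r1 s ->
    (forall x, x \in s -> `|x 0 i - a| < r1) -> f s = F s + coboundary e s.
  move=> sX ss sn.
  have Z : prism id pi (coboundary f) s = 0.
    apply/eqP; apply: contraT => /prism_neq0[t [ft _ ts _]].
    have [tX tsm tn] := mixed s r1 q t sX ss sn ts r1q.
    by rewrite hq ?eqxx// in ft => x /tn/lt_le_trans; apply.
  have := prism_homotopy id pi f s; rewrite Z addr0 map_id oppF2 => P.
  rewrite coboundaryD P (coboundary_map v) (hu (map pi s)).
  - rewrite Fpi; f2case (F s); f2case (f s); f2case (coboundary v (map pi s)); f2done.
  - by move=> y /mapP[x xs ->]; apply/piH/sX.
  - move=> y z /mapP[x xs ->] /mapP[w ws ->]; apply: le_lt_trans (dist_upd _ _ _ _) _.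
    by apply: lt_le_trans r1u; apply: ss.
(* [cup th] commutes with the coboundary and evaluates only tuples crossing the hyperplane, so a
   decomposition near it is enough. *)
exists (cup th e); split.
- exact: hom_cup.
- have [D [bD dD [rD rD0 sD]]] := cf; have [V [bV dV [rV rV0 sV]]] := cv.
  have [r r_gt0 dr] := deep_fuzz (deepU dD dV).
  exists (fuzz r (D `|` V)); split=> //; first exact/bdd_fuzz/bddU.
  pose r2 := Num.min (Num.min (rD / 2) rV) (r / 2).
  have r2_gt0 : 0 < r2 by rewrite !lt_min !divr_gt0// rV0.
  have r2D : r2 + r2 <= rD.
    by rewrite [rD]splitr; apply: lerD; rewrite !ge_min lexx.
  have r2r : r2 + r2 <= r.
    by rewrite [r]splitr; apply: lerD; rewrite !ge_min lexx !orbT.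
  have r2V : r2 <= rV by rewrite !ge_min lexx !orbT.
  exists r2 => // s sX ss nz x xs.
  have [y [z [t [sE yz ez]]]] := cup_neq0 (hom_nil he) nz.
  have ys : y \in s by rewrite sE mem_head.
  have zs : z \in s by rewrite sE inE mem_head orbT.
  have sn w : w \in s -> `|w 0 i - a| < r2.
    by move=> ws; apply: cross_near yz; apply: ss.
  have sub w : w \in z :: t -> w \in s by rewrite sE => wt; rewrite inE wt orbT.
  have : exists2 w, (D `|` V) w & dist w z < r2.
    have [v0|/eqP v0] := v (map pi (z :: t)) =P 0.
      rewrite /e v0 add0r in ez; have [t' [ft' _ t't zt']] := prism_neq0 ez.
      have [t'X t's _] : [/\ forall y, y \in t' -> X y, small dist rD t' &
          forall y, y \in t' -> `|y 0 i - a| < r2].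
        apply: (mixed (z :: t)) r2D => //.
        + by move=> w /sub/sX.
        + exact: small_sub ss.
        + by move=> w /sub/sn.
      have [zt'' | zt''] := zt' z (mem_head _ _).
        exists z; last by rewrite /dist subrr normr0.
        by left; apply: sD zt''.
      exists (pi z); first by left; apply: sD zt''.
      by rewrite dist_sym; apply: near_r; [apply: sX|apply: sn].
    exists (pi z); last by rewrite dist_sym; apply: near_r; [apply: sX|apply: sn].
    right; apply: (sV (map pi (z :: t))) => //; last by rewrite map_f// mem_head.
      by move=> w /mapP[w' w't ->]; apply/piH/sX/sub.
    move=> w w' /mapP[b bt ->] /mapP[b' b't ->]; apply: le_lt_trans (dist_upd _ _ _ _) _.
    by apply: lt_le_trans r2V; apply: ss; apply: sub.
  move=> [w Dw wz]; exists w => //; apply: le_lt_trans (dist_tri _ z _) _.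
  by apply: lt_le_trans r2r; apply: ltrD => //; apply: ss.
- exists r1 => // s sX ss; rewrite coboundary_cup -cupD.
  apply: eq_cup_near => //; rewrite ?(hom_nil hf) ?F0 ?coboundary_nil ?addr0//.
  move=> y t ts [x xs xy]; apply: dec.
  + by move=> z /ts/sX.
  + exact: small_sub ss.
  + have ys : y \in s by apply: ts; rewrite mem_head.
    by move=> z /ts zs; apply: cross_near xy; apply: ss.
- move=> r r_gt0; exists r => // s sX ss nz x xs.
  have [y [z [t [sE yz _]]]] := cup_neq0 (hom_nil he) nz.
  by apply: cross_near yz; apply: ss => //; rewrite sE ?mem_head// inE mem_head orbT.
Qed.
End Hyperplane.
End CompactSupports.

Section Decomposition.
Context {R : realType} {n : nat}.
Notation E := 'rV[R]_n.
Implicit Types (x y c p v : E) (s t : seq E) (f g : seq E -> 'F_2) (X W D : set E).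

Lemma shift0 v : shift v 0 = id.
Proof. by apply/funext => x; rewrite /shift scale0r addr0. Qed.

(** The translation is divided into steps so short that tuples mixing two consecutive translates
    remain small. The primitive is carried by the region that [D] sweeps out while it is translated
    back by [b *: v]. *)
Lemma shift_homotopy X v b D f k :
  (forall x a, X x -> X (shift v a x)) -> hom k.+1 f -> supp dist X f D ->
  germ dist X (fun s => coboundary f s = 0) ->
  exists e, [/\ hom k e,
    germ dist X (fun s => f s = coboundary e s + f (map (shift v b) s))
    & supp dist X e [set x | exists2 u, 0 <= u <= 1 & D (shift v (u * b) x)]].
Proof.
move=> Xv hf [q q0 sD] [r r0 fcoc].
pose r1 := Num.min q r; have r1_gt0 : 0 < r1 by rewrite lt_min q0.
have [N Nb] : exists N : nat, `|b| * `|v| / r1 * 2 < N.+1%:R.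
  exists (Num.truncn (`|b| * `|v| / r1 * 2)); apply: truncnS_gt.
pose g j := shift v (j%:R / N.+1%:R * b).
have step j : `|j%:R / N.+1%:R * b - j.+1%:R / N.+1%:R * b| * `|v| < r1 / 2.
  have -> : j%:R / N.+1%:R * b - j.+1%:R / N.+1%:R * b = - (b / N.+1%:R) :> R.
    rewrite -[j.+1%:R]natr1; have : N.+1%:R != 0 :> R by rewrite pnatr_eq0.
    by move: (N.+1%:R : R) => w w0; field.
  rewrite normrN normrM normfV (ger0_norm (ler0n _ _)) mulrAC ltr_pdivrMr//.
  have -> : `|b| * `|v| = `|b| * `|v| / r1 * 2 * (r1 / 2) by field; rewrite gt_eqF.
  by rewrite mulrC ltr_pM2l// divr_gt0.
have mixed j s t : (forall x, x \in s -> X x) -> small dist (r1 / 2) s ->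
    (forall y, y \in t -> exists2 x, x \in s & y = g j x \/ y = g j.+1 x) ->
    (forall y, y \in t -> X y) /\ small dist r1 t.
  move=> sX ss ts; split; first by move=> y /ts[x xs [->|->]]; apply/Xv/sX.
  move=> y z /ts[x xs yx] /ts[w ws zw]; rewrite [r1]splitr.
  have xw := ss _ _ xs ws.
  have lt1 a : dist (shift v a x) (shift v a w) < r1 / 2 + r1 / 2.
    by rewrite dist_shift; apply: lt_trans xw _; rewrite ltrDl divr_gt0.
  case: yx => ->; case: zw => ->; rewrite /g ?lt1//.
    by apply: le_lt_trans (dist_shift2 _ _ _ _ _) _; rewrite ltrD.
  by apply: le_lt_trans (dist_shift2 _ _ _ _ _) _; rewrite ltrD// distrC.
have r1h : r1 / 2 < r1 by rewrite ltr_pdivrMr// ltr_pMr// ltr1n.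
exists (prisms g N.+1 f); split.
- exact: hom_prisms.
- exists (r1 / 2); first by rewrite divr_gt0.
  move=> s sX ss; have := prisms_homotopy g N.+1 f s.
  have -> : prisms g N.+1 (coboundary f) s = 0.
    apply/eqP; apply: contraT => /prisms_neq0[j _ /prism_neq0[t [ft _ ts _]]].
    have [tX tsm] := mixed _ _ _ sX ss ts.
    rewrite fcoc ?eqxx// in ft; apply: small_le tsm; by rewrite ge_min lexx orbT.
  have -> : g 0%N = id by rewrite /g mul0r mul0r shift0.
  have gN : g N.+1 = shift v b by rewrite /g divff ?mul1r// pnatr_eq0.
  by rewrite addr0 map_id -gN => ->; rewrite addrAC addF2 add0r.
- exists (r1 / 2); first by rewrite divr_gt0.
  move=> s sX ss /prisms_neq0[j jN /prism_neq0[t [ft _ ts st]]] x xs.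
  have [tX tsm] := mixed _ _ _ sX ss ts.
  have tD y : y \in t -> D y.
    by apply: sD => //; apply: small_le tsm; rewrite ge_min lexx.
  have frac l : (l <= N.+1)%N -> 0 <= (l%:R / N.+1%:R : R) <= 1.
    by move=> lN; rewrite divr_ge0//= ler_pdivrMr// mul1r ler_nat.
  by case: (st x xs) => /tD Dx; [exists (j%:R / N.+1%:R)|exists (j.+1%:R / N.+1%:R)];
    rewrite ?frac// ltnW.
Qed.

Definition decomp m c W k f := exists ps : seq E,
  [/\ forall p, p \in ps -> slice m c p /\ W p, (m < k)%N -> ps = [::]
    & exists e, [/\ hom k e, csE (slice m c) W e
      & germ dist (slice m c) (fun s =>
          f s = \sum_(p <- ps) point_cocycle p m s + coboundary e s)]].

Lemma decompD m c W k f g : decomp m c W k f -> decomp m c W k g ->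
  decomp m c W k (fun s => f s + g s).
Proof.
move=> [ps [psW ps0 [e [he ce fe]]]] [qs [qsW qs0 [e' [he' ce' ge]]]].
exists (ps ++ qs); split.
- by move=> p; rewrite mem_cat => /orP[/psW|/qsW].
- by move=> mk; rewrite ps0// qs0.
exists (fun s => e s + e' s); split; [exact: homD|exact: csED|].
apply: germS (germI fe ge) => s _ [-> ->].
by rewrite coboundaryD big_cat /= addrACA.
Qed.

Lemma decomp_eq m c W k f g : germ dist (slice m c) (fun s => f s = g s) ->
  decomp m c W k f -> decomp m c W k g.
Proof.
move=> fg [ps [psW ps0 [e [he ce fe]]]]; exists ps; split=> //; exists e; split=> //.
by apply: germS (germI fg fe) => s _ [->].
Qed.

Lemma decomp0 m c W k : decomp m c W k (fun=> 0).
Proof.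
exists [::]; split=> //; exists (fun=> 0); split=> //; first exact: csE0.
by apply: germW => s; rewrite big_nil coboundary0 addr0.
Qed.

Lemma decomp_coboundary m c W k f e : hom k e -> csE (slice m c) W e ->
  germ dist (slice m c) (fun s => f s = coboundary e s) -> decomp m c W k f.
Proof.
move=> he ce fe; exists [::]; split=> //; exists e; split=> //.
by apply: germS fe => s _ ->; rewrite big_nil add0r.
Qed.

(** The compactly supported cohomology of [W] in an [m]-dimensional plane is generated by point
    classes in degree [m] and vanishes above; in lower degrees it would depend on [W]. *)
Definition decomposable m := forall c k W f, (m <= k)%N -> hom k.+1 f ->
  csE (slice m c) W f -> germ dist (slice m c) (fun s => coboundary f s = 0) ->
  decomp m c W k f.

(** The plane is the single point [c]: in positive degree the cone with apex [c] is a primitive, in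
    degree zero [f] is a multiple of the point class. *)
Lemma decomposable0 : decomposable 0.
Proof.
move=> c k W f _ hf cf [r r0 fcoc].
have sc x : slice 0 c x -> x = c by move=> xc; apply/rowP => j; rewrite xc.
case: k hf => [|k] hf; last first.
  pose e s := f (c :: s).
  have eE s : (forall x, x \in s -> slice 0 c x) -> small dist r s ->
      (forall x, x \in c :: s -> slice 0 c x) /\ small dist r (c :: s).
    move=> sS ss; have cS x : x \in c :: s -> slice 0 c x.
      by rewrite inE => /predU1P[->//|/sS].
    by split=> // x y /cS/sc -> /cS/sc ->; rewrite /dist subrr normr0.
  apply: (@decomp_coboundary _ _ _ _ _ e).
  - by move=> s; rewrite andbT => s1; apply: hf; rewrite andbT.
  - have [D [bD dD [q q0 sD]]] := cf; exists D; split=> //; exists q => // s sS ss nz x xs.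
    have cS y : y \in c :: s -> slice 0 c y by rewrite inE => /predU1P[->//|/sS].
    apply: (sD (c :: s)) => //; last by rewrite inE xs orbT.
    by move=> y z /cS/sc -> /cS/sc ->; rewrite /dist subrr normr0.
  - exists r => // s sS ss; have [csS css] := eE s sS ss.
    have := fcoc _ csS css; rewrite coboundary_cons oppF2 => /addF2_eq.
    by apply.
have fE s : (forall x, x \in s -> slice 0 c x) -> f s = f [:: c] * point_cocycle c 0 s.
  case: s => [|x [|y s]] sS /=.
  - by rewrite (hom_nil hf) mulr0.
  - have -> : x = c by apply/sc/sS; rewrite mem_head.
    by rewrite mulr1.
  - by rewrite hf ?mulr0.
have [fc0|fc1] := F2_01 (f [:: c]).
  by apply: decomp_eq (decomp0 _ _ _ _); exists r => // s sS _; rewrite fE// fc0 mul0r.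
exists [:: c]; split=> //.
  move=> p; rewrite inE => /eqP->; split=> //; have [D [_ dD [q q0 sD]]] := cf.
  apply: (deepE dD); apply: (sD [:: c]); rewrite ?fc1 ?mem_head//.
    by move=> x; rewrite inE => /eqP->.
  by move=> x y; rewrite !inE => /eqP-> /eqP->; rewrite /dist subrr normr0.
exists (fun=> 0); split=> //; first exact: csE0.
by exists r => // s sS _; rewrite fE// fc1 mul1r big_seq1 coboundary0 addr0.
Qed.

Section Step.
Context (i : 'I_n) (IH : decomposable i) (c : E).
Let X := slice i.+1 c.
Let v : E := delta_mx 0 i.

Let shiftX x a : X x -> X (shift v a x).
Proof.
move=> Xx j ij; rewrite /shift /v !mxE Xx// eqxx /=.
by rewrite (_ : j == i = false) ?mulr0 ?addr0//; apply: contraTF ij => /eqP->; rewrite ltnn.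
Qed.

Let shift_i b x : shift v b x 0 i = x 0 i + b.
Proof. by rewrite /shift /v !mxE !eqxx mulr1. Qed.

(** The suspension isomorphism. Translating [f] off the hyperplane at height [a], upwards and
    downwards, gives two cochains whose sum [al] is a cocycle of one degree less near that
    hyperplane. The inductive decomposition of [al] there, suspended by [cup th], is the
    decomposition of [f]. *)
Lemma slab (a tau : R) k W D f : (i.+1 <= k)%N -> hom k.+1 f -> bdd D -> 0 < tau ->
  (forall x, D x -> `|x 0 i - a| < tau) ->
  deep [set x | exists2 u, `|u| <= 2 * tau & D (shift v u x)] W ->
  supp dist X f D -> germ dist X (fun s => coboundary f s = 0) ->
  decomp i.+1 c W k f.
Proof.
case: k => // k; rewrite ltnS => ik hf bD tau0 Da dD sD fcoc.
pose th x := a <= x 0 i.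
(* A shift by twice the half-width moves the support strictly beyond the slab, here upwards and in
   the next line downwards. *)
have [ep [hep fep sep]] := shift_homotopy (- (2 * tau)) shiftX hf sD fcoc.
have [em [hem fem sem]] := shift_homotopy (2 * tau) shiftX hf sD fcoc.
set fp := fun s => f (map (shift v (- (2 * tau))) s) in fep.
set fm := fun s => f (map (shift v (2 * tau)) s) in fem.
set S := [set x | _] in dD.
have bS : bdd S.
  have [L hL] := bD; exists (L + 2 * tau) => x [u u2 /hL].
  rewrite /shift => xL; rewrite -[x](addrK (u *: v)); apply: le_trans (ler_normB _ _) _.
  apply: lerD => //; rewrite normrZ; apply: le_trans u2; rewrite ler_piMr//.
  by apply: norm_le => // j; rewrite /v mxE; case: (_ && _); rewrite ?normr1 ?normr0.
have cS e : supp dist X e S -> csE X W e by exists S.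
have {}cep : csE X W ep.
  apply: cS; apply: germS sep => s _ h /h {}h x /h[u /andP[u0 u1] Du]; exists (u * - (2 * tau)) => //.
  by rewrite normrM normrN (ger0_norm u0) ger0_norm ?ler_piMl// mulr_ge0// ltW.
have {}cem : csE X W em.
  apply: cS; apply: germS sem => s _ h /h {}h x /h[u /andP[u0 u1] Du]; exists (u * (2 * tau)) => //.
  by rewrite normrM (ger0_norm u0) ger0_norm ?ler_piMl// mulr_ge0// ltW.
have fmap0 b : germ dist X (fun s => f (map (shift v b) s) != 0 ->
    forall x, x \in s -> `|x 0 i + b - a| < tau).
  have [r r0 hr] := sD; exists r => // s sX ss nz x xs.
  rewrite -shift_i; apply/Da/(hr (map (shift v b) s)) => //; last exact: map_f.
    by move=> y /mapP[z zs ->]; apply/shiftX/sX.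
  by move=> y z /mapP[y' ys ->] /mapP[z' zs ->]; rewrite dist_shift ss.
have fp0 : germ dist X (fun s => fp s != 0 -> forall x, x \in s -> a + tau < x 0 i).
  apply: germS (fmap0 (- (2 * tau))) => s _ h /h {}h x /h; rewrite ltr_norml; lra.
have fm0 : germ dist X (fun s => fm s != 0 -> forall x, x \in s -> x 0 i < a - tau).
  apply: germS (fmap0 (2 * tau)) => s _ h /h {}h x /h; rewrite ltr_norml; lra.
pose al s := ep s + em s.
have hal : hom k.+1 al by apply: homD.
have cal : csE X W al by apply: csED.
have dal : germ dist X (fun s => coboundary al s = fp s + fm s).
  apply: germS (germI fep fem) => s _ [Ep Em]; rewrite coboundaryD.
  apply: addF2_eq; rewrite addrACA.
  by rewrite (_ : _ + fp s = f s)// (_ : _ + fm s = f s)// addF2.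
pose H := slice i (upd i a c).
have HX : H `<=` X by apply: slice_upd.
have [ps [psW ps0 [w [hw cw aw]]]] : decomp i (upd i a c) W k al.
  apply: IH => //; first exact: csE_subset cal.
  have h := germ_subset HX (germI dal (germI fp0 fm0)).
  apply: germS h => -[|x s] sH [-> [hp hm]].
    by rewrite /fp /fm /= (hom_nil hf) addr0.
  have xa : x 0 i = a by apply: slice_upd_i (sH x (mem_head _ _)).
  have [->|/eqP/hp/(_ x (mem_head _ _))] := fp (x :: s) =P 0; last by rewrite xa => ?; exfalso; lra.
  have [->|/eqP/hm/(_ x (mem_head _ _))] := fm (x :: s) =P 0; last by rewrite xa => ?; exfalso; lra.
  by rewrite addr0.
pose F s := \sum_(p <- ps) point_cocycle p i s.
have F0 : F [::] = 0 by apply: big1 => p _; apply: (hom_nil (@hom_point_cocycle _ _ p i)).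
have Fpi s : F (map (upd i a) s) = F s.
  by apply: eq_bigr => p _; apply: point_cocycle_upd.
have dal0 : germ dist X (fun s => (forall x, x \in s -> `|x 0 i - a| < tau) -> coboundary al s = 0).
  apply: germS (germI dal (germI fp0 fm0)) => -[|x s] _ [-> [hp hm]] sa.
    by rewrite /fp /fm /= (hom_nil hf) addr0.
  have := sa _ (mem_head _ _); rewrite ltr_norml => xa.
  have [->|/eqP/hp/(_ x (mem_head _ _))] := fp (x :: s) =P 0; last by move=> ?; exfalso; lra.
  have [->|/eqP/hm/(_ x (mem_head _ _))] := fm (x :: s) =P 0; last by move=> ?; exfalso; lra.
  by rewrite addr0.
have [G [hG cG alG _]] := near_hyperplane hal cal F0 Fpi tau0 dal0 hw cw aw.
exists ps; split.
- by move=> p /psW[pH Wp]; split=> //; apply: HX.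
- by rewrite ltnS.
exists (fun s => ep s + cut th al s + G s); split.
- by do 2 apply: homD => //; apply: hom_cut.
- by do 2 apply: csED => //; apply: csE_cut.
apply: germS (germI (germI fep alG) (germI dal (germI fp0 fm0))) => s sX [[Ep Ea] [dE [hp hm]]].
rewrite !coboundaryD coboundary_cut Ea.
rewrite (_ : cut th (coboundary al) s = cut th (fun s => fp s + fm s) s); last exact: eq_cut.
have -> : \sum_(p <- ps) point_cocycle p i.+1 s = cup th F s.
  rewrite cup_sum; apply: eq_big_seq => p /psW[pH _]; rewrite point_cocycleS.
  congr (cup _ _ s); apply/funext => x; rewrite /above !coE; congr (_ <= _).
  exact: slice_upd_i pH.
(* [fp] lives above the hyperplane and [fm] below it, so the cutoff separates them. *)
have -> : cut th (fun s => fp s + fm s) s = fp s.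
  case: s sX hp hm {Ep Ea dE} => [|x s] sX hp hm; first by rewrite /fp /= (hom_nil hf).
  rewrite /= /th; case: ifPn => [ax|].
    have [->|/eqP/hm/(_ x (mem_head _ _))] := fm (x :: s) =P 0; last by move=> ?; exfalso; lra.
    by rewrite addr0.
  rewrite -ltNge => xa.
  by have [->//|/eqP/hp/(_ x (mem_head _ _))] := fp (x :: s) =P 0; move=> ?; exfalso; lra.
rewrite Ep -/(fp s).
f2case (coboundary ep s); f2case (fp s); f2case (cup th F s); f2case (coboundary G s); f2done.
Qed.
(* Cutting along the hyperplane at height [A + N * tau - tau / 2], where [f] is
   a coboundary for dimension reasons, splits off the topmost slab. *)
Lemma slabs (A tau : R) k (W W1 : set E) N f : (i.+1 <= k)%N -> hom k.+1 f -> 0 < tau ->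
  (forall x y, W1 x -> dist x y < 4 * tau -> W y) ->
  csE X W1 f ->
  germ dist X (fun s => f s != 0 ->
    forall x, x \in s -> A < x 0 i < A + N%:R * tau) ->
  germ dist X (fun s => coboundary f s = 0) ->
  decomp i.+1 c W k f.
Proof.
move=> ik + tau0 W1W; elim: N f => [|N IHN] f hf cf fA fcoc.
  apply: decomp_eq (decomp0 _ _ _ _); apply: germS fA => -[|x s] _ h.
    by rewrite (hom_nil hf).
  apply/eqP; rewrite eq_sym; apply: contraT => /h/(_ x (mem_head _ _)).
  by rewrite mul0r addr0 => /andP[/lt_trans h1 /h1]; rewrite ltxx.
have slab' g : hom k.+1 g -> csE X W1 g -> germ dist X (fun s => coboundary g s = 0) ->
    germ dist X (fun s => g s != 0 ->
      forall x, x \in s -> `|x 0 i - (A + N%:R * tau)| < tau) ->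
    decomp i.+1 c W k g.
  move=> hg [D [bD dD sD]] gcoc gN.
  apply: (@slab (A + N%:R * tau) tau k W
    (D `&` [set x | `|x 0 i - (A + N%:R * tau)| < tau])) => //.
  - by apply: bdd_sub bD => x [].
  - by move=> x [].
  - exists tau => // x y [u u2 [Dx _]] xy; apply: (W1W (shift v u x)); first exact: deepE Dx.
    apply: le_lt_trans (dist_tri _ x _) _; rewrite (_ : 4 * tau = 3 * tau + tau); last by ring.
    apply: ltrD => //; rewrite /dist /shift addrAC subrr add0r.
    have v1 : `|v| <= 1.
      by apply: norm_le => // j; rewrite /v mxE; case: (_ && _); rewrite ?normr1 ?normr0.
    rewrite normrZ; apply: le_lt_trans (_ : 2 * tau < _); last by rewrite ltr_pM2r// ltr_nat.
    by apply: le_trans u2; rewrite ler_piMr.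
  - by apply: germS (germI sD gN) => s _ [h1 h2] nz x xs; split; [apply: h1|apply: h2].
case: N IHN fA slab' => [|N] IHN fA slab'.
  apply: slab' => //; apply: germS fA => s _ h /h {}h x /h.
  by rewrite ltr_norml mul0r mul1r => /andP[? ?]; apply/andP; lra.
pose a := A + N.+1%:R * tau - tau / 2; pose th x := a <= x 0 i.
pose H := slice i (upd i a c).
have HX : H `<=` X by apply: slice_upd.
have [ps [_ ps0 [w [hw cw fw]]]] : decomp i (upd i a c) W1 k f.
  apply: IH => //; [exact: ltnW|exact: csE_subset cf|exact: germ_subset fcoc].
have {ps ps0}fw : germ dist H (fun s => f s = 0 + coboundary w s).
  by apply: germS fw => s _; rewrite ps0// big_nil.
have fcoc' : germ dist X (fun s => (forall x, x \in s -> `|x 0 i - a| < 1) ->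
    coboundary f s = 0) by apply: germS fcoc.
have [G [hG cG fG Gs]] := near_hyperplane hf cf (erefl 0) (fun=> erefl 0) ltr01 fcoc' hw cw fw.
have {}Gs : germ dist X (fun s => G s != 0 -> forall x, x \in s -> `|x 0 i - a| < tau / 2).
  by apply: Gs; rewrite divr_gt0.
(* The coboundary of [cut th f] is concentrated at the hyperplane and equals [coboundary G], so the
   correction by [G] makes the upper part a cocycle. *)
pose fp s := cut th f s + G s; pose fm s := f s + fp s.
have hfp : hom k.+1 fp by apply: homD => //; apply: hom_cut.
have cfp : csE X W1 fp by apply: csED => //; apply: csE_cut.
have dfp : germ dist X (fun s => coboundary fp s = 0).
  apply: germS (germI fcoc fG) => s _ [f0 Gf].
  rewrite coboundaryD coboundary_cut.
  have -> : cut th (coboundary f) s = 0 by case: s f0 {Gf} => //= x s ->; rewrite if_same.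
  have c0 : cup th (fun=> 0 : 'F_2) s = 0.
    case: s {f0 Gf} => [|x [|y s]]; rewrite ?cup_nil ?cup_cons2 ?cup_cons /= ?if_same ?addr0//.
  by rewrite addr0 Gf c0 add0r addF2.
have sm : germ dist X (small dist (tau / 4)) by apply: germ_small; rewrite divr_gt0.
have NN : N.+2%:R * tau = N.+1%:R * tau + tau by rewrite -[N.+2%:R]natr1 mulrDl mul1r.
have Ntau : 0 <= N%:R * tau by rewrite mulr_ge0// ltW.
have N1 : N.+1%:R * tau = N%:R * tau + tau by rewrite -[N.+1%:R]natr1 mulrDl mul1r.
have cutE th' : germ dist X (fun s => cut th' f s != 0 ->
    exists2 z, th' z & forall x, x \in s -> A < x 0 i < A + N.+2%:R * tau /\
      z 0 i - tau / 4 < x 0 i < z 0 i + tau / 4).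
  apply: germS (germI fA sm) => -[|z s] _ [h1 h2] //=; case: ifP => // thz nz.
  exists z => // x xs; split; first exact: h1.
  have := le_lt_trans (dist_coord x z i) (h2 _ _ xs (mem_head _ _)).
  by rewrite ltr_norml => /andP[? ?]; apply/andP; lra.
have Dp : decomp i.+1 c W k fp.
  apply: slab' => //; apply: germS (germI (cutE th) Gs) => s _ [h1 h2] nz x xs.
  have [/eqP|/h1[z + /(_ x xs)]] := boolP (cut th f s == 0).
    move=> c0; move: nz; rewrite /fp c0 add0r => /h2/(_ x xs).
    by rewrite !ltr_norml /a => /andP[? ?]; apply/andP; lra.
  by rewrite /th /a => az [/andP[? ?] /andP[? ?]]; rewrite ltr_norml; apply/andP; lra.
have Dm : decomp i.+1 c W k fm.
  apply: IHN.
  - exact: homD.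
  - exact: csED.
  - have E s : s != [::] -> fm s = cut (fun x => ~~ th x) f s + G s.
      case: s => //= x s _; rewrite /fm /fp /=; case: (th x) => /=.
        by rewrite addrA addF2.
      by rewrite add0r.
    have sG : germ dist X (fun s => s = [::] \/ s != [::]).
      by apply: germW => s; case: (s =P [::]); [left|right; apply/eqP].
    apply: germS (germI (cutE (fun x => ~~ th x)) Gs) => s _ [h1 h2] nz x xs.
    have s0 : s != [::] by case: s xs {nz h1 h2}.
    rewrite E// in nz.
    have [/eqP|/h1[z + /(_ x xs)]] := boolP (cut (fun x => ~~ th x) f s == 0).
      move=> c0; move: nz; rewrite c0 add0r => /h2/(_ x xs).
      by rewrite !ltr_norml /a => /andP[? ?]; apply/andP; lra.
    by rewrite /th /a -ltNge => az [/andP[? ?] /andP[? ?]]; apply/andP; lra.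
  - apply: germS (germI fcoc dfp) => s _ [E1 E2].
    by rewrite coboundaryD E1 E2 addr0.
apply: decomp_eq (decompD Dm Dp); apply: germW => s.
by rewrite /fm -addrA addF2 addr0.
Qed.

End Step.

Lemma decomposableS (i : 'I_n) : decomposable i -> decomposable i.+1.
Proof.
move=> IH c k W f ik hf [D [bD [r r0 hr] sD]] fcoc.
have [L hL] := bD.
(* [slabs] needs room [4 * tau] around [W1], which is half of the distance [r]; [W1] itself uses the
   other half. *)
pose W1 : set E := fuzz (r / 2) D; pose tau := r / 8.
have tau0 : 0 < tau by rewrite divr_gt0.
pose A := - L - 1; have [N hN] : exists N : nat, (2 * L + 2) / tau < N.+1%:R.
  by exists (Num.truncn ((2 * L + 2) / tau)); apply: truncnS_gt.
apply: (@slabs i IH c A tau k W W1 N.+1) => //.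
- move=> x y [z Dz zx] xy; apply: (hr z) => //; apply: le_lt_trans (dist_tri _ x _) _.
  by rewrite [r]splitr; apply: ltrD => //; apply: lt_le_trans xy _; rewrite /tau; lra.
- exists D; split=> //; exists (r / 2); first by rewrite divr_gt0.
  by move=> x y Dx xy; exists x.
- apply: germS sD => s _ h /h {}h x /h/hL xL; have := le_trans (coord_le x i) xL.
  have : 2 * L + 2 < N.+1%:R * tau by rewrite -ltr_pdivrMr.
  by rewrite ler_norml /A => ? /andP[? ?]; apply/andP; lra.
Qed.

Theorem decomposable_le m : (m <= n)%N -> decomposable m.
Proof.
elim: m => [_|m IH mn]; first exact: decomposable0.
exact: (@decomposableS (Ordinal mn) (IH (ltnW mn))).
Qed.
End Decomposition.

(** * Nontriviality of the point class and its transport along segments *)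

Section PointClass.
Context {R : realType} {n : nat}.
Notation E := 'rV[R]_n.
Implicit Types (x y c p v : E) (s t : seq E) (f g : seq E -> 'F_2) (X W D : set E).

Lemma co_upd_neq (i : 'I_n) a x (m : nat) : m != i :> nat -> co (upd i a x) m = co x m.
Proof.
by move=> mi; rewrite /co; case: insubP => // k _ km; rewrite upd_neq// -val_eqE /= km.
Qed.

Lemma point_cocycle_germ p m r : 0 < r -> germ dist setT (fun s : seq E =>
  point_cocycle p m s != 0 ->
  forall x, x \in s -> forall i, (i < m)%N -> `|co x i - co p i| < r).
Proof.
by move=> r0; exists r => // s _ ss nz x xs i im; apply: point_cocycle_near nz _ _ xs im.
Qed.

(* A primitive [e] of the point class would make [cut _ _ - e] a cocycle joining
   the point class one dimension lower to zero, along translations. *)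
Lemma point_cocycle_nontrivial m c p e : (m <= n)%N -> slice m c p -> hom m e ->
  csE (slice m c) setT e ->
  ~ germ dist (slice m c) (fun s => point_cocycle p m s = coboundary e s).
Proof.
elim: m c p e => [|m IH] c p e mn pc he ce.
  move=> [r r0 hr]; have : point_cocycle p 0 [:: p] = coboundary e [:: p].
    apply: hr => [x|]; first by rewrite mem_seq1 => /eqP->.
    by apply: small_seq1; rewrite dist_xx.
  by rewrite coboundary_cons coboundary_nil subr0 (hom0 he) => /(congr1 val).
pose i : 'I_n := Ordinal mn; have iE : m = i by [].
move=> Be; have [D [[L hL] _ sD]] := ce.
(* The hyperplanes at heights [b] and [- b] miss the bounded set [D] carrying [e], and the height of
   [p] lies strictly between them. *)
pose X := slice i.+1 c; pose b := `|L| + 1 + `|p 0 i|; pose v : E := delta_mx 0 i.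
pose H := slice i (upd i (- b) c); pose th := above p i.
have HX : H `<=` X by apply: slice_upd.
have shift_neq u x (j : 'I_n) : j != i -> shift v u x 0 j = x 0 j.
  by move=> /negbTE ji; rewrite /shift /v !mxE ji andbF mulr0 addr0.
have shift_i u x : shift v u x 0 i = x 0 i + u.
  by rewrite /shift /v !mxE !eqxx mulr1.
have shiftX x u : X x -> X (shift v u x).
  move=> Xx j ij; rewrite shift_neq ?Xx//; by apply: contraTneq ij => ->; rewrite ltnn.
pose z s := cut th (point_cocycle p i) s + e s.
have hz : hom i.+1 z by apply: homD => //; apply/hom_cut/hom_point_cocycle.
have dz : germ dist X (fun s => coboundary z s = 0).
  apply: germS Be => s _ Be; rewrite coboundaryD -Be; exact: addF2.
pose B : set E := [set x | forall j, (j < i)%N -> `|co x j - co p j| < 1].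
have sz : supp dist X z (B `|` D).
  apply: germS (germI sD (germ_subset (@subsetT _ X) (point_cocycle_germ p i ltr01))) => s _ [h1 h2] nz x xs.
  have [c0|c0] := eqVneq (cut th (point_cocycle p i) s) 0.
    by right; apply: h1 xs; move: nz; rewrite /z c0 add0r.
  by left=> j ji; apply: (h2 (cut_neq0 c0) _ xs).
have [w [hw zw sw]] := shift_homotopy (2 * b) shiftX hz sz dz.
have b0 : 0 < b by rewrite /b ltr_wpDr// ltr_wpDl.
have Lb : L < b by rewrite /b; apply: le_lt_trans (ler_norm L) _; rewrite -addrA ltrDl ltr_wpDr.
have pb : - b < p 0 i < b.
  by rewrite -ltr_norml /b ltrDr ltr_wpDl.
have e0 x (s : seq E) : D x -> ~ (x 0 i = b \/ x 0 i = - b).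
  move=> /hL xL; have := le_lt_trans (le_trans (coord_le x i) xL) Lb.
  by rewrite ltr_norml => /andP[h1 h2] [E0|E0]; move: h1 h2; rewrite E0 ltxx.
have H_i x : H x -> x 0 i = - b by apply: slice_upd_i.
apply: (IH (upd i (- b) c) (upd i (- b) p) w (ltnW mn)) => //.
- exact: (@upd_slice _ _ i).
(* On [H] only the coordinates before [i] are free, and these are bounded by membership in [B] or in
   [D]. *)
- exists (H `&` [set x | exists2 u, 0 <= u <= 1 & (B `|` D) (shift v (u * (2 * b)) x)]).
  split=> //; [|exact: deepT|].
    exists (`|L| + `|p| + 1 + `|upd i (- b) c|) => x [Hx [u _ BDx]].
    apply: norm_le; first by rewrite !addr_ge0.
    move=> j; have [ij|ji] := leqP i j.
      by rewrite Hx//; apply: le_trans (coord_le _ _) _; rewrite lerDr !addr_ge0.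
    have ji' : j != i by apply: contraTneq ji => ->; rewrite ltnn.
    rewrite -(shift_neq (u * (2 * b)) x j ji').
    apply: (@le_trans _ _ (`|L| + `|p| + 1)); last by rewrite lerDl.
    case: BDx => [/(_ j ji)|/hL /(le_trans (coord_le _ j))].
      rewrite !coE => /ltW h; rewrite -[X in `|X|](subrK (p 0 j)).
      apply: le_trans (ler_normD _ _) _; rewrite addrC.
      by apply: lerD => //; apply: le_trans (coord_le p j) _; rewrite lerDr.
    by move=> h; apply: le_trans h _; rewrite -addrA; apply: le_trans (ler_norm _) _; rewrite lerDl addr_ge0.
  by apply: germS (germI (germ_mem _ H) (germ_subset HX sw)) => s _ [sH h] nz x xs; split; [apply: sH|apply: h].
have eH : germ dist H (fun s => z s = 0).
  apply: germS (germ_subset HX sD) => -[|x s] sH sD'; first exact: (hom_nil hz).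
  rewrite /z /= /th /above !(coE _ i) (H_i x (sH x (mem_head _ _))).
  rewrite leNgt (andP pb).1 /= add0r; apply/eqP; apply: contraT => /sD'/(_ x (mem_head _ _)).
  by move=> /e0 []//; right; apply/H_i/sH; rewrite mem_head.
have eH2 : germ dist H (fun s => z (map (shift v (2 * b)) s) = point_cocycle p i s).
  have [r r0 hr] := sD; exists r => // s sH ss; rewrite /z.
  have mD : e (map (shift v (2 * b)) s) = 0.
    case: s sH ss => [|x s] sH ss; first exact: (hom_nil he).
    apply/eqP; apply: contraT => nz; have : D (shift v (2 * b) x).
      apply: hr nz _ _; rewrite ?mem_head//.
        by move=> y /mapP[y' ys ->]; apply/shiftX/HX/sH.
      by move=> y y' /mapP[x1 h1 ->] /mapP[x2 h2 ->]; rewrite dist_shift; apply: ss.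
    by move=> /e0 []//; left; rewrite shift_i (H_i x (sH x (mem_head _ _))); ring.
  rewrite mD addr0; case: s sH {ss mD} => [|x s] sH.
    by rewrite (hom_nil (@hom_point_cocycle _ _ p i)).
  rewrite /= /th /above !(coE _ i) shift_i (H_i x (sH x (mem_head _ _))).
  rewrite (_ : - b + 2 * b = b); last by ring.
  rewrite (ltW (andP pb).2) -[LHS]/(point_cocycle p i (map _ (x :: s))).
  apply: point_cocycle_map => y j ji; congr (_ <= _).
  rewrite /co; case: insubP => // k _ kj; rewrite shift_neq//.
  by rewrite -val_eqE /= kj; apply: contraTneq ji => ->; rewrite ltnn.
apply: germS (germI (germ_subset HX zw) (germI eH eH2)) => s _ [E1 [E2 E3]].
rewrite (@point_cocycle_ext _ _ _ p) => [|j ji]; last first.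
  by apply: co_upd_neq; apply: contraTneq ji => ->; rewrite ltnn.
by apply: addF2_eq; rewrite addrC -E3 -E1.
Qed.

Lemma slice_n c : slice n c = setT.
Proof. by apply/seteqP; split=> // x _ i; rewrite leqNgt ltn_ord. Qed.

(** Composing the class of [p] with the translation by [p - q] gives the class of [q], and the
    homotopy is carried by a neighbourhood of the segment between them. *)
Lemma point_cocycle_segment p q W (r : R) : 0 < r ->
  (forall u y, 0 <= u <= 1 -> dist (p + u *: (q - p)) y < r -> W y) ->
  exists e, [/\ hom n e, csE setT W e &
    germ dist setT (fun s => point_cocycle p n s = point_cocycle q n s + coboundary e s)].
Proof.
move=> r0 hW; pose v := p - q.
have sD : supp dist setT (point_cocycle p n) [set x | dist p x < r / 2].
  have r2 : 0 < r / 2 by rewrite divr_gt0.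
  apply: germS (point_cocycle_germ p n r2) => s _ h nz x xs /=.
  rewrite dist_sym; apply: norm_lt => // i.
  by have := h nz x xs i (ltn_ord i); rewrite !coE !mxE.
have coc : germ dist setT (fun s => coboundary (point_cocycle p n) s = 0).
  by apply: germW => s; apply: coboundary_point_cocycle.
have [e [he fe se]] := shift_homotopy (v := v) 1 (fun x a (_ : setT x) => I)
  (@hom_point_cocycle _ _ p n) sD coc.
exists e; split=> //.
  exists [set x | exists2 u, 0 <= u <= 1 & dist (p + u *: (q - p)) x < r / 2]; split.
  - exists (`|p| + `|q - p| + r / 2) => x [u /andP[u0 u1]] /ltW px.
    rewrite -[x](subrK (p + u *: (q - p))) addrC; apply: le_trans (ler_normD _ _) _.
    apply: lerD; last by rewrite -/(dist x _) dist_sym.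
    apply: le_trans (ler_normD _ _) _; rewrite lerD2l normrZ ger0_norm//.
    by rewrite ler_piMl.
  - exists (r / 2); first by rewrite divr_gt0.
    move=> x y [u u01 ux] xy; apply: (hW u) => //; apply: le_lt_trans (dist_tri _ x _) _.
    by rewrite [r]splitr; apply: ltrD.
  - apply: germS se => s _ h nz x xs; have [u u01 /=] := h nz x xs.
    rewrite mulr1 => ux; exists u => //; rewrite /dist.
    rewrite (_ : p + _ - x = p - shift v u x)// /shift /v.
    by rewrite opprD addrA -[- (u *: (p - q))]scalerN opprB addrAC.
apply: germS fe => s _ ->; rewrite addrC; congr (_ + _).
apply: point_cocycle_map => x i im; rewrite /shift /v scale1r.
rewrite /co; case: insubP => [k _ _|]; last by rewrite -leqNgt leqNgt im.
rewrite !mxE -subr_ge0 -[RHS]subr_ge0; congr (0 <= _); ring.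
Qed.

End PointClass.

(** The sets satisfying [Q] form an ideal. If [A] were not in it, their complements in [A] would
    generate a proper filter without cluster point in [A]. This principle takes the place of finite
    subcovers throughout. *)
Lemma compact_ind {T : topologicalType} (A : set T) (Q : set T -> Prop) :
  Q set0 -> (forall S S', S `<=` S' -> Q S' -> Q S) ->
  (forall S S', Q S -> Q S' -> Q (S `|` S')) ->
  (forall x, A x -> exists2 V, nbhs x V & Q V) -> compact A -> Q A.
Proof.
move=> Q0 Qsub QU Qloc cA; apply: contrapT => nQA.
pose F := filter_from Q (fun S => A `\` S).
have FF : Filter F.
  apply: filter_from_filter; first by exists set0.
  by move=> S S' QS QS'; exists (S `|` S'); [exact: QU|rewrite setDUr].
have PF : ProperFilter F.
  apply: filter_from_proper => S QS; apply: contrapT => /nonemptyPn AS0; apply: nQA.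
  by apply: Qsub QS => x Ax; apply: contrapT => nSx; have : (A `\` S) x by []; rewrite AS0.
have FA : F A by exists set0 => // x [].
have [x [Ax clx]] := cA F PF FA; have [V Vx QV] := Qloc x Ax.
have [y [[_ nVy] Vy]] : (A `\` V) `&` V !=set0 by apply: clx => //; exists V.
exact: nVy.
Qed.

(* The pseudometric [d] induces the topology at the points of [G] only. *)
Record gauge {R : realType} {T : topologicalType} (d : T -> T -> R) (G : set T) : Prop := Gauge {
  gauge_xx : forall x, d x x = 0;
  gauge_sym : forall x y, d x y = d y x;
  gauge_tri : forall x y z, d x z <= d x y + d y z;
  gauge_continuous : continuous (fun p : T * T => d p.1 p.2);
  gauge_nbhs : forall x V, G x -> nbhs x V -> exists2 r : R, 0 < r & forall y, d x y < r -> V y }.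

(** * Pseudometrics and supports *)

Section Gauge.
Context {R : realType} {T : topologicalType} (d : T -> T -> R) {G : set T} (dG : gauge d G).

Definition near_set (r : R) (D : set T) : set T := [set y | exists2 x, D x & d x y < r].

Lemma gauge_ball x r : 0 < r -> nbhs x [set y | d x y < r].
Proof.
move=> r0; have h : {for (x, x), continuous (fun p : T * T => d p.1 p.2)}.
  exact: gauge_continuous dG (x, x).
have cx : (fun y => d x y) @ x --> d x x.
  apply: (@cvg_comp _ _ _ (fun y => (x, y)) (fun p => d p.1 p.2) _ (nbhs (x, x))); last exact: h.
  by apply: cvg_pair; [exact: cvg_cst|exact: cvg_id].
have := cx [set t | t < r]; apply; rewrite (gauge_xx dG) /=.
by apply: open_nbhs_nbhs; split; [exact: open_lt|].
Qed.

Lemma gauge_ge0 x y : 0 <= d x y.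
Proof.
have := gauge_tri dG x y x; rewrite (gauge_xx dG) (gauge_sym dG y x) -mulr2n.
by rewrite pmulrn_lge0.
Qed.

(** Besides Lebesgue's lemma, an arbitrary relation [P] also covers uniform continuity around [C]:
    only one of the two points has to lie in [C]. *)
Lemma lebesgue_number (C : set T) (P : T -> T -> Prop) : compact C -> C `<=` G ->
  (forall x, C x -> exists2 V, nbhs x V & forall y z, V y -> V z -> P y z) ->
  exists2 r : R, 0 < r & forall x y, C x -> d x y < r -> P x y.
Proof.
move=> cC CG hP.
pose Q (S : set T) := exists2 r : R, 0 < r & forall x y, S x -> C x -> d x y < r -> P x y.
suff [r r0 hr] : Q C by exists r => // x y Cx; apply: hr.
apply: compact_ind cC; rewrite /Q.
- by exists 1.
- by move=> S S' SS' [r r0 hr]; exists r => // x y /SS'; apply: hr.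
- move=> S S' [r r0 hr] [q q0 hq]; exists (Num.min r q); first by rewrite lt_min r0.
  by move=> x y [Sx|Sx] Cx; rewrite lt_min => /andP[h1 h2]; [apply: hr|apply: hq].
move=> x Cx; have [V Vx VP] := hP x Cx; have [r r0 hr] := gauge_nbhs dG (CG x Cx) Vx.
have r2 : 0 < r / 2 by rewrite divr_gt0.
exists [set y | d x y < r / 2]; first exact: gauge_ball.
exists (r / 2) => // y z /= xy _ yz; apply: VP; apply: hr.
  by apply: lt_trans xy _; rewrite ltr_pdivrMr// ltr_pMr// ltr1n.
by apply: le_lt_trans (gauge_tri dG x y z) _; rewrite [r]splitr ltrD.
Qed.

Lemma near_set_open r D : open (near_set r D).
Proof.
rewrite openE => y [x Dx xy]; have e0 : 0 < r - d x y by rewrite subr_gt0.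
apply: filterS (gauge_ball y e0) => z /= yz; exists x => //.
by apply: le_lt_trans (gauge_tri dG x y z) _; rewrite -ltrBrDl.
Qed.

Lemma sub_near_set r D : 0 < r -> D `<=` near_set r D.
Proof. by move=> r0 x Dx; exists x => //; rewrite (gauge_xx dG). Qed.

Lemma near_set_sub (D U : set T) : compact D -> D `<=` G -> open U -> D `<=` U ->
  exists2 r, 0 < r & near_set r D `<=` U.
Proof.
move=> cD DG oU DU; have [|r r0 hr] := @lebesgue_number D (fun _ y => U y) cD DG.
  by move=> x Dx; exists U => //; apply: open_nbhs_nbhs; split=> //; apply: DU.
by exists r => // y [x Dx xy]; apply: hr Dx xy.
Qed.

Hypothesis lc : forall (x : T) V, nbhs x V -> exists C, [/\ compact C, C `<=` V & nbhs x C].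

Lemma near_set_compact (D U : set T) : compact D -> D `<=` G -> open U -> D `<=` U ->
  exists C r, [/\ compact C, C `<=` U, 0 < r & near_set r D `<=` C].
Proof.
move=> cD DG oU DU.
have [C [cC CU DC]] : exists C, [/\ compact C, C `<=` U & D `<=` C^°].
  pose Q (S : set T) := exists C, [/\ compact C, C `<=` U & S `&` D `<=` C^°].
  suff [C [cC CU DC]] : Q D by exists C; split=> // x Dx; apply: DC.
  apply: compact_ind cD; rewrite /Q.
  - by exists set0; split=> [|//|x []//]; exact: compact0.
  - by move=> S S' SS' [C [cC CU h]]; exists C; split=> // x [/SS' Sx Dx]; apply: h.
  - move=> S S' [C [cC CU h]] [C' [cC' CU' h']]; exists (C `|` C'); split.
    + exact: compactU.
    + by move=> x [/CU|/CU'].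
    + have CI : C^° `<=` (C `|` C')^° by apply: interiorS => y; left.
      have CI' : C'^° `<=` (C `|` C')^° by apply: interiorS => y; right.
      by move=> x [[Sx|Sx] Dx]; [apply/CI/h|apply/CI'/h'].
  move=> x Dx; have [C [cC CU Cx]] := lc (open_nbhs_nbhs (conj oU (DU x Dx))).
  exists C^°; first exact: (nbhs_interior Cx).
  by exists C; split=> // y [].
have [r r0 hr] := near_set_sub cD DG (open_interior C) DC.
by exists C, r; split=> // x /hr/interior_subset.
Qed.
End Gauge.

Section Supports.
Context {R : realType} {T : topologicalType} (d : T -> T -> R) {G : set T} (dG : gauge d G).
Implicit Types (f g : seq T -> 'F_2) (W D : set T).
Notation germ := (germ d [set: T]).

(** Asking for every [r] makes [D] a support in the limit of small tuples, so that taking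
    coboundaries does not enlarge it. *)
Definition supported D f := forall r : R, 0 < r ->
  germ (fun s => f s != 0 -> forall x, x \in s -> near_set d r D x).

Definition csM W f := exists D, [/\ compact D, D `<=` W & supported D f].

Lemma near_setS (r r' : R) D D' : r <= r' -> D `<=` D' ->
  near_set d r D `<=` near_set d r' D'.
Proof. by move=> rr DD y [x /DD Dx xy]; exists x => //; apply: lt_le_trans xy rr. Qed.

Lemma supported_sub D D' f : D `<=` D' -> supported D f -> supported D' f.
Proof.
by move=> DD sD r r0; apply: germS (sD r r0) => s _ h nz x xs; apply: near_setS (h nz x xs).
Qed.

Lemma supported_eq D f g : germ (fun s => f s = g s) -> supported D f -> supported D g.
Proof. by move=> fg sD r r0; apply: germS (germI fg (sD r r0)) => s _ [->]. Qed.

Lemma supported0 D : supported D (fun=> 0).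
Proof. by move=> r r0; apply: germW => s; rewrite eqxx. Qed.

Lemma supportedD D f g : supported D f -> supported D g -> supported D (fun s => f s + g s).
Proof.
move=> sf sg r r0; apply: germS (germI (sf r r0) (sg r r0)) => s _ [hf hg] nz x xs.
have [f0|f0] := eqVneq (f s) 0; last exact: hf.
by apply: hg => //; move: nz; rewrite f0 add0r.
Qed.

Lemma supported_sum D (I : eqType) (r : seq I) (F : I -> seq T -> 'F_2) :
  (forall i, i \in r -> supported D (F i)) -> supported D (fun s => \sum_(i <- r) F i s).
Proof.
elim: r => [|i r IH] hF.
  by apply: supported_eq (supported0 D); apply: germW => s; rewrite big_nil.
apply: supported_eq (supportedD (hF i (mem_head _ _)) (IH _)).
  by apply: germW => s; rewrite big_cons.
by move=> j jr; apply: hF; rewrite inE jr orbT.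
Qed.

Lemma supported_coboundary D f : f [::] = 0 -> supported D f -> supported D (coboundary f).
Proof.
move=> f0 sf r r0; have r2 : 0 < r / 2 by rewrite divr_gt0.
apply: germS (germI (germ_sub (sf _ r2)) (germ_small _ _ r2)) => s _ [h ss] nz x xs.
have [t [ft t0 ts _]] := coboundary_neq0 f0 nz; case: t ft t0 ts => // y t ft _ ts.
have [z Dz zy] := h (y :: t) ts ft y (mem_head _ _); exists z => //.
apply: le_lt_trans (gauge_tri dG z y x) _; rewrite [r]splitr; apply: ltrD => //.
by apply: ss => //; apply: ts; rewrite mem_head.
Qed.

Lemma csM_eq W f g : germ (fun s => f s = g s) -> csM W f -> csM W g.
Proof. by move=> fg [D [cD DW sD]]; exists D; split=> //; apply: supported_eq fg sD. Qed.

Lemma csM0 W : csM W (fun=> 0).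
Proof. by exists set0; split=> //; [exact: compact0|exact: supported0]. Qed.

Lemma csMD W f g : csM W f -> csM W g -> csM W (fun s => f s + g s).
Proof.
move=> [D [cD DW sD]] [D' [cD' DW' sD']]; exists (D `|` D'); split.
- exact: compactU.
- by move=> x [/DW|/DW'].
- by apply: supportedD; [apply: supported_sub sD|apply: supported_sub sD'] => x; [left|right].
Qed.

Lemma csM_sub W W' f : W `<=` W' -> csM W f -> csM W' f.
Proof. by move=> WW [D [cD DW sD]]; exists D; split=> // x /DW/WW. Qed.

Lemma csM_coboundary W f : f [::] = 0 -> csM W f -> csM W (coboundary f).
Proof. by move=> f0 [D [cD DW sD]]; exists D; split=> //; apply: supported_coboundary. Qed.

Lemma csM_sum W (I : Type) (r : seq I) (F : I -> seq T -> 'F_2) :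
  (forall i, csM W (F i)) -> csM W (fun s => \sum_(i <- r) F i s).
Proof.
move=> hF; elim: r => [|i r IH].
  by apply: csM_eq (csM0 W); apply: germW => s; rewrite big_nil.
by apply: csM_eq (csMD (hF i) IH); apply: germW => s; rewrite big_cons.
Qed.

Hypothesis lc : forall (x : T) V, nbhs x V -> exists C, [/\ compact C, C `<=` V & nbhs x C].

(** In place of a partition of unity, tuples are sorted by whether their first entry is close to the
    part of the support outside [V]. *)
Lemma csM_split k U V f : open U -> open V -> U `<=` G ->
  hom k f -> csM (U `|` V) f ->
  exists f1 f2, [/\ hom k f1, hom k f2, csM U f1, csM V f2 & f =1 fun s => f1 s + f2 s].
Proof.
move=> oU oV UG hf [D [cD DUV sD]].
have cDV : compact (D `\` V).
  rewrite setDE; apply: compact_closedI => //; exact: open_closedC.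
have DVU : D `\` V `<=` U by move=> x [/DUV[]].
have [C [r [cC CU r0 rC]]] := near_set_compact dG lc cDV (subset_trans DVU UG) oU DVU.
(* The radius [r / 2] keeps the first part in [C], while the second is supported on the points of
   [D] at distance at least [r / 4] from [D] outside [V], a compact subset of [V]. *)
pose th x := `[< near_set d (r / 2) (D `\` V) x >].
have r4 : 0 < r / 4 by rewrite divr_gt0.
exists (cut th f), (cut (fun x => ~~ th x) f); split; [exact: hom_cut..| | |].
- exists C; split=> // q q0.
  have m0 : 0 < Num.min (r / 4) q by rewrite lt_min r4.
  apply: germS (germ_small _ _ m0) => -[//|x s] _ ss /=; case: ifP => // /asboolP[z Dz zx] _ y ys.
  exists x; last by apply: lt_le_trans (ss _ _ (mem_head _ _) ys) _; rewrite ge_min lexx orbT.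
  apply: rC; exists z => //; apply: lt_trans zx _.
  by rewrite ltr_pdivrMr// ltr_pMr// ltr1n.
- exists (D `\` near_set d (r / 4) (D `\` V)); split.
  + rewrite setDE; apply: compact_closedI => //.
    exact/open_closedC/(near_set_open dG).
  + move=> x [Dx nx]; apply: contrapT => nVx; apply: nx.
    by apply: (sub_near_set dG).
  move=> q q0; have m0 : 0 < Num.min (r / 4) (q / 2) by rewrite lt_min r4 divr_gt0.
  apply: germS (germI (sD _ m0) (germ_small _ _ m0)) => -[//|x s] _ [h ss] /=.
  case: ifP => // thx nz y ys; have [z Dz zx] := h nz x (mem_head _ _).
  have lq a : a < Num.min (r / 4) (q / 2) -> a < q / 2.
    by move=> aa; apply: lt_le_trans aa _; rewrite ge_min lexx orbT.
  have lr a : a < Num.min (r / 4) (q / 2) -> a < r / 4.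
    by move=> aa; apply: lt_le_trans aa _; rewrite ge_min lexx.
  exists z; last first.
    apply: le_lt_trans (gauge_tri dG z x y) _; rewrite [q]splitr; apply: ltrD; first exact: lq.
    exact/lq/ss/ys/mem_head.
  split=> // -[w Dw wz]; move/negP: thx; apply; apply/asboolP; exists w => //.
  apply: le_lt_trans (gauge_tri dG w z x) _; have := lr _ zx; lra.
- case=> [|x s] /=; first by rewrite (hom_nil hf) addr0.
  by case: (th x); rewrite ?addr0 ?add0r.
Qed.
End Supports.

Definition loc_compact (T : topologicalType) := forall (x : T) V, nbhs x V ->
  exists C, [/\ compact C, C `<=` V & nbhs x C].

Section EuclideanGauge.
Context {R : realType} {n : nat}.
Notation E := 'rV[R]_n.

Lemma dist_gauge : gauge (@dist R n) setT.
Proof.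
split.
- exact: dist_xx.
- exact: dist_sym.
- exact: dist_tri.
- move=> p; apply: (@cvg_comp _ _ _ (fun p : E * E => p.1 - p.2) (fun x => `|x|) _ (nbhs (p.1 - p.2))).
    by apply: cvgB; [exact: cvg_fst|exact: cvg_snd].
  exact: norm_continuous.
- move=> x V _ /nbhs_ballP[r /= r0 hr]; exists r => // y xy; apply: hr.
  by rewrite -ball_normE.
Qed.

Lemma closed_bdd_compact (D : set E) : bdd D -> closed D -> compact D.
Proof.
move=> [L hL]; apply: bounded_closed_compact; exists L; split; first exact: num_real.
by move=> t /ltW Lt x /hL xL; apply: le_trans xL Lt.
Qed.

Lemma compact_bdd (D : set E) : compact D -> bdd D.
Proof.
move=> /compact_bounded[L [_ hL]]; exists (L + 1) => x Dx; apply: hL Dx.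
by rewrite ltrDl.
Qed.

Lemma bdd_closure (D : set E) : bdd D -> bdd (closure D).
Proof.
move=> [L hL]; exists (L + 1) => x clx.
have [y [Dy xy]] := clx _ (gauge_ball dist_gauge x ltr01).
rewrite -[x](subrK y); apply: le_trans (ler_normD _ _) _; rewrite addrC lerD ?hL//.
exact: ltW.
Qed.

Lemma euclidean_loc_compact : loc_compact E.
Proof.
move=> x V /nbhs_ballP[r /= r0 hr]; have r2 : 0 < r / 2 by rewrite divr_gt0.
exists (closure [set y | dist x y < r / 2]); split.
- apply: closed_bdd_compact; last exact: closed_closure.
  apply: bdd_closure; exists (`|x| + r / 2) => y /= xy.
  rewrite -[y](subrK x) addrC; apply: le_trans (ler_normD _ _) _; rewrite lerD2l.
  by rewrite -/(dist y x) dist_sym ltW.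
- move=> y cly; have [z [/= xz yz]] := cly _ (gauge_ball dist_gauge y r2).
  apply: hr; rewrite -ball_normE /=; apply: le_lt_trans (dist_tri x z y) _.
  by rewrite [r]splitr ltrD// dist_sym.
- by apply: filterS (gauge_ball dist_gauge x r2); exact: subset_closure.
Qed.

Lemma csE_csM W (f : seq E -> 'F_2) : csE setT W f -> csM (@dist R n) W f.
Proof.
move=> [D [bD dD sD]]; exists (closure D); split.
- by apply: closed_bdd_compact; [exact: bdd_closure|exact: closed_closure].
- move=> x clx; have [r r0 hr] := dD; have [y [Dy xy]] := clx _ (gauge_ball dist_gauge x r0).
  by apply: hr Dy _; rewrite dist_sym.
- move=> r r0; apply: germS sD => s _ h nz x xs; exists x; last by rewrite dist_xx.
  by apply: subset_closure; apply: h.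
Qed.

Lemma csM_csE W (f : seq E -> 'F_2) : open W -> csM (@dist R n) W f -> csE setT W f.
Proof.
move=> oW [D [cD DW sD]].
have [C [r [cC CW r0 rC]]] := near_set_compact dist_gauge euclidean_loc_compact cD (@subsetT _ _) oW DW.
have r2 : 0 < r / 2 by rewrite divr_gt0.
exists (near_set (@dist R n) (r / 2) D); split; last exact: sD.
- apply: bdd_sub (compact_bdd cC); apply: subset_trans rC; apply: near_setS => //.
  by rewrite ler_pdivrMr// ler_pMr// ler1n.
- exists (r / 2) => // x y [z Dz zx] xy; apply/CW/rC; exists z => //.
  by apply: le_lt_trans (dist_tri _ x _) _; rewrite [r]splitr ltrD.
Qed.
End EuclideanGauge.

Record part_homeo {T T' : topologicalType} (B : set T) (B' : set T') (h : T -> T') (h' : T' -> T)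
    : Prop := PartHomeo {
  ph_open : open B;
  ph_open' : open B';
  ph_image : forall x, B x -> B' (h x);
  ph_image' : forall y, B' y -> B (h' y);
  ph_K : forall x, B x -> h' (h x) = x;
  ph_K' : forall y, B' y -> h (h' y) = y;
  ph_cont : forall x, B x -> {for x, continuous h};
  ph_cont' : forall y, B' y -> {for y, continuous h'} }.

Lemma part_homeo_sym {T T' : topologicalType} (B : set T) (B' : set T') h h' :
  part_homeo B B' h h' -> part_homeo B' B h' h.
Proof. by case. Qed.

Lemma part_homeo_sub {T T' : topologicalType} (B : set T) (B' : set T') h h' W :
  part_homeo B B' h h' -> open W -> W `<=` B ->
  part_homeo W (B' `&` h' @^-1` W) h h'.
Proof.
move=> H oW WB; split.
- exact: oW.
- rewrite openE => y [B'y Wy]; apply: filterI.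
    by apply: open_nbhs_nbhs; split=> //; exact: (ph_open' H).
  by apply: (ph_cont' H B'y); apply: open_nbhs_nbhs.
- by move=> x Wx; split; [exact/(ph_image H)/WB|rewrite /= (ph_K H (WB _ Wx))].
- by move=> y [].
- by move=> x /WB; exact: (ph_K H).
- by move=> y [/(ph_K' H)].
- by move=> x /WB; exact: (ph_cont H).
- by move=> y [/(ph_cont' H)].
Qed.

Lemma image_compact {T T' : topologicalType} (h : T -> T') (C : set T) :
  (forall x, C x -> {for x, continuous h}) -> compact C -> compact (h @` C).
Proof.
move=> hc; apply: continuous_compact; apply/continuous_in_subspaceT => x /set_mem.
exact: hc.
Qed.

(** * Charts and point classes *)

Section Transport.
Context {R : realType} {T T' : topologicalType}.
Context {d : T -> T -> R} {G : set T} {d' : T' -> T' -> R} {G' : set T'}.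
Context (dG : gauge d G) (dG' : gauge d' G').
Context {B : set T} {B' : set T'} {h : T -> T'} {h' : T' -> T} (H : part_homeo B B' h h').
Context (BG : B `<=` G) (BG' : B' `<=` G').
Notation near := (near_set d).
Notation near' := (near_set d').

Lemma homeo_small C (r' : R) : compact C -> C `<=` B -> 0 < r' -> exists2 r, 0 < r &
  forall s, small d r s -> (forall x, x \in s -> near r C x) ->
  [/\ forall x, x \in s -> B x, small d' r' (map h s) &
      forall y, y \in map h s -> near' r' (h @` C) y].
Proof.
move=> cC CB r'0; have r4 : 0 < r' / 4 by rewrite divr_gt0.
have [x Cx|r r0 hr] := lebesgue_number dG (C := C)
    (P := fun y z => B z /\ d' (h y) (h z) < r' / 2) cC (subset_trans CB BG).
  exists (B `&` h @^-1` [set y | d' (h x) y < r' / 4]).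
    apply: filterI; first by apply: open_nbhs_nbhs; split; [exact: (ph_open H)|exact: CB].
    by apply: (ph_cont H (CB x Cx)); exact: gauge_ball dG' _ _ r4.
  move=> y z [_ /= xy] [Bz xz]; split=> //; apply: le_lt_trans (gauge_tri dG' _ (h x) _) _.
  by rewrite (gauge_sym dG' (h y)); lra.
exists (r / 2); first by rewrite divr_gt0.
move=> s ss sC.
have r2 : r / 2 < r by rewrite ltr_pdivrMr// ltr_pMr// ltr1n.
split.
- by move=> x /sC[y Cy yx]; have [] := hr y x Cy (lt_trans yx r2).
- move=> _ _ /mapP[x xs ->] /mapP[y ys ->]; have [c Cc cx] := sC x xs.
  have [_ h1] := hr c x Cc (lt_trans cx r2).
  have [|_ h2] := hr c y Cc.
    by apply: le_lt_trans (gauge_tri dG c x y) _; rewrite [r]splitr ltrD// ss.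
  apply: le_lt_trans (gauge_tri dG' _ (h c) _) _.
  by rewrite (gauge_sym dG' (h x)) [r']splitr ltrD.
- move=> _ /mapP[x /sC[y Cy yx] ->]; have [_ yx'] := hr y x Cy (lt_trans yx r2).
  exists (h y); first by exists y.
  by apply: lt_trans yx' _; rewrite ltr_pdivrMr// ltr_pMr// ltr1n.
Qed.

(** [h] is meaningful on [B] only, so the correspondence is asked for near compact subsets of [B],
    at a scale depending on them. *)
Definition corr (f : seq T -> 'F_2) (f' : seq T' -> 'F_2) := forall C, compact C -> C `<=` B ->
  exists2 r, 0 < r & forall s, small d r s -> (forall x, x \in s -> near r C x) ->
    f s = f' (map h s).

Lemma corrD f f' g g' : corr f f' -> corr g g' ->
  corr (fun s => f s + g s) (fun s => f' s + g' s).
Proof.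
move=> ff gg C cC CB; have [r r0 hr] := ff C cC CB; have [q q0 hq] := gg C cC CB.
exists (Num.min r q); first by rewrite lt_min r0.
move=> s ss sC; rewrite hr ?hq//.
- by apply: small_le ss; rewrite ge_min lexx orbT.
- by move=> x /sC; apply: near_setS => //; rewrite ge_min lexx orbT.
- by apply: small_le ss; rewrite ge_min lexx.
- by move=> x /sC; apply: near_setS => //; rewrite ge_min lexx.
Qed.

Lemma corr0 : corr (fun=> 0) (fun=> 0). Proof. by exists 1. Qed.

Lemma corr_sum (I : eqType) (r : seq I) F F' : (forall i, i \in r -> corr (F i) (F' i)) ->
  corr (fun s => \sum_(i <- r) F i s) (fun s => \sum_(i <- r) F' i s).
Proof.
elim: r => [|i r IH] hF.
  by move=> C cC CB; exists 1 => // s _ _; rewrite !big_nil.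
have h1 := corrD (hF i (mem_head _ _)) (IH (fun j jr => hF j (mem_behead (s := i :: r) jr))).
by move=> C cC CB; have [q q0 hq] := h1 C cC CB; exists q => // s ss sC; rewrite !big_cons hq.
Qed.

Lemma corr_coboundary f f' : corr f f' -> corr (coboundary f) (coboundary f').
Proof.
move=> ff C cC CB; have [r r0 hr] := ff C cC CB; exists r => // s ss sC.
rewrite -coboundary_map; apply: coboundary_eq_faces => i _; apply: hr.
  by apply: small_sub ss => x; exact: mem_face.
by move=> x /mem_face; exact: sC.
Qed.

(** Away from [D] both cochains vanish, and near [D] the map [h] translates one identity into the
    other. *)
Lemma corr_germ D f f' g g' : compact D -> D `<=` B -> corr f f' -> corr g g' ->
  supported d D f -> supported d D g ->
  germ d' setT (fun s => f' s = g' s) -> germ d setT (fun s => f s = g s).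
Proof.
move=> cD DB ff gg sf sg [q q0 fg'].
have [r r0 hr] := ff D cD DB; have [u u0 hu] := gg D cD DB.
have [v v0 hv] := homeo_small cD DB q0.
pose m := Num.min (Num.min r u) v; have m0 : 0 < m by rewrite !lt_min r0 u0.
have [mr mu mv] : [/\ m <= r, m <= u & m <= v] by rewrite !ge_min !lexx !orbT.
apply: germS (germI (germI (sf _ m0) (sg _ m0)) (germ_small d setT m0)) => s _ [[hf hg] ss].
have key : (forall x, x \in s -> near m D x) -> f s = g s.
  move=> sD; have [_ ss' _] := hv s (small_le mv ss) (fun x xs => near_setS mv (@subset_refl _ D) (sD x xs)).
  rewrite hr ?hu ?fg'//; try exact: small_le ss.
  - by move=> x /sD; apply: near_setS.
  - by move=> x /sD; apply: near_setS.
have [f0|/hf/key//] := eqVneq (f s) 0; have [g0|/hg/key//] := eqVneq (g s) 0.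
by rewrite f0 g0.
Qed.
End Transport.

Section Transport2.
Context {R : realType} {T T' : topologicalType}.
Context {d : T -> T -> R} {G : set T} {d' : T' -> T' -> R} {G' : set T'}.
Context (dG : gauge d G) (dG' : gauge d' G').
Context {B : set T} {B' : set T'} {h : T -> T'} {h' : T' -> T} (H : part_homeo B B' h h').
Context (BG : B `<=` G) (BG' : B' `<=` G').
Notation near := (near_set d).
Notation near' := (near_set d').

Lemma corr_sym f f' : corr (d := d) (B := B) (h := h) f f' ->
  corr (d := d') (B := B') (h := h') f' f.
Proof.
move=> ff C cC CB; have cC' : compact (h' @` C).
  by apply: image_compact => // y /CB; exact: (ph_cont' H).
have CB' : h' @` C `<=` B by move=> _ [y /CB By <-]; exact: (ph_image' H By).
have [r r0 hr] := ff _ cC' CB'.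
have [q q0 hq] := homeo_small dG' dG (part_homeo_sym H) BG' cC CB r0.
exists q => // s ss sC; have [sB ss' sC'] := hq s ss sC.
rewrite hr// -map_comp; congr (f' _); rewrite -[LHS]map_id; apply/eq_in_map => y /sB By /=.
by rewrite (ph_K' H By).
Qed.

Lemma transport k D f : loc_compact T' -> compact D -> D `<=` B -> hom k f -> supported d D f ->
  exists g, [/\ hom k g, supported d' (h @` D) g & corr (d := d) (B := B) (h := h) f g].
Proof.
move=> lc cD DB hf sf.
have cD' : compact (h @` D) by apply: image_compact => // y /DB; exact: (ph_cont H).
have DB' : h @` D `<=` B' by move=> _ [y /DB By <-]; exact: (ph_image H By).
have [C [r [cC CB r0 rC]]] := near_set_compact dG' lc cD' (subset_trans DB' BG') (ph_open' H) DB'.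
(* [h'] is arbitrary off [B']. Forcing [g] to vanish off a compact neighbourhood [C] of the image of
   the support loses nothing on small tuples. *)
pose g s := if all (fun x => `[< C x >]) s then f (map h' s) else 0.
have gE s : g s != 0 -> (forall x, x \in s -> C x) /\ f (map h' s) != 0.
  rewrite /g; case: allP => [sC nz|]; last by rewrite eqxx.
  by split=> // x /sC/asboolP.
exists g; split.
- by move=> s sk; rewrite /g; case: ifP => // _; apply: hf; rewrite size_map.
- move=> q q0; have [u u0 hu] := homeo_small dG dG' H BG cD DB q0.
  have [v v0 hv] := sf u u0.
  have m0 : 0 < Num.min u v by rewrite lt_min u0.
  have [w w0 hw] := homeo_small dG' dG (part_homeo_sym H) BG' cC CB m0.
  exists w => // s _ ss /gE[sC fs].
  have sC' x : x \in s -> near' w C x by move=> xs; exact: (sub_near_set dG' w0 (sC x xs)).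
  have [sB ss' _] := hw s ss sC'.
  have ssv : small d v (map h' s) by apply: small_le ss'; rewrite ge_min lexx orbT.
  have ssu : small d u (map h' s) by apply: small_le ss'; rewrite ge_min lexx.
  have [_ _ h3] := hu _ ssu (hv _ (fun _ _ => I) ssv fs).
  move=> x xs; rewrite -(ph_K' H (sB x xs)); apply: h3.
  by apply: map_f; apply: map_f.
- move=> K cK KB; have [u u0 hu] := homeo_small dG dG' H BG cD DB r0.
  have [v v0 hv] := homeo_small dG dG' H BG cK KB ltr01.
  have [w w0 hw] := sf u u0.
  pose m := Num.min (Num.min u v) w; have m0 : 0 < m by rewrite !lt_min u0 v0.
  have [mu mv mw] : [/\ m <= u, m <= v & m <= w] by rewrite !ge_min !lexx !orbT.
  exists m => // s ss sK.
  have [sB _ _] := hv s (small_le mv ss) (fun x xs => near_setS mv (@subset_refl _ K) (sK x xs)).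
  have hh : map h' (map h s) = s.
    rewrite -map_comp -[RHS]map_id; apply/eq_in_map => y /sB By /=; exact: (ph_K H By).
  rewrite /g hh; case: allP => // nC; apply/eqP; apply: contraT => fs; exfalso; apply: nC.
  move=> y ys; apply/asboolP/rC.
  have [_ _ h3] := hu s (small_le mu ss) (hw s (fun _ _ => I) (small_le mw ss) fs).
  exact: h3.
Qed.
End Transport2.

Lemma supported_point {R : realType} {n : nat} (p : 'rV[R]_n) :
  supported (@dist R n) [set p] (point_cocycle p n).
Proof.
move=> r r0; apply: germS (point_cocycle_germ p n r0) => s _ h nz x xs; exists p => //.
rewrite dist_sym; apply: norm_lt => // i.
by have := h nz x xs i (ltn_ord i); rewrite !coE !mxE.
Qed.

Definition convex_set_rV {R : realType} {n : nat} (V : set 'rV[R]_n) :=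
  forall p q (u : R), V p -> V q -> 0 <= u <= 1 -> V (p + u *: (q - p)).

Lemma convex_ball {R : realType} {n : nat} (p : 'rV[R]_n) (r : R) :
  convex_set_rV [set y | dist p y < r].
Proof.
move=> x y u /= xr yr /andP[u0 u1].
rewrite /dist (_ : p - (x + u *: (y - x)) = (1 - u) *: (p - x) + u *: (p - y)); last first.
  apply/rowP => i; rewrite !mxE; ring.
apply: le_lt_trans (ler_normD _ _) _; rewrite !normrZ (ger0_norm u0) ger0_norm ?subr_ge0//.
have [->|u_neq0] := eqVneq u 0; first by rewrite subr0 mul1r mul0r addr0.
have {u_neq0}u0 : 0 < u by rewrite lt_def u_neq0.
rewrite [r](_ : _ = (1 - u) * r + u * r); last by ring.
by apply: ler_ltD; [rewrite ler_wpM2l ?subr_ge0// ltW|rewrite ltr_pM2l].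
Qed.

Lemma ball_chart {R : realType} {n : nat} {T : topologicalType} (C O : set T)
    (C' : set 'rV[R]_n) k k' p : part_homeo C C' k k' -> open O -> O p -> C p ->
  exists (r : R) W, [/\ 0 < r, open W, W `<=` C `&` O, W p
    & C' `&` k' @^-1` W = [set y | dist (k p) y < r]].
Proof.
move=> K oO Op Cp; have oCO : open (C `&` O) by apply: openI => //; exact: (ph_open K).
have KCO : part_homeo (C `&` O) (C' `&` k' @^-1` (C `&` O)) k k'.
  by apply: (part_homeo_sub K) => // x [].
have kp : (C' `&` k' @^-1` (C `&` O)) (k p) by exact: (ph_image KCO).
have [r r0 hr] : exists2 r : R, 0 < r & forall y, dist (k p) y < r -> (C' `&` k' @^-1` (C `&` O)) y.
  by apply: (gauge_nbhs dist_gauge) => //; apply: open_nbhs_nbhs; split=> //; exact: (ph_open' KCO).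
exists r, [set x | (C `&` O) x /\ dist (k p) (k x) < r]; split=> //.
- rewrite openE => x [COx px].
  have nC : nbhs x (C `&` O) by apply: open_nbhs_nbhs.
  have nD : nbhs x (k @^-1` [set y | dist (k p) y < r]).
    apply: (ph_cont KCO COx); have r1 : 0 < r - dist (k p) (k x) by rewrite subr_gt0.
    apply: filterS (gauge_ball dist_gauge (k x) r1) => z /= xz.
    by apply: le_lt_trans (dist_tri _ (k x) _) _; rewrite -ltrBrDl.
  by apply: filterS (filterI nC nD) => y [].
- by move=> x [].
- by split; rewrite ?dist_xx.
- apply/seteqP; split=> y /=; first by move=> [C'y [_]]; rewrite (ph_K' K C'y).
  by move=> yr; have [C'y COy] := hr y yr; split=> //; split=> //; rewrite (ph_K' K C'y).
Qed.

Section ChartCohomology.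
Context {R : realType} {n : nat} {M : topologicalType} (d : M -> M -> R) {G : set M}.
Context (dG : gauge d G) (lc : loc_compact M).
Notation E := 'rV[R]_n.
Notation germT := (germ d setT).

(** A representative on [M] of the class of [p]. It depends on the chart [h]; that the choice is
    immaterial modulo 2 is the content of [deg_point_class]. *)
Definition point_class (B : set M) (h : M -> E) p f :=
  [/\ hom n.+1 f, supported d [set p] f
    & corr (d := d) (B := B) (h := h) f (point_cocycle (h p) n)].

Section OneChart.
Context {B : set M} {B' : set E} {h : M -> E} {h' : E -> M} (H : part_homeo B B' h h').
Context (BG : B `<=` G).
Let BT : B' `<=` setT. Proof. by []. Qed.
Let dE := @dist_gauge R n.
Let H' := part_homeo_sym H.

Lemma point_class_exists p : B p -> exists f, point_class B h p f.
Proof.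
move=> Bp; have D1 : [set h p] `<=` B' by move=> _ ->; exact: (ph_image H).
have [f [hf sf cf]] := transport dE dG H' BT BG lc (@compact_set1 _ (h p)) D1
  (@hom_point_cocycle _ _ (h p) n) (supported_point (h p)).
exists f; split=> //; last exact: (corr_sym dE dG H' BG cf).
by apply: supported_sub sf => _ [_ -> <-]; rewrite (ph_K H).
Qed.

Lemma point_class_cocycle p f : B p -> point_class B h p f ->
  germT (fun s => coboundary f s = 0).
Proof.
move=> Bp [hf sf cf]; have D1 : [set p] `<=` B by move=> _ ->.
apply: (corr_germ dG dE H BG (@compact_set1 _ p) D1 (corr_coboundary cf) corr0).
- exact: (supported_coboundary dG (hom_nil hf)).
- exact: supported0.
- by apply: germW => s; rewrite coboundary_point_cocycle.
Qed.

Let csM_transport k W f : open W -> W `<=` B -> hom k f -> csM d W f ->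
  exists D g, [/\ compact D, D `<=` W, supported d D f & 
    [/\ hom k g, csM (@dist R n) (B' `&` h' @^-1` W) g, supported (@dist R n) (h @` D) g
      & corr (d := d) (B := B) (h := h) f g]].
Proof.
move=> oW WB hf [D [cD DW sD]].
have [g [hg sg cg]] := transport dG dE H BG BT euclidean_loc_compact cD (subset_trans DW WB) hf sD.
exists D, g; split=> //; split=> //; exists (h @` D); split=> //.
  by apply: image_compact => // y /DW/WB; exact: (ph_cont H).
move=> _ [x /DW Wx <-]; split; first exact/(ph_image H)/WB.
by rewrite /= (ph_K H (WB _ Wx)).
Qed.

Let csM_transport' k W g : W `<=` B -> hom k g ->
  csM (@dist R n) (B' `&` h' @^-1` W) g ->
  exists D f, [/\ compact D, D `<=` W, supported d D f, hom k f
    & corr (d := d) (B := B) (h := h) f g].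
Proof.
move=> WB hg [D [cD DW sD]].
have DB : D `<=` B' by move=> x /DW[].
have [f [hf sf cf]] := transport dE dG H' BT BG lc cD DB hg sD.
exists (h' @` D), f; split=> //.
- by apply: image_compact => // y /DB; exact: (ph_cont' H).
- by move=> _ [y /DW[_ Wy] <-].
- exact: (corr_sym dE dG H' BG cf).
Qed.

Lemma chart_decomp W f : open W -> W `<=` B -> hom n.+1 f -> csM d W f ->
  germT (fun s => coboundary f s = 0) ->
  exists ps F e, [/\ forall p, p \in ps -> W p /\ point_class B h p (F p), hom n e, csM d W e
    & germT (fun s => f s = \sum_(p <- ps) F p s + coboundary e s)].
Proof.
move=> oW WB hf cf fcoc.
have HW := part_homeo_sub H oW WB.
have [D [g [cD DW sD [hg cg sg fg]]]] := csM_transport oW WB hf cf.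
have gcoc : germ (@dist R n) setT (fun s => coboundary g s = 0).
  have cD' : compact (h @` D) by apply: image_compact => // y /DW/WB; exact: (ph_cont H).
  have DB' : h @` D `<=` B' by move=> _ [y /DW/WB By <-]; exact: (ph_image H).
  have cc := corr_sym dG dE H BT (corr_coboundary fg).
  have c0 := corr_sym dG dE H BT (@corr0 _ _ _ d B h).
  apply: (corr_germ dE dG H' BT cD' DB' cc c0) => //.
    exact: (supported_coboundary dE (hom_nil hg)).
  exact: supported0.
have cgE : csE (slice n 0) (B' `&` h' @^-1` W) g.
  by rewrite slice_n; apply: csM_csE (ph_open' HW) cg.
have [|ps' [psW _ [e' [he' ce' ge']]]] := decomposable_le (leqnn n) (leqnn n) hg cgE.
  by rewrite slice_n.
rewrite slice_n in ce' ge'.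
have [De [e [cDe DeW se he ee]]] := csM_transport' WB he' (csE_csM ce').
have /choice[F hF] : forall p, exists f, B p -> point_class B h p f.
  move=> p; have [Bp|nBp] := pselect (B p); last by exists (fun=> 0) => /nBp.
  by have [fp pfp] := point_class_exists Bp; exists fp.
have psW' p : p \in map h' ps' -> W p by move=> /mapP[q /psW[_ [_ Wq]] ->].
exists (map h' ps'), F, e; split=> //.
- by move=> p /psW' Wp; split=> //; exact/hF/WB.
- by exists De.
pose D' := D `|` ([set` map h' ps'] `|` De).
have cD' : compact D'.
  apply: compactU => //; apply: compactU => //; exact: finite_compact (finite_seq _).
have DB' : D' `<=` B by move=> x [/DW/WB|[/psW'/WB|/DeW/WB]].
have cs : corr (d := d) (B := B) (h := h) (fun s => \sum_(p <- map h' ps') F p s)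
    (fun s => \sum_(p <- map h' ps') point_cocycle (h p) n s).
  by apply: corr_sum => p /psW' Wp; have [] := hF p (WB _ Wp).
apply: (corr_germ dG dE H BG cD' DB' fg (corrD cs (corr_coboundary ee))).
- by apply: supported_sub sD => x; left.
- apply: supportedD; last first.
    apply: (supported_coboundary dG (hom_nil he)); by apply: supported_sub se => x Dx; right; right.
  apply: supported_sum => p pps; have [_ sp _] := (hF p (WB _ (psW' p pps))).
  by apply: supported_sub sp => _ ->; right; left.
apply: germS ge' => s _ ->; rewrite big_map; congr (_ + _); apply: eq_big_seq => q /psW[_ [Bq _]].
by rewrite (ph_K' H Bq).
Qed.

Lemma point_class_nontrivial p f e : B p -> point_class B h p f -> hom n e -> csM d B e ->
  ~ germT (fun s => f s = coboundary e s).
Proof.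
move=> Bp [hf sf cf] he ce fe.
have [D [e' [cD DB sD [he' ce' se ee]]]] := csM_transport (ph_open H) (@subset_refl _ B) he ce.
have HW := part_homeo_sub H (ph_open H) (@subset_refl _ B).
have ceE : csE (slice n (h p)) setT e'.
  by rewrite slice_n; apply: csM_csE openT _; apply: csM_sub ce'.
apply: (@point_cocycle_nontrivial _ _ n (h p) (h p) e') => //.
rewrite slice_n; pose D' := [set h p] `|` h @` D.
have cD' : compact D'.
  apply: compactU; first exact: compact_set1.
  by apply: image_compact => // y /DB; exact: (ph_cont H).
have DB' : D' `<=` B'.
  by move=> x [->|[y /DB By <-]]; exact: (ph_image H).
have cc := corr_sym dG dE H BT (corr_coboundary ee).
apply: (corr_germ dE dG H' BT cD' DB' (corr_sym dG dE H BT cf) cc) => //.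
- by apply: supported_sub (supported_point (h p)) => x; left.
- by apply: (supported_coboundary dE (hom_nil he')); apply: supported_sub se => x; right.
Qed.

Lemma point_class_segment W p q f g : open W -> W `<=` B ->
  convex_set_rV (B' `&` h' @^-1` W) -> W p -> W q ->
  point_class B h p f -> point_class B h q g ->
  exists e, [/\ hom n e, csM d W e & germT (fun s => f s = g s + coboundary e s)].
Proof.
move=> oW WB cW Wp Wq [hf sf cf] [hg sg cg].
have HW := part_homeo_sub H oW WB; set W' := B' `&` _ in cW.
have Wp' : W' (h p) by exact: (ph_image HW).
have Wq' : W' (h q) by exact: (ph_image HW).
pose seg := [set h p + u *: (h q - h p) | u in `[0, 1]].
have cseg : compact seg.
  apply: image_compact; last exact: segment_compact.
  move=> u _; apply: cvgD; first exact: cvg_cst.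
  exact: scalel_continuous.
have segW : seg `<=` W'.
  by move=> _ [u /itvP u01 <-]; apply: cW; rewrite // !u01.
have [r r0 hr] := near_set_sub dE cseg (@subsetT _ _) (ph_open' HW) segW.
have segr u y : 0 <= u <= 1 -> dist (h p + u *: (h q - h p)) y < r -> W' y.
  by move=> u01 uy; apply: hr; exists (h p + u *: (h q - h p)) => //; exists u; rewrite //= in_itv.
have [e' [he' ce' ge']] := point_cocycle_segment r0 segr.
have [De [e [cDe DeW se he ee]]] := csM_transport' WB he' (csE_csM ce').
exists e; split=> //; first by exists De.
pose D' := [set p] `|` ([set q] `|` De).
have cD' : compact D' by apply: compactU; [|apply: compactU => //]; exact: compact_set1.
have DB' : D' `<=` B by move=> x [->|[->|/DeW]]; exact: WB.
apply: (corr_germ dG dE H BG cD' DB' cf (corrD cg (corr_coboundary ee))) ge'.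
- by apply: supported_sub sf => x; left.
- apply: supportedD; first by apply: supported_sub sg => x ->; right; left.
  by apply: (supported_coboundary dG (hom_nil he)); apply: supported_sub se => x Dx; right; right.
Qed.
End OneChart.
End ChartCohomology.

(** * The fundamental class modulo 2 *)

Section Degree.
Context {R : realType} {n : nat} {M : topologicalType} (d : M -> M -> R) {G : set M}.
Context (dG : gauge d G) (lc : loc_compact M) (hM : hausdorff_space M).
Notation E := 'rV[R]_n.
Notation germ := (germ d setT).
Implicit Types (f g e : seq M -> 'F_2) (W : set M).

Definition cobounds W f := exists e, [/\ hom n e, csM d W e & germ (fun s => f s = coboundary e s)].

Definition cocycle_in W f := [/\ hom n.+1 f, csM d W f & germ (fun s => coboundary f s = 0)].

Lemma coboundsD W f g : cobounds W f -> cobounds W g -> cobounds W (fun s => f s + g s).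
Proof.
move=> [e [he ce fe]] [e' [he' ce' ge']]; exists (fun s => e s + e' s); split.
- exact: homD.
- exact: csMD.
- by apply: germS (germI fe ge') => s _ [-> ->]; rewrite coboundaryD.
Qed.

Lemma cobounds_eq W f g : germ (fun s => f s = g s) -> cobounds W f -> cobounds W g.
Proof.
move=> fg [e [he ce fe]]; exists e; split=> //.
by apply: germS (germI fg fe) => s _ [<-].
Qed.

Lemma cobounds_sub W W' f : W `<=` W' -> cobounds W f -> cobounds W' f.
Proof. by move=> WW [e [he ce fe]]; exists e; split=> //; apply: csM_sub ce. Qed.

Lemma cobounds0 W : cobounds W (fun=> 0).
Proof.
exists (fun=> 0); split=> //; first exact: csM0.
by apply: germW => s; rewrite coboundary0.
Qed.

Lemma cobounds_coboundary W e : hom n e -> csM d W e -> cobounds W (coboundary e).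
Proof. by move=> he ce; exists e; split=> //; apply: germW. Qed.

Lemma cobounds_addr W f g : cobounds W (fun s => f s + g s) -> cobounds W g -> cobounds W f.
Proof.
move=> fg cg; apply: cobounds_eq (coboundsD fg cg); apply: germW => s.
by rewrite -addrA addF2 addr0.
Qed.

Lemma cocycle_inD W f g : cocycle_in W f -> cocycle_in W g -> cocycle_in W (fun s => f s + g s).
Proof.
move=> [hf cf df] [hg cg dg]; split; [exact: homD|exact: csMD|].
by apply: germS (germI df dg) => s _ [E1 E2]; rewrite coboundaryD E1 E2 addr0.
Qed.

Lemma cocycle_in_coboundary W e : hom n e -> csM d W e -> cocycle_in W (coboundary e).
Proof.
move=> he ce; split; [exact: hom_coboundary| |by apply: germW => s; rewrite coboundaryK].
exact: (csM_coboundary dG (hom_nil he) ce).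
Qed.

Lemma cocycle_in0 W : cocycle_in W (fun=> 0).
Proof.
by split=> //; [exact: csM0|apply: germW => s; rewrite coboundary0].
Qed.

Lemma cocycle_in_sum W (I : eqType) (r : seq I) (F : I -> seq M -> 'F_2) :
  (forall i, i \in r -> cocycle_in W (F i)) -> cocycle_in W (fun s => \sum_(i <- r) F i s).
Proof.
elim: r => [|i r IH] hF.
  rewrite (_ : (fun s => _) = fun=> 0); first exact: cocycle_in0.
  by apply/funext => s; rewrite big_nil.
rewrite (_ : (fun s => _) = fun s => F i s + \sum_(j <- r) F j s).
  by apply: cocycle_inD; [apply: hF; rewrite mem_head|apply: IH => j jr; apply: hF; rewrite inE jr orbT].
by apply/funext => s; rewrite big_cons.
Qed.

Definition convex_chart (B : set M) (h : M -> E) := exists B' h',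
  [/\ part_homeo B B' h h', B `<=` G & convex_set_rV B'].

Lemma convex_chart_open B h : convex_chart B h -> open B.
Proof. by move=> [B' [h' [/ph_open]]]. Qed.

Lemma convex_chart_cocycle B h p f : convex_chart B h -> B p -> point_class d B h p f ->
  cocycle_in B f.
Proof.
move=> [B' [h' [H BG _]]] Bp pf; have [hf sf cf] := pf; split=> //.
  by exists [set p]; split=> //; [exact: compact_set1|move=> _ ->].
exact: (point_class_cocycle dG H BG Bp pf).
Qed.

(** In a convex set all point classes are cohomologous and cancel in pairs, so only the parity of
    their number matters. *)
Lemma sum_point_class B B' (h : M -> E) h' W p0 f0 ps (F : M -> seq M -> 'F_2) :
  part_homeo B B' h h' -> B `<=` G -> open W -> W `<=` B ->
  convex_set_rV (B' `&` h' @^-1` W) -> W p0 -> point_class d B h p0 f0 ->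
  (forall p, p \in ps -> W p /\ point_class d B h p (F p)) ->
  cobounds W (fun s => \sum_(p <- ps) F p s) \/
  cobounds W (fun s => \sum_(p <- ps) F p s + f0 s).
Proof.
move=> H BG oW WB cW Wp0 pf0; elim: ps => [|p ps IH] hF.
  by left; apply: cobounds_eq (cobounds0 W); apply: germW => s; rewrite big_nil.
have [Wp pfp] := hF p (mem_head _ _).
have [e [he ce pe]] := point_class_segment dG lc H BG oW WB cW Wp Wp0 pfp pf0.
have cp : cobounds W (fun s => F p s + f0 s).
  exists e; split=> //; apply: germS pe => s _ ->.
  by rewrite addrAC addF2 add0r.
have {}IH := IH (fun q qps => hF q (mem_behead (s := p :: ps) qps)).
case: IH => IH; [right|left].
  apply: cobounds_eq (coboundsD cp IH); apply: germW => s; rewrite big_cons.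
  by rewrite addrAC.
apply: cobounds_eq (coboundsD cp IH); apply: germW => s; rewrite big_cons.
by rewrite addrACA addF2 addr0.
Qed.

Lemma cocycle_or_point B h p fp f : convex_chart B h -> B p -> point_class d B h p fp ->
  cocycle_in B f -> cobounds B f \/ cobounds B (fun s => f s + fp s).
Proof.
move=> [B' [h' [H BG cB]]] Bp pfp [hf cf df].
have oB := ph_open H; have BB := @subset_refl _ B.
have cW : convex_set_rV (B' `&` h' @^-1` B).
  move=> x y u [B'x _] [B'y _] u01; have B'z := cB x y u B'x B'y u01.
  by split=> //; exact: (ph_image' H).
have [ps [F [e [hF he ce fe]]]] := chart_decomp dG lc H BG oB BB hf cf df.
have ce' := cobounds_coboundary he ce.
case: (sum_point_class H BG oB BB cW Bp pfp hF) => hc; [left|right].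
  by apply: cobounds_eq (coboundsD hc ce'); apply: germS fe.
apply: cobounds_eq (coboundsD hc ce'); apply: germS fe => s _ ->.
by rewrite addrAC.
Qed.

(** The isomorphism of the compactly supported top cohomology of a convex chart with ['F_2]: by
    [cocycle_or_point] a class is zero or the class of a point, so it suffices to decide whether it
    is zero. *)
Definition deg B f : 'F_2 := (~~ `[< cobounds B f >])%:R.

Lemma deg_cobounds B f : cobounds B f -> deg B f = 0.
Proof. by move=> cf; rewrite /deg; case: asboolP. Qed.

Lemma deg_ncobounds B f : ~ cobounds B f -> deg B f = 1.
Proof. by move=> cf; rewrite /deg; case: asboolP. Qed.

(** If neither class is zero, both are the class of one point and they cancel. Such a point exists,
    since a cocycle that is not a coboundary has nonempty support. *)
Lemma degD B h f g : convex_chart B h -> cocycle_in B f -> cocycle_in B g ->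
  deg B (fun s => f s + g s) = deg B f + deg B g.
Proof.
move=> cB cf cg; have [Bf|nBf] := pselect (cobounds B f).
  rewrite (deg_cobounds Bf) add0r; have [Bg|nBg] := pselect (cobounds B g).
    by rewrite (deg_cobounds Bg) (deg_cobounds (coboundsD Bf Bg)).
  rewrite (deg_ncobounds nBg) deg_ncobounds// => Bfg; apply: nBg.
  apply: cobounds_addr Bf; apply: cobounds_eq Bfg; apply: germW => s; exact: addrC.
have [Bg|nBg] := pselect (cobounds B g).
  rewrite (deg_cobounds Bg) addr0 (deg_ncobounds nBf) deg_ncobounds// => Bfg; apply: nBf.
  exact: (cobounds_addr Bfg Bg).
rewrite (deg_ncobounds nBf) (deg_ncobounds nBg) addF2 deg_cobounds//.
have [B' [h' [H BG _]]] := cB.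
have [p Bp] : exists p, B p.
  have [hf cf' df] := cf; have [D [cD DB sD]] := cf'.
  have [[p Dp]|D0] := pselect (D !=set0); first by exists p; exact: DB.
  exfalso; apply: nBf; apply: cobounds_eq (cobounds0 B).
  apply: germS (sD 1 ltr01) => -[|x s] _ hD; first by rewrite (hom_nil hf).
  apply/eqP; rewrite eq_sym; apply: contraT => /hD/(_ x (mem_head _ _))[y Dy _].
  by case: D0; exists y.
have [fp pfp] := point_class_exists dG lc H BG Bp.
case: (cocycle_or_point cB Bp pfp cf) => // c1.
case: (cocycle_or_point cB Bp pfp cg) => // c2.
apply: cobounds_eq (coboundsD c1 c2); apply: germW => s.
by rewrite addrACA addF2 addr0.
Qed.

Lemma deg_sum B h (I : eqType) (r : seq I) (F : I -> seq M -> 'F_2) : convex_chart B h ->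
  (forall i, i \in r -> cocycle_in B (F i)) ->
  deg B (fun s => \sum_(i <- r) F i s) = \sum_(i <- r) deg B (F i).
Proof.
move=> cB; elim: r => [|i r IH] hF.
  rewrite big_nil; apply: deg_cobounds; apply: cobounds_eq (cobounds0 B).
  by apply: germW => s; rewrite big_nil.
have hF' j : j \in r -> cocycle_in B (F j) by move=> jr; apply: hF; rewrite inE jr orbT.
rewrite big_cons -IH// -(degD cB (hF i (mem_head _ _)) (cocycle_in_sum hF')).
by congr (deg B _); apply/funext => s; rewrite big_cons.
Qed.

(** Near [p] the class [f] decomposes into point classes of the chart [k], hence is there zero or
    the class of [p] in that chart. The first case contradicts nontriviality in [B]; in the second,
    a primitive of [f] in [C] contradicts nontriviality in [C]. *)
Lemma deg_point_class B h C k p f : convex_chart B h -> convex_chart C k -> B p -> C p ->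
  point_class d B h p f -> deg C f = 1.
Proof.
move=> [B' [h' [H BG _]]] [C' [k' [K CG cC]]] Bp Cp pf; apply: deg_ncobounds => Cf.
have [r [W [r0 oW WCB Wp EW]]] := ball_chart K (ph_open H) Bp Cp.
have WC : W `<=` C by move=> x /WCB[].
have WB : W `<=` B by move=> x /WCB[].
have cW : convex_set_rV (C' `&` k' @^-1` W) by rewrite EW; exact: convex_ball.
have [hf sf cf] := pf.
have cfW : csM d W f by exists [set p]; split=> //; [exact: compact_set1|move=> _ ->].
have df := point_class_cocycle dG H BG Bp pf.
have [ps [F [e [hF he ce fe]]]] := chart_decomp dG lc K CG oW WC hf cfW df.
have [gp pgp] := point_class_exists dG lc K CG Cp.
have ce' := cobounds_coboundary he ce.
have nt B1 B1' (h1 : M -> E) h1' f1 : part_homeo B1 B1' h1 h1' -> B1 `<=` G -> B1 p -> point_class d B1 h1 p f1 ->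
    ~ cobounds B1 f1.
  move=> H1 B1G B1p pf1 [e1 [he1 ce1 fe1]].
  exact: (point_class_nontrivial dG H1 B1G B1p pf1 he1 ce1 fe1).
case: (sum_point_class K CG oW WC cW Wp pgp hF) => hc.
  apply: (nt _ _ _ _ _ H BG Bp pf); apply: (cobounds_sub WB).
  by apply: cobounds_eq (coboundsD hc ce'); apply: germS fe.
apply: (nt _ _ _ _ _ K CG Cp pgp).
apply: cobounds_addr Cf; apply: (cobounds_sub WC).
apply: cobounds_eq (coboundsD hc ce'); apply: germS fe => s _ ->.
by rewrite addrAC addrC.
Qed.

(** A point of [D] lies in [D'] or has a neighbourhood at positive distance from [D']; compactness
    of [D] gives one scale for all of them. *)
Lemma supportedI D D' f : compact D -> compact D' -> D `<=` G ->
  supported d D f -> supported d D' f -> supported d (D `&` D') f.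
Proof.
move=> cD cD' DG sf sf' r r0.
pose Q (S : set M) := exists2 q : R, 0 < q & forall x, S x -> D x -> forall y, d x y < q ->
  near_set d q D' y -> near_set d r (D `&` D') y.
have [q q0 hq] : Q D.
  apply: compact_ind cD; rewrite /Q.
  - by exists 1.
  - by move=> S S' SS' [q q0 hq]; exists q => // x /SS'; apply: hq.
  - move=> S S' [q q0 hq] [u u0 hu]; exists (Num.min q u); first by rewrite lt_min q0.
    move=> x [Sx|Sx] Dx y; rewrite lt_min => /andP[h1 h2] h3; [apply: (hq x) => //|apply: (hu x) => //].
      by apply: near_setS h3; rewrite ?ge_min ?lexx.
    by apply: near_setS h3; rewrite ?ge_min ?lexx ?orbT.
  move=> x Dx; have [D'x|nD'x] := pselect (D' x).
    have r2 : 0 < r / 2 by rewrite divr_gt0.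
    exists [set y | d x y < r / 2]; first exact: (gauge_ball dG _ r2).
    exists (r / 2) => // z /= xz Dz y zy _; exists x => //.
    by apply: le_lt_trans (gauge_tri dG x z y) _; rewrite [r]splitr ltrD.
  have nx : nbhs x (~` D').
    by apply: open_nbhs_nbhs; split=> //; apply: closed_openC; apply: compact_closed.
  have [v v0 hv] := gauge_nbhs dG (DG x Dx) nx.
  have v3 : 0 < v / 3 by rewrite divr_gt0.
  exists [set y | d x y < v / 3]; first exact: (gauge_ball dG _ v3).
  exists (v / 3) => // z /= xz Dz y zy [w D'w wy]; exfalso; apply: (hv w) => //.
  have := gauge_tri dG x z w; have := gauge_tri dG z y w.
  rewrite (gauge_sym dG y w); lra.
apply: germS (germI (sf q q0) (sf' q q0)) => s _ [h1 h2] nz x xs.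
have [y Dy yx] := h1 nz x xs; exact: (hq y Dy Dy x yx (h2 nz x xs)).
Qed.

Lemma csM_splitn k m (U : nat -> set M) f : (forall j, (j < m)%N -> open (U j)) ->
  (forall j, (j < m)%N -> U j `<=` G) -> hom k f ->
  csM d [set x | exists2 j, (j < m)%N & U j x] f ->
  exists F : nat -> seq M -> 'F_2,
    [/\ forall j, hom k (F j), forall j, (j < m)%N -> csM d (U j) (F j)
      & germ (fun s => f s = \sum_(j < m) F j s)].
Proof.
elim: m f => [|m IH] f oU UG hf cf.
  exists (fun=> fun=> 0); split=> //.
  have [D [_ D0 sD]] := cf; apply: germS (sD 1 ltr01) => -[|x s] _ h.
    by rewrite big_ord0 (hom_nil hf).
  rewrite big_ord0; apply/eqP; apply: contraT => /h/(_ x (mem_head _ _))[y /D0[]//].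
pose V := [set x | exists2 j, (j < m)%N & U j x].
have oV : open V.
  rewrite openE => x [j jm Ux]; have /(_ (ltnW jm)) := oU j; rewrite openE => /(_ x Ux).
  by apply: filterS => y Uy; exists j.
have VG : V `<=` G by move=> x [j jm]; exact/UG/ltnW.
have cf' : csM d (V `|` U m) f.
  apply: csM_sub cf => x [j]; rewrite ltnS leq_eqVlt => /predU1P[->|jm] Ux; first by right.
  by left; exists j.
have [f1 [f2 [hf1 hf2 cf1 cf2 fE]]] := csM_split dG lc oV (oU m (ltnSn m)) VG hf cf'.
have [F [hF cF FE]] := IH f1 (fun j jm => oU j (ltnW jm)) (fun j jm => UG j (ltnW jm)) hf1 cf1.
exists (fun j => if j == m then f2 else F j); split.
- by move=> j; case: ifP.
- move=> j; rewrite ltnS leq_eqVlt => /predU1P[->|jm]; first by rewrite eqxx.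
  by rewrite ltn_eqF//; apply: cF.
- apply: germS FE => s _ E; rewrite fE E big_ord_recr /= eqxx; congr (_ + _).
  by apply: eq_bigr => j _; rewrite ltn_eqF.
Qed.

(* Compatibility of the local degrees, by induction on the number of charts: the
   cocycle of the last chart is supported in the union of the others, hence is
   cohomologous to a sum of point classes there. *)
Lemma sum_deg0 m (B : nat -> set M) (h : nat -> M -> E) (f : nat -> seq M -> 'F_2) :
  (forall j, (j < m)%N -> convex_chart (B j) (h j)) ->
  (forall j, (j < m)%N -> cocycle_in (B j) (f j)) ->
  germ (fun s => \sum_(j < m) f j s = 0) ->
  \sum_(j < m) deg (B j) (f j) = 0.
Proof.
elim: m f => [|m IH] f hB hf f0; first by rewrite big_ord0.
have [hfm [D [cD DB sD]] dfm] := hf m (ltnSn m).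
have [Bm' [hm' [Hm BmG cBm]]] := hB m (ltnSn m).
pose V := [set x | exists2 j, (j < m)%N & B j x].
have oB j : (j < m)%N -> open (B j) by move=> jm; exact/convex_chart_open/hB/ltnW.
have BjG j : (j < m)%N -> B j `<=` G by move=> jm; have [? [? []]] := hB j (ltnW jm).
have [Fs [cFs FsV sFs]] : csM d V (fun s => \sum_(j < m) f j s).
  apply: csM_sum => j; have [_ cj _] := hf j (ltnW (ltn_ord j)).
  by apply: csM_sub cj => x Bx; exists j.
have fmE : germ (fun s => \sum_(j < m) f j s = f m s).
  by apply: germS f0 => s _; rewrite big_ord_recr /= => /addF2_eq.
pose W := B m `&` V.
have oV : open V.
  rewrite openE => x [j jm Ux]; have := oB j jm; rewrite openE => /(_ x Ux).
  by apply: filterS => y Uy; exists j.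
have oW : open W by apply: openI => //; exact: (ph_open Hm).
have WB : W `<=` B m by move=> x [].
have cW : csM d W (f m).
  exists (D `&` Fs); split.
  - by apply: compact_closedI => //; apply: compact_closed.
  - by move=> x [/DB Bx /FsV Vx].
  - apply: supportedI => //; first exact: (subset_trans DB BmG).
    exact: (supported_eq fmE sFs).
have [ps [F [e [hF he ce fe]]]] := chart_decomp dG lc Hm BmG oW WB hfm cW dfm.
have [] := @csM_splitn n m (fun j => B m `&` B j) e.
- by move=> j jm; apply: openI; [exact: (ph_open Hm)|exact: oB].
- by move=> j jm x [/BmG].
- exact: he.
- by apply: csM_sub ce => x [Bx [j jm Bj]]; exists j.
move=> es [hes ces eE].
have /choice[k hk] : forall p, exists j : nat, p \in ps -> (j < m)%N /\ B j p.
  move=> p; have [pps|/negP npps] := boolP (p \in ps); last by exists 0%N.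
  by have [[_ [j jm Bj]] _] := hF p pps; exists j.
(* Every point class of [f m], and every piece of the primitive [e], is handed to one of the
   remaining charts. The [ff j] again sum to zero, and the points are added to the degrees. *)
pose ff j s := f j s + (\sum_(p <- ps | k p == j) F p s + coboundary (es j) s).
have Fsum j : (j < m)%N -> cocycle_in (B j) (fun s => \sum_(p <- ps | k p == j) F p s).
  move=> jm; rewrite (_ : (fun s => _) = fun s => \sum_(p <- [seq p <- ps | k p == j]) F p s); last first.
    by apply/funext => s; rewrite big_filter.
  apply: cocycle_in_sum => p; rewrite mem_filter => /andP[/eqP kpj pps].
  have [[Bp _] pp] := hF p pps; have [_ Bkp] := hk p pps; rewrite kpj in Bkp.
  have [hp cp dp] := convex_chart_cocycle (hB m (ltnSn m)) Bp pp.
  have [_ sp _] := pp; split=> //; exists [set p]; split=> //; first exact: compact_set1.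
  by move=> _ ->.
have ces' j : (j < m)%N -> csM d (B j) (es j).
  by move=> jm; apply: csM_sub (ces j jm) => x [].
have dces j : (j < m)%N -> cocycle_in (B j) (coboundary (es j)).
  by move=> jm; apply: cocycle_in_coboundary => //; exact: ces'.
have := IH ff (fun j jm => hB j (ltnW jm)).
have -> : \sum_(j < m) deg (B j) (ff j) = \sum_(j < m) deg (B j) (f j) + \sum_(p <- ps) 1.
  have -> : \sum_(p <- ps) 1 = \sum_(j < m) \sum_(p <- ps | k p == j) (1 : 'F_2).
    rewrite (exchange_big_dep predT)//= big_seq [RHS]big_seq; apply: eq_bigr => p pps.
    have [km _] := hk p pps; rewrite (big_pred1 (Ordinal km))//.
  rewrite -big_split /=; apply: eq_bigr => j _.
  have jm := ltn_ord j; have cB := hB j (ltnW jm).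
  have E1 := degD cB (Fsum j jm) (dces j jm).
  rewrite (degD cB (hf j (ltnW jm)) (cocycle_inD (Fsum j jm) (dces j jm))) E1.
  rewrite [deg (B j) (coboundary _)]deg_cobounds ?addr0; last exact/cobounds_coboundary/ces'.
  congr (_ + _); rewrite (_ : (fun s => _) = fun s => \sum_(p <- [seq p <- ps | k p == j]) F p s); last first.
    by apply/funext => s; rewrite big_filter.
  rewrite -[RHS]big_filter (deg_sum cB); last first.
    move=> p; rewrite mem_filter => /andP[/eqP kpj pps].
    have [[Bp _] pp] := hF p pps; have [_ Bkp] := hk p pps; rewrite kpj in Bkp.
    have [hp cp dp] := convex_chart_cocycle (hB m (ltnSn m)) Bp pp.
    have [_ sp _] := pp; split=> //; exists [set p]; split=> //; first exact: compact_set1.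
    by move=> _ ->.
  apply: eq_big_seq => p; rewrite mem_filter => /andP[/eqP kpj pps].
  have [[Bp _] pp] := hF p pps; have [_ Bkp] := hk p pps; rewrite kpj in Bkp.
  exact: (deg_point_class (hB m (ltnSn m)) cB Bp Bkp pp).
have degm : deg (B m) (f m) = \sum_(p <- ps) 1.
  have cem : csM d (B m) e by apply: csM_sub ce.
  have cFps : cocycle_in (B m) (fun s => \sum_(p <- ps) F p s).
    apply: cocycle_in_sum => p /hF[[Bp _] pp].
    exact: (convex_chart_cocycle (hB m (ltnSn m)) Bp pp).
  have -> : deg (B m) (f m) = deg (B m) (fun s => \sum_(p <- ps) F p s + coboundary e s).
    have [c1|c1] := pselect (cobounds (B m) (f m)).
      by rewrite !deg_cobounds//; apply: cobounds_eq c1.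
    rewrite !deg_ncobounds// => c2; apply: c1; apply: cobounds_eq c2.
    by apply: germS fe => s _ ->.
  rewrite (degD (hB m (ltnSn m)) cFps (cocycle_in_coboundary he cem)).
  rewrite [deg _ (coboundary e)]deg_cobounds ?addr0; last exact: cobounds_coboundary.
  rewrite (deg_sum (hB m (ltnSn m))); last first.
    by move=> p /hF[[Bp _] pp]; exact: (convex_chart_cocycle (hB m (ltnSn m)) Bp pp).
  apply: eq_big_seq => p /hF[[Bp _] pp].
  exact: (deg_point_class (hB m (ltnSn m)) (hB m (ltnSn m)) Bp Bp pp).
rewrite big_ord_recr /= degm; apply.
- move=> j jm; apply: cocycle_inD; first exact/hf/ltnW.
  by apply: cocycle_inD; [exact: Fsum|exact: dces].
- apply: germS (germI (germI fmE fe) (germ_coboundary eE)) => s _ [[E1 E2] E3].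
  rewrite big_split /= E1 big_split /= E2.
  rewrite -coboundary_sum -E3 addrACA addF2 addr0.
  have -> : \sum_(j < m) \sum_(p <- ps | k p == j) F p s = \sum_(p <- ps) F p s.
    rewrite (exchange_big_dep predT)//= big_seq [RHS]big_seq; apply: eq_bigr => p pps.
    have [km _] := hk p pps; rewrite (big_pred1 (Ordinal km))//.
  by rewrite addF2.
Qed.

(* The existence of the fundamental class modulo 2. *)
Theorem point_class_not_boundary (O B : set M) h p f e :
  (forall x, O x -> exists C k, [/\ convex_chart C k, C x & C `<=` O]) ->
  convex_chart B h -> B p -> B `<=` O -> point_class d B h p f ->
  hom n e -> csM d O e -> ~ germ (fun s => f s = coboundary e s).
Proof.
move=> hO cB Bp BO pf he [D [cD DO sD]] fe.
(* The chart [B] of [p] is kept as the first chart of the cover, so that its index is known. *)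
pose Q (S : set M) := exists m (C : nat -> set M) (k : nat -> M -> E),
  [/\ (0 < m)%N, C 0%N = B, k 0%N = h,
      forall j, (j < m)%N -> convex_chart (C j) (k j)
    & forall x, S x -> D x -> exists2 j, (j < m)%N & C j x].
have QQ : Q D.
  apply: compact_ind cD; rewrite /Q.
  - by exists 1%N, (fun=> B), (fun=> h); split=> // -[].
  - move=> S S' SS' [m [C [k [m0 C0 k0 Ck hC]]]]; exists m, C, k; split=> // x /SS'; exact: hC.
  - move=> S S' [m [C [k [m0 C0 k0 Ck hC]]]] [m' [C' [k' [m'0 C'0 k'0 Ck' hC']]]].
    exists (m + m')%N, (fun j => if (j < m)%N then C j else C' (j - m)%N),
      (fun j => if (j < m)%N then k j else k' (j - m)%N); split.
    + by rewrite addn_gt0 m0.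
    + by rewrite m0.
    + by rewrite m0.
    + move=> j jm; case: ltnP => mj; first exact: Ck.
      by apply: Ck'; rewrite ltn_subLR.
    + move=> x [Sx|Sx] Dx.
        have [j jm Cx] := hC x Sx Dx; exists j; rewrite ?jm//.
        by apply: leq_trans jm _; rewrite leq_addr.
      have [j jm Cx] := hC' x Sx Dx; exists (m + j)%N; first by rewrite ltn_add2l.
      by rewrite ltnNge leq_addr /= addKn.
  move=> x Dx; have [C [k [Ck Cx CO]]] := hO x (DO x Dx).
  exists C; first by apply: open_nbhs_nbhs; split=> //; exact: (convex_chart_open Ck).
  exists 2%N, (fun j => if j is 0 then B else C), (fun j => if j is 0 then h else k); split=> //.
    by case.
  by move=> y Cy _; exists 1%N.
case: QQ => m [C [k [m0 C0 k0 Ck hC]]].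
have CG j : (j < m)%N -> C j `<=` G by move=> jm; have [? [? []]] := Ck j jm.
have ceU : csM d [set x | exists2 j, (j < m)%N & C j x] e.
  by exists D; split=> // x Dx; exact: hC.
have [es [hes ces eE]] := csM_splitn (fun j jm => convex_chart_open (Ck j jm)) CG he ceU.
(* These cocycles sum to [f] plus the coboundary of [e], that is to zero, yet only the first one has
   nonzero degree. *)
pose ff j s := coboundary (es j) s + (if j is 0 then f s else 0).
have cf := convex_chart_cocycle cB Bp pf.
have dces j : (j < m)%N -> cocycle_in (C j) (coboundary (es j)).
  by move=> jm; apply: cocycle_in_coboundary => //; exact: ces.
have hff j : (j < m)%N -> cocycle_in (C j) (ff j).
  move=> jm; apply: cocycle_inD; first exact: dces.
  by case: j jm => [|j] jm; [rewrite C0|exact: cocycle_in0].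
have : \sum_(j < m) deg (C j) (ff j) = 0.
  apply: (sum_deg0 Ck hff).
  apply: germS (germI fe (germ_coboundary eE)) => s _ [E1 E2].
  rewrite big_split /= -coboundary_sum -E2 -E1.
  case: m m0 {hC Ck CG ceU ces eE dces hff E2} => // m _.
  by rewrite big_ord_recl /= big1 ?addr0 ?addF2.
case: m m0 hC Ck CG ceU ces eE dces hff => // m _ hC Ck CG ceU ces eE dces hff.
rewrite big_ord_recl /= big1 => [|j _]; last first.
  have jm : (bump 0 j < m.+1)%N by rewrite /bump add1n ltnS.
  rewrite [deg _ _]deg_cobounds//.
  apply: cobounds_eq (cobounds_coboundary (hes (bump 0 j)) (ces _ jm)).
  by apply: germW => s; rewrite /ff /bump add1n addr0.
have -> : ff 0%N = fun s => coboundary (es 0%N) s + f s by [].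
rewrite addr0; have cC0 := Ck 0%N (ltn0Sn m); rewrite C0 k0 in cC0.
have d0 := dces 0%N (ltn0Sn m); rewrite C0 in d0 *.
rewrite (degD cC0 d0 cf) [deg _ (coboundary _)]deg_cobounds.
  by rewrite add0r (deg_point_class cC0 cC0 Bp Bp pf) => /(congr1 val).
by apply: cobounds_coboundary => //; rewrite -C0; exact: ces.
Qed.
End Degree.

(** * Manifolds *)

Section GaugeConstruction.
Context {R : realType} {n : nat} {M : topologicalType} (hM : hausdorff_space M).
Notation E := 'rV[R]_n.

Lemma continuous_ext_at {T U : topologicalType} (f g : T -> U) x (V : set T) :
  nbhs x V -> (forall y, V y -> f y = g y) -> {for x, continuous g} -> {for x, continuous f}.
Proof.
move=> Vx fg cg W; rewrite (fg x (nbhs_singleton Vx)) => /cg gW.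
by apply: filterS (filterI Vx gW) => y [Vy Wy]; rewrite /= fg.
Qed.

(** The distance is pulled back along the pair of a bump function [rho] and the chart multiplied by
    [rho]. The pair is continuous on all of [M] and determines the chart coordinates wherever [rho]
    is positive. *)
Lemma chart_gauge (C : set M) (C' : set E) k k' p : part_homeo C C' k k' -> C p ->
  exists2 V, nbhs p V & exists d : M -> M -> R, gauge d V.
Proof.
move=> K Cp.
have [C0 [r [cC0 C0C r0 rC]]] := near_set_compact dist_gauge euclidean_loc_compact
  (@compact_set1 _ (k p)) (@subsetT _ _) (ph_open' K) (fun y (yp : y = k p) =>
    eq_ind_r C' (ph_image K Cp) yp).
have {}rC y : dist (k p) y < r -> C0 y by move=> yr; apply: rC; exists (k p).
pose S := k' @` C0.
have clS : closed S.
  by apply: compact_closed => //; apply: image_compact => // y /C0C; exact: (ph_cont' K).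
have SC : S `<=` C by move=> _ [y /C0C C'y <-]; exact: (ph_image' K).
pose rho x : R := if pselect (C x) then Num.max 0 (r - dist (k p) (k x)) else 0.
have rhoS x : ~ S x -> rho x = 0.
  move=> nSx; rewrite /rho; case: pselect => // Cx; apply/max_idPl; rewrite subr_le0 leNgt.
  by apply: contra_notN nSx => kr; exists (k x); [exact: rC|exact: (ph_K K)].
pose F x : E := rho x *: k x.
(* [rho] is given by a formula on the open set [C] and vanishes off the closed set [S] inside [C],
   so two open sets cover [M]. *)
have rho_c x : {for x, continuous rho}.
  have [Cx|nCx] := pselect (C x).
    apply: (@continuous_ext_at _ _ _ (fun x => Num.max 0 (r - dist (k p) (k x))) _ C).
    - by apply: open_nbhs_nbhs; split=> //; exact: (ph_open K).
    - by move=> y Cy; rewrite /rho; case: pselect.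
    - have c0 : {for x, continuous ((fun=> 0) : M -> R^o)} by exact: cvg_cst.
      have c1 : {for x, continuous ((fun x => r - dist (k p) (k x)) : M -> R^o)}.
        apply: cvgB; first exact: cvg_cst.
        apply: cvg_norm; apply: cvgB; first exact: cvg_cst.
        exact: (ph_cont K Cx).
      exact: (continuous_max c0 c1).
  apply: (@continuous_ext_at _ _ _ (fun=> 0) _ (~` S)); last exact: cvg_cst.
  - by apply: open_nbhs_nbhs; split; [exact: closed_openC|move=> /SC].
  - by move=> y /rhoS.
have F_c x : {for x, continuous F}.
  have [Cx|nCx] := pselect (C x).
    by apply: cvgZ; [exact: rho_c|exact: (ph_cont K Cx)].
  apply: (@continuous_ext_at M E F (fun=> 0) x (~` S)); last exact: cvg_cst.
  - by apply: open_nbhs_nbhs; split; [exact: closed_openC|move=> /SC].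
  - by move=> y nSy; rewrite /F rhoS// scale0r.
have rho_pos x : 0 < rho x -> C x /\ dist (k p) (k x) < r.
  rewrite /rho; case: pselect => [Cx|nCx] /=; last by rewrite ltxx.
  by rewrite lt_max ltxx /= subr_gt0.
exists [set x | 0 < rho x].
  apply: (rho_c p [set t : R | 0 < t]); apply: open_nbhs_nbhs; split; first exact: open_gt.
  rewrite /= /rho; case: pselect => [Cp1|nCp] /=; last by case: nCp.
  by rewrite lt_max dist_xx subr0 r0 orbT.
exists (fun x y => `|rho x - rho y| + `|F x - F y|); split.
- by move=> x; rewrite !subrr !normr0 addr0.
- by move=> x y; rewrite distrC (distrC (F x)).
- by move=> x y z; rewrite addrACA lerD// ler_distD.
- have c1 : continuous rho := rho_c; have c2 : continuous F := F_c.
  move=> [x y]; apply: cvgD; apply: cvg_norm; apply: cvgB.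
  + by apply: (@cvg_comp _ _ _ fst rho _ (nbhs x)); [exact: cvg_fst|exact: rho_c].
  + by apply: (@cvg_comp _ _ _ snd rho _ (nbhs y)); [exact: cvg_snd|exact: rho_c].
  + by apply: (@cvg_comp _ _ _ fst F _ (nbhs x)); [exact: cvg_fst|exact: F_c].
  + by apply: (@cvg_comp _ _ _ snd F _ (nbhs y)); [exact: cvg_snd|exact: F_c].
move=> x V /= rx Vx; have [Cx kx] := rho_pos x rx.
have [q q0 hq] : exists2 q : R, 0 < q & forall w, dist (k x) w < q -> (C' `&` k' @^-1` V) w.
  apply: (gauge_nbhs dist_gauge) => //; have C'x := ph_image K Cx; apply: filterI.
    by apply: open_nbhs_nbhs; split=> //; exact: (ph_open' K).
  by apply: (ph_cont' K C'x); rewrite (ph_K K Cx).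
(* If [rho] and [F] vary by less than [e], then [rho x * dist (k x) (k y)] is less than [e * L],
   because [k y] has norm at most [L - 1]. *)
pose L := 1 + (`|k p| + r).
have L0 : 0 < L by rewrite /L ltr_pwDl// addr_ge0// ltW.
pose e := Num.min (rho x) (q * rho x / L).
have e0 : 0 < e by rewrite lt_min rx divr_gt0// mulr_gt0.
exists e => // y dxy.
have h1 : `|rho x - rho y| < e by apply: le_lt_trans dxy; rewrite lerDl.
have h2 : `|F x - F y| < e by apply: le_lt_trans dxy; rewrite lerDr.
have ry : 0 < rho y.
  move: h1; rewrite ltr_norml => /andP[_]; rewrite /e lt_min => /andP[h _]; lra.
have [Cy ky] := rho_pos y ry.
have kyL : `|k y| <= `|k p| + r.
  rewrite -[k y](subrK (k p)) addrC; apply: le_trans (ler_normD _ _) _.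
  by rewrite lerD2l -/(dist _ _) dist_sym ltW.
suff : dist (k x) (k y) < q by move=> /hq[_]; rewrite /= (ph_K K Cy).
rewrite -(ltr_pM2l rx) /dist -[X in X * _](gtr0_norm rx) -normrZ scalerBr.
have -> : rho x *: k x - rho x *: k y = (F x - F y) + (rho y - rho x) *: k y.
  by rewrite /F scalerBl addrA subrK.
apply: le_lt_trans (ler_normD _ _) _; rewrite normrZ distrC.
apply: (@lt_le_trans _ _ (e * L)); last first.
  by rewrite mulrC -ler_pdivlMl// /e ge_min [L^-1 * _]mulrC [rho x * q]mulrC lexx orbT.
rewrite /L mulrDr mulr1; apply: ltr_leD; first by rewrite distrC.
by apply: ler_pM => //; rewrite distrC ltW.
Qed.

(** The sum of two gauges is a gauge for the union, so the local ones combine by compactness. *)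
Lemma compact_gauge (N : set M) : (forall x, exists C C' k k', @part_homeo M E C C' k k' /\ C x) ->
  compact N -> exists d : M -> M -> R, gauge d N.
Proof.
move=> charts cN; pose Q (S : set M) := exists d : M -> M -> R, gauge d S.
apply: (compact_ind (Q := Q)) cN; rewrite /Q.
- exists (fun _ _ => 0); split=> //.
  by move=> p; exact: cvg_cst.
- by move=> S S' SS' [d [h1 h2 h3 h4 h5]]; exists d; split=> // x V /SS'; exact: h5.
- move=> S S' [d dS] [d' dS']; exists (fun x y => d x y + d' x y); split.
  + by move=> x; rewrite (gauge_xx dS) (gauge_xx dS') addr0.
  + by move=> x y; rewrite (gauge_sym dS) (gauge_sym dS').
  + by move=> x y z; rewrite addrACA lerD// ?(gauge_tri dS) ?(gauge_tri dS').
  + by move=> p; apply: cvgD; [exact: (gauge_continuous dS)|exact: (gauge_continuous dS')].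
  + move=> x V [Sx|Sx] Vx.
      have [r r0 hr] := gauge_nbhs dS Sx Vx; exists r => // y xy; apply: hr.
      by apply: le_lt_trans xy; rewrite lerDl (gauge_ge0 dS').
    have [r r0 hr] := gauge_nbhs dS' Sx Vx; exists r => // y xy; apply: hr.
    by apply: le_lt_trans xy; rewrite lerDr (gauge_ge0 dS).
- by move=> x _; have [C [C' [k [k' [K Cx]]]]] := charts x; exact: (chart_gauge K Cx).
Qed.
End GaugeConstruction.

Section Manifold.
Context {R : realType} {n : nat} {M : topologicalType} {A : set (chart R n M)}.
Context (MA : smooth_manifold A).
Notation E := 'rV[R]_n.

Lemma chart_homeo (c : chart R n M) :
  part_homeo (chart_dom c) (chart_fun c @` chart_dom c) (chart_fun c) (chart_inv c).
Proof.
split.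
- exact: chart_dom_open.
- exact: chart_img_open.
- by move=> x cx; exists x.
- by move=> _ [x cx <-]; rewrite chart_funK.
- by move=> x; exact: chart_funK.
- by move=> _ [x cx <-]; rewrite chart_funK.
- have := @chart_fun_continuous R n M c; rewrite continuous_open_subspace; last exact: chart_dom_open.
  by move=> h x cx; apply: h; exact: mem_set.
- have := @chart_inv_continuous R n M c; rewrite continuous_open_subspace; last exact: chart_img_open.
  by move=> h x cx; apply: h; exact: mem_set.
Qed.

Lemma manifold_charts x : exists C C' k k', @part_homeo M E C C' k k' /\ C x.
Proof.
have [c _ cx] := atlas_covers MA x.
by exists (chart_dom c), (chart_fun c @` chart_dom c), (chart_fun c), (chart_inv c);
  split=> //; exact: chart_homeo.
Qed.

Lemma manifold_gauge (N : set M) : compact N -> exists d : M -> M -> R, gauge d N.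
Proof. exact: (compact_gauge (manifold_hausdorff MA) manifold_charts). Qed.

Lemma manifold_loc_compact : loc_compact M.
Proof.
move=> x V Vx; have [C [C' [k [k' [K Cx]]]]] := manifold_charts x.
have [r [W [r0 oW WCV Wx EW]]] := ball_chart K (open_interior V) Vx Cx.
have KW : part_homeo W (C' `&` k' @^-1` W) k k' by apply: (part_homeo_sub K) => // y /WCV[].
have nx : nbhs (k x) (C' `&` k' @^-1` W).
  by apply: open_nbhs_nbhs; split; [exact: (ph_open' KW)|exact: (ph_image KW)].
have [D [cD DW Dx]] := euclidean_loc_compact nx.
exists (k' @` D); split.
- by apply: image_compact => // y /DW; exact: (ph_cont' KW).
- by move=> _ [y /DW/(ph_image' KW)/WCV[_ /interior_subset Vy] <-].
- have nW : nbhs x W by apply: open_nbhs_nbhs.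
  apply: filterS (filterI nW (ph_cont KW Wx Dx)) => y [Wy Dy]; exists (k y) => //.
  exact: (ph_K KW).
Qed.

Lemma manifold_convex_chart (G O : set M) x : open O -> O `<=` G -> O x ->
  exists C (k : M -> E), [/\ convex_chart (G := G) C k, C x & C `<=` O].
Proof.
move=> oO OG Ox; have [C [C' [k [k' [K Cx]]]]] := manifold_charts x.
have [r [W [r0 oW WCO Wx EW]]] := ball_chart K oO Ox Cx.
exists W, k; split=> //; last by move=> y /WCO[].
exists (C' `&` k' @^-1` W), k'; split.
- by apply: (part_homeo_sub K) => // y /WCO[].
- by move=> y /WCO[_ /OG].
- by rewrite EW; exact: convex_ball.
Qed.
End Manifold.

(** * Alexander-Spanier and Cech cohomology *)

Section AlexanderSpanier.
Context {R : realType} {X : topologicalType} (d : X -> X -> R).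

Definition as_cocycle k (f : seq X -> 'F_2) :=
  hom k.+1 f /\ germ d setT (fun s => coboundary f s = 0).

Definition as_coh k (f g : seq X -> 'F_2) :=
  exists2 e, hom k e & germ d setT (fun s => f s = g s + coboundary e s).

Lemma as_coh_trans k f g h : as_coh k f g -> as_coh k g h -> as_coh k f h.
Proof.
move=> [e he fg] [e' he' gh]; exists (fun s => e s + e' s); first exact: homD.
by apply: germS (germI fg gh) => s _ [-> ->]; rewrite coboundaryD addrAC addrA.
Qed.

(** Cech cochains are unconstrained on tuples of other sizes, whereas [hom] asks for zero there. *)
Definition trunc k (f : seq X -> 'F_2) s := if (size s == k) && (0 < k)%N then f s else 0.

Lemma hom_trunc k (f : seq X -> 'F_2) : hom k (trunc k f).
Proof. by move=> s /negbTE sk; rewrite /trunc sk. Qed.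

Lemma trunc_coboundary k f s : (k = 0%N -> f [::] = 0) -> size s = k.+1 ->
  coboundary (trunc k f) s = coboundary f s.
Proof.
move=> f0 sk; apply: coboundary_eq_faces => i lt_is; rewrite /trunc size_face// sk eqxx /=.
case: posnP => // k0; move: (size_face lt_is); rewrite sk k0 => /size0nil ->.
by rewrite f0.
Qed.

Lemma as_coh_trunc k f g e : hom k.+1 f -> hom k.+1 g -> e [::] = 0 ->
  germ d setT (fun s => size s = k.+1 -> f s = g s + coboundary e s) -> as_coh k f g.
Proof.
move=> hf hg e0 fg; exists (trunc k e); first exact: hom_trunc.
apply: germS fg => s _ fg; have [sk|sk] := eqVneq (size s) k.+1.
  by rewrite trunc_coboundary// fg.
by rewrite hf ?hg ?(hom_coboundary (hom_trunc e)) ?addr0 ?andbT.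
Qed.

(* What is used of a compact metric space; [lebesgue] is the existence of
   Lebesgue numbers. *)
Record metric_like : Prop := MetricLike {
  ml_xx : forall x, d x x = 0;
  ml_sym : forall x y, d x y = d y x;
  ml_tri : forall x y z, d x z <= d x y + d y z;
  ml_open : forall x r, open [set y | d x y < r];
  ml_lebesgue : forall S : open_cover X, exists2 r, 0 < r &
    forall x, exists2 U, cover_sets S U & forall y, d x y < r -> U y }.

Definition fine_choice (S : set (set X)) r (u : X -> set X) :=
  forall x, S (u x) /\ forall y, d x y < r -> u x y.

(** A choice [u] of a member of the cover around each point turns a Cech cochain into a cochain on
    tuples of points. The correction by [e] is there for [represents_surj], where the cochain on
    points is given first. *)
Definition represents k (a : cocycle X k) (f : seq X -> 'F_2) :=
  exists r u e, [/\ 0 < r, fine_choice (cocycle_cover a) r u, e [::] = 0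
    & germ d setT (fun s => size s = k.+1 -> f s = a (map u s) + coboundary e s)].

Hypothesis mX : metric_like.

Lemma fine_choice_simplex S r u k s : fine_choice S r u -> small d r s -> size s = k.+1 ->
  simplex S k (map u s).
Proof.
move=> uS ss sk; split; first by rewrite size_map.
  by move=> U /mapP[x _ ->]; have [] := uS x.
case: s ss sk => // x s ss _; exists x => U /mapP[y ys ->].
by have [_] := uS y; apply; apply: ss => //; exact: mem_head.
Qed.

Lemma fine_choice_exists (S : open_cover X) : exists r u, 0 < r /\ fine_choice S r u.
Proof.
have [r r0 hr] := ml_lebesgue mX S; exists r.
have /choice[u hu] : forall x, exists U, cover_sets S U /\ forall y, d x y < r -> U y.
  by move=> x; have [U] := hr x; exists U.
by exists u.
Qed.

Lemma represents_exists k (a : cocycle X k) : exists2 f, as_cocycle k f & represents a f.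
Proof.
have [r [u [r0 hu]]] := fine_choice_exists (cocycle_cover a).
exists (trunc k.+1 (fun s => a (map u s))).
  split; first exact: hom_trunc.
  exists r => // s _ ss; have [sk|sk] := eqVneq (size s) k.+2; last first.
    by rewrite (hom_coboundary (hom_trunc _)) ?andbT.
  rewrite trunc_coboundary// (coboundary_map a) (cocycleP (c := a))//.
  exact: (fine_choice_simplex hu ss sk).
exists r, u, (fun=> 0); split=> //; apply: germW => s sk.
by rewrite /trunc sk eqxx /= coboundary0 addr0.
Qed.

Definition ball_cover_sets r : set (set X) := [set V | exists x, V = [set y | d x y < r]].

Lemma ball_cover_open r V : ball_cover_sets r V -> open V.
Proof. by move=> [x ->]; exact: (ml_open mX). Qed.

Lemma ball_cover_covers r : 0 < r -> forall x, exists2 V, ball_cover_sets r V & V x.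
Proof. by move=> r0 x; exists [set y | d x y < r]; [exists x|rewrite /= (ml_xx mX)]. Qed.

Definition ball_cover r (r0 : 0 < r) : open_cover X :=
  OpenCover (@ball_cover_open r) (ball_cover_covers r0).

(** A ball may have several centres; one is chosen, so the centre of the ball around [x] is only
    close to [x]. *)
Definition center (x0 : X) r (V : set X) : X := xget x0 [set x | V = [set y | d x y < r]].

Lemma centerP x0 r V : ball_cover_sets r V -> V = [set y | d (center x0 r V) y < r].
Proof.
by move=> [x Vx]; rewrite /center; case: xgetP => [y _ //|/(_ x)]; case.
Qed.

Lemma center_small x0 r k s : simplex (ball_cover_sets r) k s ->
  small d (r + r) (map (center x0 r) s).
Proof.
move=> [_ sS [z sz]] _ _ /mapP[U Us ->] /mapP[V Vs ->].
have Uz := sz U Us; have Vz := sz V Vs.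
rewrite (centerP x0 (sS U Us)) /= in Uz; rewrite (centerP x0 (sS V Vs)) /= in Vz.
by apply: le_lt_trans (ml_tri mX _ z _) _; rewrite (ml_sym mX z) ltrD.
Qed.

Lemma represents_surj (x0 : X) k f : as_cocycle k f -> exists a : cocycle X k, represents a f.
Proof.
(* Centres of balls with a common point are less than [2 * q] apart, and the prisms below mix points
   and centres at distances less than [3 * q]. *)
move=> [hf [r r0 fcoc]]; pose q := r / 4; have q0 : 0 < q by rewrite divr_gt0.
have cP : is_cocycle (ball_cover q0) k (fun s => f (map (center x0 q) s)).
  move=> s sS; rewrite coboundary_map; apply: fcoc => //.
  have := @center_small x0 q k.+1 s sS; apply: small_le; rewrite /q; lra.
exists (Cocycle cP); pose u x := [set y | d x y < q]; pose c := center x0 q \o u.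
have dc x : d x (c x) < q.
  have : u x x by rewrite /u /= (ml_xx mX).
  by rewrite {1}(@centerP x0 q (u x)) /=; [rewrite (ml_sym mX)|exists x].
exists q, u, (prism id c f); split=> //; first by move=> x; split=> //; exists x.
exists q => // s _ ss sk; rewrite /= -map_comp -/c.
have := prism_homotopy id c f s; rewrite map_id oppF2.
have -> : prism id c (coboundary f) s = 0.
  apply/eqP; apply: contraT => /prism_neq0[t [ft _ ts _]].
  rewrite fcoc ?eqxx// in ft => _ _ /ts[x xs [->|->]] /ts[y ys [->|->]].
  - by apply: lt_le_trans (ss _ _ xs ys) _; rewrite /q; lra.
  - apply: le_lt_trans (ml_tri mX x y _) _; have := ss _ _ xs ys; have := dc y; rewrite /q; lra.
  - apply: le_lt_trans (ml_tri mX _ x _) _; have := ss _ _ xs ys; have := dc x.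
    by rewrite (ml_sym mX x) /q; lra.
  - apply: le_lt_trans (ml_tri mX _ x _) _; apply: le_lt_trans (lerD (lexx _) (ml_tri mX x y _)) _.
    by have := ss _ _ xs ys; have := dc x; have := dc y; rewrite (ml_sym mX x (c x)) /q; lra.
rewrite addr0 => ->; rewrite addrA addF2 add0r//.
Qed.

Lemma represents0 k : represents (cocycle0 (G := 'F_2) X k) (fun=> 0).
Proof.
exists 1, (fun=> setT), (fun=> 0); split=> //.
by apply: germW => s _; rewrite coboundary0 addr0.
Qed.
End AlexanderSpanier.

Section CechComparison.
Context {R : realType} {X Y : topologicalType} {dX : X -> X -> R} {dY : Y -> Y -> R}.
Context (mX : metric_like dX) (j : X -> Y).
Context (jd : forall x y, dY (j x) (j y) = dX x y) (x0 : X).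

Lemma small_map r s : small dX r s -> small dY r (map j s).
Proof. by move=> ss _ _ /mapP[x xs ->] /mapP[y ys ->]; rewrite jd; apply: ss. Qed.

Lemma cech_rel_as_coh k (a : cocycle Y k) (b : cocycle X k) f g :
  hom k.+1 f -> hom k.+1 g -> represents dY a f -> represents dX b g -> cech_rel j a b ->
  as_coh dX k (fun s => f (map j s)) g.
Proof.
move=> hf hg [r [u [e [r0 hu e0 fe]]]] [r' [u' [e' [r'0 hu' e'0 ge']]]].
move=> [S [p [q [pj qid [e2 e20 e2P]]]]].
have [w [v [w0 hv]]] := fine_choice_exists mX S.
(* The terms account, in order, for the representative [f], the passage from [u \o j] to [p \o v],
   the relation between [a] and [b], the passage from [q \o v] to [u'], and the representative
   [g]. *)
pose E s := e (map j s) + (prism (u \o j) (p \o v) a s + (e2 (map v s) + (prism (q \o v) u' b s + e' s))).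
apply: (@as_coh_trunc _ _ _ k _ _ E) => //.
- by move=> s sk; apply: hf; rewrite size_map.
- by rewrite /E /= e0 e20 e'0 !addr0.
have [rf rf0 hfe] := fe; have [rg rg0 hge] := ge'.
pose m := Num.min (Num.min r r') (Num.min w (Num.min rf rg)).
have m0 : 0 < m by rewrite !lt_min r0 r'0 w0 rf0.
have [mr mr' mw mrf mrg] : [/\ m <= r, m <= r', m <= w, m <= rf & m <= rg].
  by rewrite !ge_min !lexx !orbT.
exists m => // s _ ss sk.
have near_head x : x \in s -> dX x (head x0 s) < m.
  by move=> xs; apply: ss => //; case: s xs {sk} => // y s _; exact: mem_head.
have V1 : prism (u \o j) (p \o v) (coboundary a) s = 0.
  apply/eqP; apply: contraT => /prism_neq0[t [ft st ts _]].
  rewrite (cocycleP (c := a)) ?eqxx// in ft; split; first by rewrite st sk.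
    move=> U /ts[x xs [->|->]]; first by have [] := hu (j x).
    by have [Sv _] := hv x; have [] := pj _ Sv.
  exists (j (head x0 s)) => U /ts[x xs [->|->]].
    have [_] := hu (j x); apply; rewrite jd; exact: lt_le_trans (near_head x xs) mr.
  have [Sv hvx] := hv x; have [_ sub] := pj _ Sv; apply: sub; apply: hvx.
  exact: lt_le_trans (near_head x xs) mw.
have V2 : prism (q \o v) u' (coboundary b) s = 0.
  apply/eqP; apply: contraT => /prism_neq0[t [ft st ts _]].
  rewrite (cocycleP (c := b)) ?eqxx// in ft; split; first by rewrite st sk.
    move=> U /ts[x xs [->|->]]; last by have [] := hu' x.
    by have [Sv _] := hv x; have [] := qid _ Sv.
  exists (head x0 s) => U /ts[x xs [->|->]]; last first.
    have [_] := hu' x; apply; exact: lt_le_trans (near_head x xs) mr'.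
  have [Sv hvx] := hv x; have [_ sub] := qid _ Sv; apply: (sub); apply: hvx.
  exact: lt_le_trans (near_head x xs) mw.
have P1 := prism_homotopy (u \o j) (p \o v) a s; rewrite V1 addr0 oppF2 in P1.
have P2 := prism_homotopy (q \o v) u' b s; rewrite V2 addr0 oppF2 in P2.
have P3 := e2P (map v s) (fine_choice_simplex hv (small_le mw ss) sk).
rewrite hfe ?size_map//; last exact/small_map/(small_le mrf).
rewrite hge//; last exact: small_le ss.
rewrite /E !coboundaryD (coboundary_map e) (coboundary_map e2) P1 P2 -P3 oppF2 -!map_comp.
set a1 := a _; set a2 := a _; set b1 := b _; set b2 := b _.
set d1 := coboundary e _; set d2 := coboundary e' s.
by f2case a1; f2case a2; f2case b1; f2case b2; f2case d1; f2case d2; f2done.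
Qed.

Lemma as_coh_cech_rel k (a : cocycle Y k) (b : cocycle X k) f g :
  represents dY a f -> represents dX b g ->
  as_coh dX k (fun s => f (map j s)) g -> cech_rel j a b.
Proof.
move=> [r [u [e [r0 hu e0 [rf rf0 fe]]]]] [r' [u' [e' [r'0 hu' e'0 [rg rg0 ge]]]]] [e2 he2 [r2 r20 fg]].
pose m := Num.min (Num.min r r') (Num.min r2 (Num.min rf rg)).
have m0 : 0 < m / 2 by rewrite divr_gt0// !lt_min r0 r'0 r20 rf0.
have [mr mr' m2 mrf mrg] : [/\ m <= r, m <= r', m <= r2, m <= rf & m <= rg].
  by rewrite !ge_min !lexx !orbT.
have m2m : m / 2 <= m by move: m0; lra.
pose c := center dX x0 (m / 2).
exists (ball_cover mX m0), (u \o j \o c), (u' \o c).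
have cV V : ball_cover_sets dX (m / 2) V -> forall z, V z -> dX (c V) z < m / 2.
  by move=> SV z; rewrite {1}(centerP x0 SV).
split.
- move=> V SV; split; first by have [] := hu (j (c V)).
  move=> z /(cV V SV) cz; have [_ h] := hu (j (c V)); apply: h.
  by rewrite jd; apply: lt_le_trans cz (le_trans m2m mr).
- move=> V SV; split; first by have [] := hu' (c V).
  move=> z /(cV V SV) cz; have [_ h] := hu' (c V); apply: h.
  exact: lt_le_trans cz (le_trans m2m mr').
exists (fun s => e (map j (map c s)) + (e2 (map c s) + e' (map c s))).
  by rewrite /= e0 (hom_nil he2) e'0 !addr0.
move=> s sS; have ss : small dX m (map c s).
  by have := @center_small _ _ _ mX x0 (m / 2) k s sS; apply: small_le; lra.
have sk : size (map c s) = k.+1 by rewrite size_map; case: sS.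
have F := fe _ (fun _ _ => I) (small_map (small_le mrf ss)); rewrite !size_map in F.
have Gg := ge _ (fun _ _ => I) (small_le mrg ss).
have FG := fg _ (fun _ _ => I) (small_le m2 ss).
rewrite F ?Gg// in FG; last by move: sk; rewrite size_map.
rewrite !coboundaryD (coboundary_map e2) (coboundary_map e') oppF2.
rewrite (coboundary_map (fun t => e (map j t))) (coboundary_map e).
rewrite (_ : a (map (u \o j \o c) s) = a (map u (map j (map c s)))); last by rewrite -!map_comp.
rewrite (_ : b (map (u' \o c) s) = b (map u' (map c s))); last by rewrite -map_comp.
move: FG; set a1 := a _; set b1 := b _; set d1 := coboundary e _; set d2 := coboundary e2 _.
set d3 := coboundary e' _ => FG.
have -> : a1 = b1 + d3 + d2 + d1 by rewrite -FG -addrA addF2 addr0.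
by f2case b1; f2case d1; f2case d2; f2case d3; f2done.
Qed.
End CechComparison.

(** * Cohomology of compact subsets through cochains on the whole space *)

Section SetCohomology.
Context {R : realType} {M : topologicalType} (d : M -> M -> R) {G : set M} (dG : gauge d G).
Implicit Types (A : set M).

Definition cocycle_on A k (f : seq M -> 'F_2) :=
  hom k.+1 f /\ germ d A (fun s => coboundary f s = 0).

Definition cohomologous A k (f g : seq M -> 'F_2) :=
  exists2 e, hom k e & germ d A (fun s => f s = g s + coboundary e s).

Definition dsub A (x y : A) : R := d (set_val x) (set_val y).

Lemma germ_sub_type A (P : seq M -> Prop) :
  germ d A P <-> germ (@dsub A) setT (fun t => P (map set_val t)).
Proof.
split=> -[r r0 hr]; exists r => // s.
  move=> _ ss; apply: hr.
    by move=> _ /mapP[x _ ->]; exact: set_valP.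
  by move=> _ _ /mapP[x xs ->] /mapP[y ys ->]; apply: ss.
move=> sA ss; have [t tE] : exists t : seq A, map set_val t = s.
  elim: s sA {ss} => [|x s IH] sA; first by exists [::].
  have [|t tE] := IH; first by move=> y ys; apply: sA; rewrite inE ys orbT.
  by exists (exist _ x (mem_set (sA x (mem_head _ _))) :: t); rewrite /= tE.
rewrite -tE; apply: hr => // x y xt yt; apply: ss; rewrite -tE; exact: map_f.
Qed.

Lemma sub_metric_like A : compact A -> A `<=` G -> metric_like (@dsub A).
Proof.
move=> cA AG; split.
- by move=> x; exact: (gauge_xx dG).
- by move=> x y; exact: (gauge_sym dG).
- by move=> x y z; exact: (gauge_tri dG).
- move=> x r; exists (near_set d r [set set_val x]); first exact: (near_set_open dG).
  by apply/seteqP; split=> y /=; [move=> [_ -> ]|move=> xy; exists (set_val x)].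
move=> S; pose Q (B : set M) := exists2 r : R, 0 < r & forall x : A, B (set_val x) ->
  exists2 U, cover_sets S U & forall y, dsub x y < r -> U y.
have [r r0 hr] : Q A.
  apply: (compact_ind (Q := Q)) cA; rewrite /Q.
  - by exists 1.
  - by move=> B B' BB [r r0 hr]; exists r => // x /BB; exact: hr.
  - move=> B B' [r r0 hr] [q q0 hq]; exists (Num.min r q); first by rewrite lt_min r0.
    move=> x [/hr|/hq] [U SU hU]; exists U => // y; rewrite lt_min => /andP[h1 h2]; exact: hU.
  move=> x0 Ax0; pose x : A := exist _ x0 (mem_set Ax0).
  have [U SU Ux] := cover_covers S x.
  have [V oV VU] := cover_open SU.
  have Vx : nbhs x0 V by apply: open_nbhs_nbhs; split=> //; move: Ux; rewrite -VU.
  have [r r0 hr] := gauge_nbhs dG (AG x0 Ax0) Vx.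
  have r2 : 0 < r / 2 by rewrite divr_gt0.
  exists [set y | d x0 y < r / 2]; first exact: (gauge_ball dG x0 r2).
  exists (r / 2) => // y /= xy; exists U => // z yz; rewrite -VU; apply: hr.
  by apply: le_lt_trans (gauge_tri dG _ (set_val y) _) _; rewrite [r]splitr ltrD.
by exists r => // x; apply: hr; exact: set_valP.
Qed.

Definition extend A (g : seq A -> 'F_2) (s : seq M) : 'F_2 :=
  if pselect (exists t : seq A, map set_val t = s) is left H then g (projT1 (cid H)) else 0.

Lemma extendE A (g : seq A -> 'F_2) t : extend g (map set_val t) = g t.
Proof.
rewrite /extend; case: pselect => [H|]; last by case; exists t.
congr g; case: cid => t' /= tt'; apply: inj_map tt'; exact: val_inj.
Qed.

Lemma hom_extend A k (g : seq A -> 'F_2) : hom k g -> hom k (extend g).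
Proof.
move=> hg s sk; rewrite /extend; case: pselect => // H; apply: hg.
by case: cid => t /= tE; rewrite -(size_map set_val) tE.
Qed.

Lemma cocycle_on_type A k f : cocycle_on A k f ->
  as_cocycle (@dsub A) k (fun t => f (map set_val t)).
Proof.
move=> [hf df]; split; first by move=> t tk; apply: hf; rewrite size_map.
by have /germ_sub_type := df; apply: germS => t _; rewrite coboundary_map.
Qed.

Lemma cohomologous_type A k f g : cohomologous A k f g <->
  as_coh (@dsub A) k (fun t => f (map set_val t)) (fun t => g (map set_val t)).
Proof.
split=> -[e he fg].
  exists (fun t => e (map set_val t)); first by move=> t tk; apply: he; rewrite size_map.
  by have /germ_sub_type := fg; apply: germS => t _; rewrite coboundary_map.
exists (extend e); first exact: hom_extend.
apply/germ_sub_type; apply: germS fg => t _ ->; congr (_ + _).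
by rewrite -coboundary_map; apply: eq_coboundary => r; rewrite extendE.
Qed.

Lemma cocycle_on_extend A k (g : seq A -> 'F_2) : as_cocycle (@dsub A) k g ->
  cocycle_on A k (extend g).
Proof.
move=> [hg dg]; split; first exact: hom_extend.
apply/germ_sub_type; apply: germS dg => t _ <-.
by rewrite -coboundary_map; apply: eq_coboundary => r; rewrite extendE.
Qed.

Section Inclusion.
Context {K N : set M} (KN : K `<=` N) (cK : compact K) (cN : compact N) (NG : N `<=` G).
Let mK : metric_like (@dsub K).
Proof. by apply: sub_metric_like => //; exact: (subset_trans KN NG). Qed.
Let mN : metric_like (@dsub N). Proof. exact: sub_metric_like. Qed.
Let jd (x y : K) : dsub (inclusion KN x) (inclusion KN y) = dsub x y. Proof. by []. Qed.
Let map_incl (t : seq K) : map set_val (map (inclusion KN) t) = map set_val t.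
Proof. by rewrite -map_comp. Qed.

Lemma cech_map_eq0 k (x0 : K) (a : cocycle (G := 'F_2) N k) f : cocycle_on N k f ->
  represents (@dsub N) a (fun t => f (map set_val t)) ->
  cech_map 'F_2 (inclusion KN) k (cech_class a) = 0 <-> cohomologous K k f (fun=> 0).
Proof.
move=> [hf df] af.
have hfN (A : set M) : hom k.+1 (fun t : seq A => f (map set_val t)).
  by move=> t tk; apply: hf; rewrite size_map.
have z0 : (0 : cech_cohomology 'F_2 K k) = cech_class (cocycle0 K k) by [].
split.
  rewrite (cech_mapE (cech_rel_pullback _ a)) z0 => /cech_classP.
  set b := cocycle_pullback _ _ => rel.
  have [g [hg _] bg] := represents_exists mK b.
  have c1 := cech_rel_as_coh mK jd x0 (hfN N) hg af bg (cech_rel_pullback _ a).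
  have c2 := cech_rel_as_coh mK (j := id) (fun _ _ => erefl) x0 hg (@hom_zero _ k.+1) bg (represents0 _ _) rel.
  apply/cohomologous_type.
  have gE : (fun s => g (map id s)) = g by apply/funext => s; rewrite map_id.
  rewrite gE in c2; have := as_coh_trans c1 c2.
  by under eq_fun do rewrite map_incl.
move=> /cohomologous_type c0; rewrite z0; apply: cech_mapE.
apply: (as_coh_cech_rel mK jd x0 af (represents0 _ _)).
by under eq_fun do rewrite map_incl.
Qed.

Lemma cech_class_eq0 k (x0 : N) (a : cocycle (G := 'F_2) N k) f : cocycle_on N k f ->
  represents (@dsub N) a (fun t => f (map set_val t)) ->
  cech_class a = 0 <-> cohomologous N k f (fun=> 0).
Proof.
move=> [hf df] af.
have hfN : hom k.+1 (fun t : seq N => f (map set_val t)).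
  by move=> t tk; apply: hf; rewrite size_map.
have z0 : (0 : cech_cohomology 'F_2 N k) = cech_class (cocycle0 N k) by [].
have idE (g : seq N -> 'F_2) : (fun s => g (map id s)) = g.
  by apply/funext => s; rewrite map_id.
rewrite z0; split.
  move=> /cech_classP rel.
  have := cech_rel_as_coh mN (j := id) (fun _ _ => erefl) x0 hfN (@hom_zero _ k.+1) af (represents0 _ _) rel.
  by rewrite (idE (fun t => f (map set_val t))) => c; apply/cohomologous_type.
move=> /cohomologous_type c0; apply/cech_classP.
apply: (as_coh_cech_rel mN (j := id) (fun _ _ => erefl) x0 af (represents0 _ _)).
by rewrite (idE (fun t => f (map set_val t))).
Qed.

Lemma represents_cocycle_on k (A : set M) (mA : metric_like (@dsub A)) (a : cocycle A k) :
  exists2 f, cocycle_on A k f & represents (@dsub A) a (fun t => f (map set_val t)).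
Proof.
have [g cg ag] := represents_exists mA a.
exists (extend g); first exact: cocycle_on_extend.
by rewrite (_ : (fun t => _) = g)//; apply/funext => t; rewrite extendE.
Qed.

Theorem inclusion_iso_of_cocycles : K !=set0 ->
  (forall k g, cocycle_on K k g -> exists2 f, cocycle_on N k f & cohomologous K k f g) ->
  (forall k f, cocycle_on N k f -> cohomologous K k f (fun=> 0) -> cohomologous N k f (fun=> 0)) ->
  inclusion_cech_iso KN 'F_2.
Proof.
move=> [x Kx] surj inj k.
pose x0 : K := exist _ x (mem_set Kx).
have kerP (z : cech_cohomology 'F_2 N k) : cech_map 'F_2 (inclusion KN) k z = 0 -> z = 0.
  rewrite -[z]cech_repr => z0; set a := repr z in z0 *.
  have [f cf af] := represents_cocycle_on mN a.
  apply/(cech_class_eq0 (inclusion KN x0) cf af)/inj => //.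
  exact/(cech_map_eq0 x0 cf af).
have injP : injective (cech_map 'F_2 (inclusion KN) k).
  move=> y z yz; apply/eqP; rewrite -subr_eq0; apply/eqP/kerP.
  by rewrite raddfB /= yz subrr.
have surjP (y : cech_cohomology 'F_2 K k) : exists z, cech_map 'F_2 (inclusion KN) k z = y.
  have [g cg bg] := represents_cocycle_on mK (repr y).
  have [f cf /cohomologous_type fg] := surj k g cg.
  have [a af] := represents_surj mN (inclusion KN x0) (cocycle_on_type cf).
  exists (cech_class a); rewrite -[y]cech_repr; apply: cech_mapE.
  apply: (as_coh_cech_rel mK jd x0 af bg).
  by under eq_fun do rewrite map_incl.
have /choice[h hK] := surjP.
by exists h => // z; apply: injP; rewrite hK.
Qed.

Theorem cocycles_of_inclusion_iso : K !=set0 -> inclusion_cech_iso KN 'F_2 ->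
  forall k f, cocycle_on N k f -> cohomologous K k f (fun=> 0) -> cohomologous N k f (fun=> 0).
Proof.
move=> [x Kx] iso k f cf f0.
pose x0 : K := exist _ x (mem_set Kx).
have [a af] := represents_surj mN (inclusion KN x0) (cocycle_on_type cf).
apply/(cech_class_eq0 (inclusion KN x0) cf af); have [g gK _] := iso k.
apply: (can_inj gK); rewrite raddf0; exact/(cech_map_eq0 x0 cf af).
Qed.
End Inclusion.
End SetCohomology.

Lemma tube {R : realType} {T M : topologicalType} (F : T * R -> M) (O : set M) (x : T) (a b : R) :
  continuous F -> open O -> (forall t, a <= t <= b -> O (F (x, t))) ->
  nbhs x [set y | forall t, a <= t <= b -> O (F (y, t))].
Proof.
move=> cF oO hx; have /compact_near_coveringP cab := @segment_compact R a b.
have := cab T (nbhs x) (fun y t => O (F (y, t))) _.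
have -> : [set y | forall t, a <= t <= b -> O (F (y, t))] =
    [set y | `[a, b] `<=` (fun t => O (F (y, t)))].
  by apply/seteqP; split=> y h t /=; have := h t; rewrite /= in_itv.
apply=> t; rewrite /= in_itv /= => /hx Oxt.
have [[U V] /= [Ux Vt] UV] := cF (x, t) O (open_nbhs_nbhs (conj oO Oxt)).
by exists (V, U) => // -[t' y] [/= Vt' Uy]; exact: (UV (y, t')).
Qed.

(** * Flows *)

Section Flow.
Context {R : realType} {M : topologicalType}.
Implicit Types (phi : M -> R -> M) (K N U V O : set M).

Definition reverse phi x t := phi x (- t).

Lemma reverse_flow phi : is_flow phi -> is_flow (reverse phi).
Proof.
move=> [c0 p0 pD]; split.
- move=> [x t]; have h : {for (x, - t), continuous (fun p : M * R => phi p.1 p.2)} by exact: c0.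
  apply: (@cvg_comp _ _ _ (fun p : M * R => (p.1, - p.2)) (fun p => phi p.1 p.2) _ (nbhs (x, - t))) => //.
  apply: (@cvg_pair _ _ _ _ (nbhs x) (nbhs (- t)) _ _ _ fst (fun p => - p.2)); first exact: cvg_fst.
  by apply: (@cvg_comp _ _ _ snd -%R _ (nbhs t)); [exact: cvg_snd|exact: opp_continuous].
- by move=> x; rewrite /reverse oppr0.
- by move=> x s t; rewrite /reverse opprD.
Qed.

Lemma reverseK phi : reverse (reverse phi) = phi.
Proof. by apply/funext => x; apply/funext => t; rewrite /reverse opprK. Qed.

Lemma flow_invariant_reverse phi K : flow_invariant phi K -> flow_invariant (reverse phi) K.
Proof. by move=> iK x t; exact: iK. Qed.

Lemma isolates_reverse phi N K : isolates phi N K -> isolates (reverse phi) N K.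
Proof.
move=> [cN KN iK mK]; split=> //; first exact: flow_invariant_reverse.
by move=> L /flow_invariant_reverse; rewrite reverseK; exact: mK.
Qed.

Lemma isolates_sub phi N K N' : isolates phi N K -> compact N' -> K `<=` N'° -> N' `<=` N ->
  isolates phi N' K.
Proof.
by move=> [cN KN iK mK] cN' KN' NN; split=> // L iL LN; apply: mK => // x /LN/NN.
Qed.

Definition stays phi N : set M := [set x | forall t, 0 <= t -> N (phi x t)].

Section OneFlow.
Context {phi : M -> R -> M} (F : is_flow phi).

Lemma flow_cont_time x : continuous (phi x).
Proof.
move=> t; apply: (@cvg_comp _ _ _ (fun t => (x, t)) (fun p : M * R => phi p.1 p.2) _ (nbhs (x, t))).
  by apply: (@cvg_pair _ _ _ (nbhs t) (nbhs x) (nbhs t) _ _ _ (fun=> x) id); [exact: cvg_cst|exact: cvg_id].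
by have /(_ (x, t)) := flow_continuous F.
Qed.

Lemma flow_cont_space t : continuous (phi^~ t).
Proof.
move=> x; apply: (@cvg_comp _ _ _ (fun x => (x, t)) (fun p : M * R => phi p.1 p.2) _ (nbhs (x, t))).
  by apply: (@cvg_pair _ _ _ (nbhs x) (nbhs x) (nbhs t) _ _ _ id (fun=> t)); [exact: cvg_id|exact: cvg_cst].
by have /(_ (x, t)) := flow_continuous F.
Qed.

Lemma flow_nbhs_time x t A : nbhs (phi x t) A -> nbhs t [set u | A (phi x u)].
Proof. exact: (@flow_cont_time x t A). Qed.

Lemma flow_nbhs_space x t A : nbhs (phi x t) A -> nbhs x [set y | A (phi y t)].
Proof. exact: (@flow_cont_space t x A). Qed.

Lemma flow_tube x a b O : open O -> (forall t, a <= t <= b -> O (phi x t)) ->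
  nbhs x [set y | forall t, a <= t <= b -> O (phi y t)].
Proof. by move=> oO h; apply: (tube (F := fun p => phi p.1 p.2)); first exact: (flow_continuous F). Qed.

Lemma stays_flow N x s : stays phi N x -> 0 <= s -> stays phi N (phi x s).
Proof. by move=> xN s0 t t0; rewrite -(flowD F); apply: xN; rewrite addr_ge0. Qed.

Lemma stays_sub N : stays phi N `<=` N.
Proof. by move=> x /(_ 0 (lexx _)); rewrite (flow0 F). Qed.

Lemma stays_closed N : closed N -> closed (stays phi N).
Proof.
move=> cN; rewrite (_ : stays phi N = \bigcap_(t in [set t | 0 <= t]) (phi^~ t @^-1` N)); last first.
  by apply/seteqP; split=> x h t; exact: h.
by apply: closed_bigI => t _; apply: closed_comp => // x _; exact: flow_cont_space.
Qed.

Lemma isolated_orbit N K x : isolates phi N K -> (forall t, N (phi x t)) -> K x.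
Proof.
move=> [_ _ _ mK] xN; apply: (mK [set phi x t | t in setT]); last by exists 0; rewrite ?(flow0 F).
- by move=> _ t [s _ <-]; exists (s + t) => //; rewrite (flowD F).
- by move=> _ [s _ <-].
Qed.

(** An orbit contained in [N] lies in [K], so every point of the compact set [N] minus [O] is
    outside [N] at some time, and so are its neighbours at the same time. *)
Lemma leave_time N K O : hausdorff_space M -> isolates phi N K -> open O -> K `<=` O ->
  exists2 T, 0 <= T & forall y, N y -> ~ O y -> exists2 t, - T <= t <= T & ~ N (phi y t).
Proof.
move=> hM iN oO KO; have cN := isolates_compact iN.
have clN : closed N by exact: compact_closed.
have cC : compact (N `&` ~` O).
  by apply: compact_closedI => //; exact: open_closedC.
pose Q (S : set M) := exists2 T, 0 <= T &
  forall y, S y -> exists2 t, - T <= t <= T & ~ N (phi y t).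
have [T T0 hT] : Q (N `&` ~` O).
  apply: (compact_ind (Q := Q)) cC; rewrite /Q.
  - by exists 0.
  - by move=> S S' SS' [T T0 hT]; exists T => // y /SS'; exact: hT.
  - move=> S S' [T T0 hT] [T' T'0 hT']; exists (Num.max T T'); first by rewrite le_max T0.
    move=> y [/hT|/hT'] [t /andP[t1 t2] nN]; exists t => //; rewrite le_max t2 ?orbT andbT lerNl le_max.
      by rewrite -lerNl t1.
    by rewrite orbC -lerNl t1.
  move=> y [Ny nOy]; have [t nN] : exists t, ~ N (phi y t).
    apply/existsNP => yN; apply: nOy; apply: KO; exact: (isolated_orbit iN yN).
  exists [set z | ~ N (phi z t)].
    apply: (flow_nbhs_space (A := ~` N)); apply: open_nbhs_nbhs; split=> //.
    exact: closed_openC.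
  by exists `|t| => // z nz; exists t => //; rewrite lerNl ler_norm -normrN ler_norm.
by exists T => // y Ny nOy; apply: hT.
Qed.

(** The window from [t - T] to [t + T] of the orbit lies in [N], so the point at time [t] cannot be
    outside [O]. *)
Lemma attract N O T : (forall y, N y -> ~ O y -> exists2 t, - T <= t <= T & ~ N (phi y t)) ->
  forall x t, stays phi N x -> 0 <= T -> T <= t -> O (phi x t).
Proof.
move=> hT x t xN T0 Tt; apply: contrapT => nO.
have [s /andP[s1 s2] nN] := hT (phi x t) (xN t (le_trans T0 Tt)) nO.
by apply: nN; rewrite -(flowD F); apply: xN; lra.
Qed.

Lemma stays_absorb N V x T : 0 <= T -> (forall t, 0 <= t <= T -> N (phi x t)) ->
  V (phi x T) -> V `<=` stays phi N `|` stays (reverse phi) N ->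
  (stays phi N `|` stays (reverse phi) N) x.
Proof.
move=> T0 xN Vx VN; case: (VN _ Vx) => h; [left|right] => t t0.
  have [tT|Tt] := leP t T; first by apply: xN; rewrite t0.
  have := h (t - T); rewrite -(flowD F) addrCA subrr addr0; apply; by rewrite subr_ge0 ltW.
have := h (t + T); rewrite /reverse -(flowD F) opprD addrCA subrr addr0; apply; exact: addr_ge0.
Qed.
End OneFlow.

Lemma stays_both phi N K : is_flow phi -> isolates phi N K ->
  stays phi N `&` stays (reverse phi) N `<=` K.
Proof.
move=> F iN x [xp xm]; apply: (isolated_orbit F iN) => t.
have [t0|/ltW t0] := leP 0 t; first exact: xp.
by have := xm (- t); rewrite /reverse opprK oppr_ge0; exact.
Qed.

Lemma sub_stays phi N K : isolates phi N K -> K `<=` stays phi N.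
Proof.
by move=> [_ KN iK _] x Kx t _; apply: interior_subset; apply: KN; exact: iK.
Qed.

(** The saddle condition is tested on [U = N]; by [stays_non_saddle] this single test decides. *)
Lemma non_saddle_stays phi N K : isolates phi N K -> non_saddle phi K ->
  exists2 V, K `<=` V° & V `<=` stays phi N `|` stays (reverse phi) N.
Proof.
move=> iN ns; apply: contrapT => nV; apply: ns; exists N; split; first exact: (isolates_nbhd iN).
move=> V KV; apply: contrapT => nx; apply: nV; exists V => // x Vx.
apply: contrapT => nst; apply: nx; exists x; split=> // h; apply: nst; [left|right] => t t0.
  exact: h.
by apply: h; rewrite oppr_le0.
Qed.

(** For a given [U] the neighbourhood [V] is shrunk: for a bounded time orbits follow [K], and
    afterwards [attract] keeps those that stay in [N] inside [U]. *)
Lemma stays_non_saddle phi N K V : hausdorff_space M -> is_flow phi -> isolates phi N K ->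
  K `<=` V° -> V `<=` stays phi N `|` stays (reverse phi) N -> non_saddle phi K.
Proof.
move=> hM F iN KV VN [U [KU hU]].
have KO : K `<=` U° by [].
have [T T0 hT] := leave_time F hM iN (open_interior U) KU.
have [T' T'0 hT'] := leave_time (reverse_flow F) hM (isolates_reverse iN) (open_interior U) KU.
pose T2 := Num.max T T'.
have [x [[Vx xO] nf nb]] : exists x, [/\ (V `&` [set y | forall t, - T2 <= t <= T2 -> U° (phi y t)]) x,
    ~ (forall t, 0 <= t -> U (phi x t)) & ~ (forall t, t <= 0 -> U (phi x t))].
  apply: hU => x Kx; apply: filterI; first exact: KV.
  apply: flow_tube => //; first exact: open_interior.
  by move=> t _; apply: KU; exact: (isolates_invariant iN).
have TT : T <= T2 by rewrite le_max lexx.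
have TT' : T' <= T2 by rewrite le_max lexx orbT.
case: (VN x Vx) => xN.
  apply: nf => t t0; apply: interior_subset; have [tT|/ltW Tt] := leP t T2.
    by apply: xO; rewrite tT andbT; lra.
  by apply: (attract F (T := T) hT) => //; exact: le_trans TT Tt.
apply: nb => t t0; apply: interior_subset; have [tT|/ltW Tt] := leP (- t) T2.
  by apply: xO; rewrite lerNl tT /=; lra.
have := attract (reverse_flow F) (T := T') hT' xN T'0 (le_trans TT' Tt).
by rewrite /reverse opprK.
Qed.

(** [s] is the supremum of the times up to which the orbit remains in [N]. The orbit may touch the
    frontier earlier; what matters is that it is outside [N] at times arbitrarily soon after [s]. *)
Lemma first_exit phi N y t : is_flow phi -> closed N -> N y -> 0 <= t -> ~ N (phi y t) ->
  exists s, [/\ 0 <= s <= t, forall u, 0 <= u <= s -> N (phi y u), ~ N° (phi y s)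
    & forall e, 0 < e -> exists2 u, s < u <= s + e & ~ N (phi y u)].
Proof.
move=> F clN Ny t0 nN.
pose E := [set s | 0 <= s <= t /\ forall u, 0 <= u <= s -> N (phi y u)].
have E0 : E 0.
  by split; [rewrite lexx t0|move=> u u0; rewrite (_ : u = 0) ?(flow0 F)//; apply/eqP; rewrite eq_le andbC].
have ubE : has_ubound E by exists t => s [/andP[]].
have hE : has_sup E by split=> //; exists 0.
pose s := sup E; have s0 : 0 <= s by exact: ub_le_sup.
have st : s <= t by apply: ge_sup; [exists 0|move=> x [/andP[]]].
have ltN u : 0 <= u -> u < s -> N (phi y u).
  move=> u0 us; have us0 : 0 < s - u by rewrite subr_gt0.
  have [v [_ vN] sv] := sup_adherent us0 hE.
  by apply: vN; rewrite u0 /=; apply/ltW; move: sv; rewrite subKr.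
have sN : N (phi y s).
  have [->|sn0] := eqVneq s 0; first by rewrite (flow0 F).
  have s_gt0 : 0 < s by rewrite lt_def sn0.
  apply: contrapT => nNs.
  have : nbhs s [set u | ~ N (phi y u)].
    by apply: (flow_nbhs_time F (A := ~` N)); apply: open_nbhs_nbhs; split=> //; exact: closed_openC.
  move=> /nbhs_ballP[e /= e0 he]; pose u := Num.max 0 (s - e / 2).
  have us : u < s by rewrite gt_max s_gt0 /=; lra.
  apply: (he u); last by apply: ltN => //; rewrite le_max lexx.
  rewrite /ball /= gtr0_norm ?subr_gt0//.
  have : s - e / 2 <= u by rewrite le_max lexx orbT.
  by lra.
have leN u : 0 <= u <= s -> N (phi y u).
  by move=> /andP[u0]; rewrite le_eqVlt => /predU1P[->//|]; exact: ltN.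
have nxt e : 0 < e -> exists2 u, s < u <= s + e & ~ N (phi y u).
  move=> e0; apply: contrapT => nu.
  have sNt : s < t by rewrite lt_def st andbT; apply: contra_notN nN => /eqP->.
  pose v := Num.min (s + e) t.
  have sv : s < v by rewrite lt_min ltrDl e0.
  have : E v.
    split; first by rewrite ge_min lexx orbT andbT; apply: ltW; exact: le_lt_trans sv.
    move=> u /andP[u0 uv]; have [us|su] := leP u s; first by apply: leN; rewrite u0.
    apply: contrapT => nNu; apply: nu; exists u => //; rewrite su /=.
    by apply: le_trans uv _; rewrite ge_min lexx.
  by move=> /(ub_le_sup ubE); rewrite leNgt sv.
exists s; split; rewrite ?s0//.
move=> sNi; have : nbhs s [set u | N (phi y u)].
  exact: (flow_nbhs_time F).
move=> /nbhs_ballP[e /= e0 he]; have e2 : 0 < e / 2 by rewrite divr_gt0.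
have [u /andP[su us] nNu] := nxt _ e2; apply: nNu; apply: he.
by rewrite /ball /= ltr0_norm ?subr_lt0//; lra.
Qed.

Lemma block_reverse phi N K : isolating_block phi N K -> isolating_block (reverse phi) N K.
Proof.
move=> [iN [Ni [No [[cNi cNo fE] [h1 h2 h3 h4]]]]]; split; first exact: isolates_reverse.
exists No, Ni; split; first by split; rewrite // setUC.
split.
- move=> x /h2[e e0 he]; exists e => // t /andP[t1 t2]; apply: he; lra.
- move=> x /h1[e e0 he]; exists e => // t /andP[t1 t2]; apply: he; lra.
- move=> x /h4[e e0 he]; exists e => // t /andP[t1 t2]; apply: he; lra.
- move=> x /h3[e e0 he]; exists e => // t /andP[t1 t2]; apply: he; lra.
Qed.

(** [P] is closed, meets the connected set [N'], and is relatively open in it by the last two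
    hypotheses. *)
Lemma clopen_stays phi N N' (P := stays phi N `|` stays (reverse phi) N) :
  is_flow phi -> closed N -> connected N' -> N' `&` P !=set0 ->
  (forall x, N' x -> stays phi N x -> nbhs x [set y | N' y -> P y]) ->
  (forall x, N' x -> stays (reverse phi) N x -> nbhs x [set y | N' y -> P y]) ->
  N' `<=` P.
Proof.
move=> F clN cN' P0 h1 h2.
suff <- : N' `&` P = N' by move=> x [].
apply: cN' => //.
- exists [set y | N' y -> P y]°; first exact: open_interior.
  apply/seteqP; split=> x [N'x]; last by move=> /interior_subset/(_ N'x).
  by move=> Px; split=> //; case: Px; [exact: h1|exact: h2].
- exists P => //; apply: closedU; first exact: stays_closed.
  exact: (stays_closed (reverse_flow F)).
Qed.

Lemma frontierP N x : closed N -> frontier N x <-> N x /\ ~ N° x.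
Proof. by move=> clN; rewrite /frontier -(closure_id N).1. Qed.

(** An orbit staying forwards in [N] never meets the exit set. During the bounded time it needs to
    reach [V] the same holds for nearby orbits, which therefore cannot leave [N] before reaching
    [V]. *)
Lemma block_stays phi N K : hausdorff_space M -> is_flow phi -> isolating_block phi N K ->
  connected N -> K !=set0 -> non_saddle phi K -> N `<=` stays phi N `|` stays (reverse phi) N.
Proof.
move=> hM F bN coN [x0 Kx0] ns; have iN := block_isolates bN.
have clN : closed N by apply: compact_closed => //; exact: (isolates_compact iN).
have [V KV VN] := non_saddle_stays iN ns.
have loc psi : is_flow psi -> isolating_block psi N K ->
    V `<=` stays psi N `|` stays (reverse psi) N ->
    forall x, N x -> stays psi N x -> nbhs x [set y | N y -> (stays psi N `|` stays (reverse psi) N) y].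
  move=> {}F {}bN {}VN x Nx xN; have {}iN := block_isolates bN.
  have [_ [Ni [No [[cNi cNo fE] [h1 h2 h3 h4]]]]] := bN.
  have [T T0 hT] := leave_time F hM iN (open_interior V) KV.
  have clNo : closed No by exact: compact_closed.
  have xT : V° (psi x T) by exact: (attract F hT).
  have n1 : nbhs x [set y | forall t, 0 <= t <= T -> (~` No) (psi y t)].
    apply: flow_tube => //; first exact: closed_openC.
    move=> t /andP[t0 _] Nox; have [e e0 he] := h2 _ Nox.
    apply: (he e); first by rewrite e0 lexx.
    by rewrite -(flowD F); apply: xN; rewrite addr_ge0// ltW.
  have n2 : nbhs x (psi^~ T @^-1` V°).
    by apply: (flow_nbhs_space F); apply: open_nbhs_nbhs; split=> //; exact: open_interior.
  apply: filterS (filterI n1 n2) => y [yNo yV] Ny.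
  apply: (stays_absorb F T0 _ (interior_subset yV)) => // t /andP[t0 tT].
  apply: contrapT => nN; have [s [/andP[s0 st] sN nsN nxt]] := first_exit F clN Ny t0 nN.
  have fs : frontier N (psi y s) by apply/frontierP => //; split=> //; apply: sN; rewrite s0 lexx.
  have nNo : ~ No (psi y s) by apply: yNo; rewrite s0 (le_trans st).
  (* At a frontier point that is not an exit point the orbit enters the interior, which contradicts
     leaving right after [s]. *)
  have [e e0 he] := h4 _ (conj fs nNo).
  have [u /andP[su us]] := nxt e e0; apply.
  apply: interior_subset; have := he (u - s); rewrite -(flowD F) [s + _]addrC subrK; apply.
  by rewrite subr_gt0 su /= lerBlDl.
apply: (clopen_stays F clN coN).
- exists x0; split; last by left; exact: (sub_stays iN).
  by apply: interior_subset; exact: (isolates_nbhd iN).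
- exact: loc.
- have := loc _ (reverse_flow F) (block_reverse bN).
  by rewrite reverseK setUC; apply.
Qed.
End Flow.

(** * Perturbation of flows *)

Section Perturbation.
Context {R : realType} {M : topologicalType} (hM : hausdorff_space M).
Implicit Types (phi psi : M -> R -> M) (K N U V O : set M).

(** The orbit of [x] up to the time when it enters [D] is a connected subset of [N], so it cannot
    cross from one relatively clopen part to the other. *)
Lemma clopen_grow phi N K D D' x : is_flow phi -> isolates phi N K -> open D -> closed D' ->
  N `&` D = N `&` D' -> K `<=` D -> stays phi N x -> D x.
Proof.
move=> F iN oD cD' DD KD xN; have [T T0 hT] := leave_time F hM iN oD KD.
pose I := phi x @` `[0, T].
have cI : connected I.
  apply: connected_continuous_connected; first exact: segment_connected.
  by apply: continuous_subspaceT; exact: (flow_cont_time F).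
have IN : I `<=` N by move=> _ [t /= /[!in_itv]/andP[t0 _] <-]; exact: xN.
have II : I `&` D = I.
  apply: cI.
  - exists (phi x T); split; last exact: (attract F hT).
    by exists T => //=; rewrite in_itv /= T0 lexx.
  - by exists D.
  - by exists D' => //; rewrite -(setIidl IN) -setIA DD setIA.
have : I x by exists 0; rewrite ?(flow0 F)//= in_itv /= lexx.
by rewrite -II => -[].
Qed.

(** A relatively clopen part of [N] contains [K] or misses it, and [clopen_grow] applies to it or to
    its complement. *)
Lemma stays_connected phi N K : is_flow phi -> isolates phi N K -> connected K -> K !=set0 ->
  N `<=` stays phi N `|` stays (reverse phi) N -> connected N.
Proof.
move=> F iN cK [x0 Kx0] NP B [b Bb] [D oD BD] [D' cD' BD'].
have KN : K `<=` N by move=> x Kx; apply: interior_subset; exact: (isolates_nbhd iN).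
have grow C C' : open C -> closed C' -> N `&` C = N `&` C' -> K `<=` C -> N `<=` C.
  move=> oC cC' CC KC x Nx; case: (NP x Nx) => xN.
    exact: (clopen_grow F iN oC cC' CC KC xN).
  exact: (clopen_grow (reverse_flow F) (isolates_reverse iN) oC cC' CC KC xN).
have DD : N `&` D = N `&` D' by rewrite -BD -BD'.
have [[k [Kk Dk]]|KD] := pselect (K `&` D !=set0).
  have KDK : K `&` D = K.
    apply: cK; [by exists k|by exists D|exists D' => //].
    by rewrite -(setIidl KN) -setIA DD setIA.
  have ND := grow D D' oD cD' DD; rewrite BD; apply/setIidl/ND => x.
  by rewrite -{1}KDK => -[].
have ND : N `<=` ~` D'.
  apply: (grow (~` D') (~` D)).
  - exact: closed_openC.
  - exact: open_closedC.
  - apply/seteqP; split=> x [Nx nx]; split=> // Dx; apply: nx.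
      have : (N `&` D) x by [].
      by rewrite DD => -[].
    have : (N `&` D') x by [].
    by rewrite -DD => -[].
  - move=> x Kx D'x; apply: KD; exists x; split=> //.
    have : (N `&` D') x by split=> //; exact: KN.
    by rewrite -DD => -[].
by exfalso; move: Bb; rewrite BD' => -[/ND].
Qed.

(** After a perturbation the orbit of a frontier point may first enter the interior, so it is only
    asked to leave [N] before it meets [N']. *)
Definition passes psi N N' (Q : set M) := forall y, Q y -> exists2 t, 0 <= t &
  ~ N (psi y t) /\ forall s, 0 <= s <= t -> ~ N' (psi y s).

Lemma exits_pass psi N N' (Q : set M) : is_flow psi -> closed N -> N' `<=` N° -> Q `<=` frontier N ->
  (forall x, Q x -> exists2 e : R, 0 < e & forall t, 0 < t <= e -> ~ N (psi x t)) ->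
  passes psi N N' Q.
Proof.
move=> F clN NN QN hQ y Qy; have [e e0 he] := hQ y Qy; exists e; first exact: ltW.
split; first by apply: he; rewrite e0 lexx.
move=> s /andP[]; rewrite le_eqVlt => /predU1P[<- _|s0 se]; last first.
  by move=> /NN/interior_subset; apply: he; rewrite s0.
by rewrite (flow0 F) => /NN; have /(frontierP _ clN)[] := QN y Qy.
Qed.

Lemma passes_stable (psi : R -> M -> R -> M) N N' (Q : set M) :
  continuous (fun q : M * R * R => psi q.2 q.1.1 q.1.2) -> closed N -> closed N' ->
  compact Q -> passes (psi 0) N N' Q ->
  exists2 e, 0 < e & forall l, `|l| < e -> passes (psi l) N N' Q.
Proof.
move=> c clN clN' cQ h0.
have c' : continuous (fun q : M * R * R => psi q.1.2 q.1.1 q.2).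
  move=> [[y l] t].
  apply: (@cvg_comp _ _ _ (fun q : M * R * R => (q.1.1, q.2, q.1.2))
    (fun q => psi q.2 q.1.1 q.1.2) _ (nbhs (y, t, l))); last by have /(_ (y, t, l)) := c.
  apply: (@cvg_pair _ _ _ (nbhs (y, l, t)) (nbhs (y, t)) (nbhs l) _ _ _
    (fun q : M * R * R => (q.1.1, q.2)) (fun q => q.1.2)).
    apply: (@cvg_pair _ _ _ (nbhs (y, l, t)) (nbhs y) (nbhs t) _ _ _
      (fun q : M * R * R => q.1.1) snd); last exact: cvg_snd.
    by apply: (@cvg_comp _ _ _ fst fst _ (nbhs (y, l))); exact: cvg_fst.
  by apply: (@cvg_comp _ _ _ fst snd _ (nbhs (y, l))); [exact: cvg_fst|exact: cvg_snd].
pose P (S : set M) := exists2 e, 0 < e & forall l, `|l| < e -> forall y, S y -> exists2 t, 0 <= t &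
  ~ N (psi l y t) /\ forall s, 0 <= s <= t -> ~ N' (psi l y s).
suff [e e0 he] : P Q by exists e => // l le y; exact: he.
apply: (compact_ind (Q := P)) cQ; rewrite /P.
- by exists 1.
- by move=> S S' SS' [e e0 he]; exists e => // l le y /SS'; exact: he.
- move=> S S' [e e0 he] [e' e'0 he']; exists (Num.min e e'); first by rewrite lt_min e0.
  by move=> l; rewrite lt_min => /andP[h1 h2] y [Sy|Sy]; [exact: he|exact: he'].
move=> y /h0[t t0 [nN nN']].
have n1 : nbhs (y, 0 : R) [set q | forall s, 0 <= s <= t -> (~` N') (psi q.2 q.1 s)].
  by apply: (tube c' (closed_openC clN')) => s st; exact: nN'.
have n2 : nbhs (y, 0 : R) [set q | forall s, t <= s <= t -> (~` N) (psi q.2 q.1 s)].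
  by apply: (tube c' (closed_openC clN)) => s; rewrite -eq_le => /eqP <-.
have [[U V] /= [Uy V0] UV] := filterI n1 n2.
have /nbhs_ballP[e /= e0 he] := V0.
exists U => //; exists e => // l le z Uz; exists t => //.
have [h1 h2] : [set q : M * R | forall s, 0 <= s <= t -> (~` N') (psi q.2 q.1 s)] (z, l) /\
    [set q : M * R | forall s, t <= s <= t -> (~` N) (psi q.2 q.1 s)] (z, l).
  by apply: UV; split=> //=; apply: he; rewrite /ball /= sub0r normrN.
by split; [apply: h2; rewrite lexx|exact: h1].
Qed.

(** Followed backwards from a point of [Q], the orbit would leave [N] before meeting [N'], whereas
    here it returns to [x] in [N'] without leaving [N]. *)
Lemma passes_avoid psi N N' (Q : set M) x t : is_flow psi -> passes (reverse psi) N N' Q ->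
  N' x -> 0 <= t -> (forall u, 0 <= u <= t -> N (psi x u)) -> ~ Q (psi x t).
Proof.
move=> F hQ N'x t0 xN Qt; have [s s0 [nN nN']] := hQ _ Qt.
have E u : reverse psi (psi x t) u = psi x (t - u) by rewrite /reverse -(flowD F).
have [st|/ltW ts] := leP s t.
  by apply: nN; rewrite E; apply: xN; rewrite subr_ge0 st lerBlDr lerDl.
by apply: (nN' t); rewrite ?t0// E subrr (flow0 F).
Qed.

(** The counterpart of [block_stays] for a flow of which [N] need not be a block. A forward orbit
    from [N'] that stays in [N] avoids the whole frontier: the entrance set by [passes_avoid], the
    exit set because it would have to leave afterwards. Nearby orbits hence remain in the interior
    until they reach [V]. *)
Lemma passes_stays psi N N' K Ni No : is_flow psi -> closed N ->
  frontier N = Ni `|` No -> passes (reverse psi) N N' Ni -> passes psi N N' No ->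
  N' `<=` N° -> connected N' -> isolates psi N K -> K `<=` N' -> K !=set0 ->
  non_saddle psi K -> N' `<=` stays psi N `|` stays (reverse psi) N.
Proof.
move=> F clN fN pi po N'N cN' iN KN' [x0 Kx0] ns.
have [V KV VN] := non_saddle_stays iN ns.
have loc phi I O : is_flow phi -> frontier N = I `|` O -> passes (reverse phi) N N' I ->
    passes phi N N' O -> isolates phi N K -> V `<=` stays phi N `|` stays (reverse phi) N ->
    forall x, N' x -> stays phi N x ->
      nbhs x [set y | N' y -> (stays phi N `|` stays (reverse phi) N) y].
  move=> {}F {}fN {}pi {}po {}iN {}VN x N'x xN.
  have [T T0 hT] := leave_time F hM iN (open_interior V) KV.
  have xT : V° (phi x T) by exact: (attract F hT).
  have n1 : nbhs x [set y | forall t, 0 <= t <= T -> N° (phi y t)].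
    apply: flow_tube => //; first exact: open_interior.
    move=> t /andP[t0 _]; apply: contrapT => nN.
    have : frontier N (phi x t) by apply/(frontierP _ clN); split=> //; exact: xN.
    rewrite fN => -[It|Ot].
      by apply: (passes_avoid F pi N'x t0 _ It) => u /andP[u0 _]; exact: xN.
    have [s s0 [nNs _]] := po _ Ot; apply: nNs.
    by rewrite -(flowD F); apply: xN; exact: addr_ge0.
  have n2 : nbhs x [set y | V° (phi y T)].
    by apply: (flow_nbhs_space F); apply: open_nbhs_nbhs; split=> //; exact: open_interior.
  apply: filterS (filterI n1 n2) => y [yN yV] _.
  apply: (stays_absorb F T0 _ (interior_subset yV)) => // t tT.
  by apply: interior_subset; exact: yN.
apply: (clopen_stays F clN cN').
- by exists x0; split; [exact: KN'|left; exact: (sub_stays iN)].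
- exact: (loc _ Ni No).
- move=> x N'x xN; have h := loc (reverse psi) No Ni (reverse_flow F); rewrite reverseK in h.
  rewrite setUC; apply: h => //; [by rewrite fN setUC|exact: isolates_reverse|by rewrite setUC].
Qed.
End Perturbation.

(** * Existence of isolating blocks *)

Section Lyapunov.
Context {R : realType} {M : topologicalType} (hM : hausdorff_space M).
Implicit Types (phi psi : M -> R -> M) (N U V O : set M).

Section Distance.
Context {d : M -> M -> R} {G : set M} (dG : gauge d G) (K : set M) (K0 : K !=set0).

Definition dist_to x : R := inf [set d k x | k in K].

Lemma dist_to_has_inf x : has_inf [set d k x | k in K].
Proof.
split; first by have [k Kk] := K0; exists (d k x), k.
by exists 0 => _ [k _ <-]; exact: (gauge_ge0 dG).
Qed.

Lemma dist_to_ge0 x : 0 <= dist_to x.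
Proof.
apply: lb_le_inf; first by have [k Kk] := K0; exists (d k x), k.
by move=> _ [k _ <-]; exact: (gauge_ge0 dG).
Qed.

Lemma dist_to_le x k : K k -> dist_to x <= d k x.
Proof. by move=> Kk; apply: ge_inf; [exact: (dist_to_has_inf x).2|exists k]. Qed.

Lemma dist_to_lt x r : dist_to x < r -> near_set d r K x.
Proof.
move=> xr; have r0 : 0 < r - dist_to x by rewrite subr_gt0.
have [_ [k Kk <-]] := inf_adherent r0 (dist_to_has_inf x).
by rewrite -/(dist_to x) addrC subrK => kr; exists k.
Qed.

Lemma dist_to0 x : K x -> dist_to x = 0.
Proof.
move=> Kx; apply/eqP; rewrite eq_le dist_to_ge0 andbT.
by apply: le_trans (dist_to_le x Kx) _; rewrite (gauge_xx dG).
Qed.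

Lemma dist_to_lip x y : dist_to x <= dist_to y + d x y.
Proof.
rewrite -lerBlDr; apply: lb_le_inf; first by have [k Kk] := K0; exists (d k y), k.
move=> _ [k Kk <-]; rewrite lerBlDr; apply: le_trans (dist_to_le x Kk) _.
by apply: le_trans (gauge_tri dG k y x) _; rewrite (gauge_sym dG y x).
Qed.

Lemma dist_to_continuous : continuous dist_to.
Proof.
move=> x; apply/cvgrPdist_lt => e e0; apply: filterS (gauge_ball dG x e0) => y /= xy.
apply: le_lt_trans xy; rewrite ler_norml.
have h1 := dist_to_lip x y; have h2 := dist_to_lip y x; rewrite (gauge_sym dG y x) in h2.
by apply/andP; split; lra.
Qed.

End Distance.

(** Strict growth for positive times makes orbits enter the sublevel sets strictly; the bounds 1 and
    2 make late times, when the orbit is close to [K], contribute little. *)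
Definition weight (t : R) : R := 2 - (1 + `|t|)^-1.

Let den_gt0 (t : R) : 0 < 1 + `|t|. Proof. by rewrite ltr_pwDl. Qed.

Lemma weight_continuous : continuous weight.
Proof.
move=> t; apply: cvgB; first exact: cvg_cst.
apply: cvgV; first by rewrite gt_eqF.
apply: cvgD; first exact: cvg_cst.
exact: (@norm_continuous R R^o t).
Qed.

Lemma weight0 : weight 0 = 1. Proof. by rewrite /weight normr0 addr0 invr1; ring. Qed.

Lemma weight_lt2 t : weight t < 2.
Proof. by rewrite /weight gtrBl invr_gt0. Qed.

Lemma weight_ge1 t : 1 <= weight t.
Proof.
rewrite /weight (_ : 2 = 1 + 1 :> R)// -addrA lerDl subr_ge0 invf_le1//.
by rewrite lerDl.
Qed.

Lemma weight_lt s t : 0 <= t -> t < s -> weight t < weight s.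
Proof.
move=> t0 ts; rewrite /weight ltrD2l ltrN2 ltf_pV2 ?posrE// ltrD2l !ger0_norm//.
exact: (le_trans t0 (ltW ts)).
Qed.

Section Sublevel.
Context {psi : M -> R -> M} (F : is_flow psi) {N K : set M} (iN : isolates psi N K).
Context {u : M -> R} (u_cont : continuous u) (u_ge0 : forall x, 0 <= u x).
Context (u0 : forall x, K x -> u x = 0) (e : R) (e0 : 0 < e).

(* A sublevel set of the Lyapunov function [sup_t weight t * u (psi x t)]. *)
Definition sublevel := stays psi N `&` [set x | forall t, 0 <= t -> weight t * u (psi x t) <= e].
Definition strict_sublevel :=
  stays psi N `&` [set x | forall t, 0 <= t -> weight t * u (psi x t) < e].

Let wu_continuous : continuous (fun p : M * R => weight p.2 * u (psi p.1 p.2)).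
Proof.
move=> p; apply: cvgM.
  by apply: (@cvg_comp _ _ _ snd weight _ (nbhs p.2)); [exact: cvg_snd|exact: weight_continuous].
apply: (@cvg_comp _ _ _ (fun p : M * R => psi p.1 p.2) u _ (nbhs (psi p.1 p.2))).
  exact: (flow_continuous F).
exact: u_cont.
Qed.

Lemma strict_sublevel_sub : strict_sublevel `<=` sublevel.
Proof. by move=> x [xN h]; split=> // t t0; apply/ltW/h. Qed.

Lemma sublevel_closed : closed N -> closed sublevel.
Proof.
move=> clN; apply: closedI; first exact: (stays_closed F).
rewrite (_ : [set x | _] = \bigcap_(t in [set t | 0 <= t]) [set x | weight t * u (psi x t) <= e]); last first.
  by apply/seteqP; split=> x h t; exact: h.
apply: closed_bigI => t _.
apply: (closed_comp (f := fun x => weight t * u (psi x t)) (D := [set y | y <= e])); last exact: closed_le.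
move=> x _; apply: cvgM; first exact: cvg_cst.
apply: (@cvg_comp _ _ _ (psi^~ t) u _ (nbhs (psi x t))); last exact: u_cont.
exact: (flow_cont_space F).
Qed.

(** From a uniform time on [u] is below [e / 4] and the weight below 2, so only a compact interval
    of times imposes a condition, and that condition is open. *)
Lemma strict_sublevel_near x : strict_sublevel x ->
  nbhs x [set y | stays psi N y -> strict_sublevel y].
Proof.
move=> [xN hx]; have e4 : 0 < e / 4 by rewrite divr_gt0.
have oO : open (u @^-1` [set y | y < e / 4]) by apply: open_comp => // y _; exact: u_cont.
have KO : K `<=` u @^-1` [set y | y < e / 4] by move=> y Ky; rewrite /= u0.
have [T T0 hT] := leave_time F hM iN oO KO.
have n1 : nbhs x [set y | forall t, 0 <= t <= T -> [set y | y < e] (weight t * u (psi y t))].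
  apply: (tube (F := fun p : M * R => weight p.2 * u (psi p.1 p.2))).
  - exact: wu_continuous.
  - exact: open_lt.
  by move=> t /andP[t0 _]; exact: hx.
apply: filterS n1 => y hy yN; split=> // t t0; have [tT|/ltW Tt] := leP t T; first by apply: hy; rewrite t0.
have /= := attract F hT yN T0 Tt; have := weight_lt2 t; have := weight_ge1 t.
have := u_ge0 (psi y t); nra.
Qed.

Lemma sublevel_forward x s : sublevel x -> 0 < s -> strict_sublevel (psi x s).
Proof.
move=> [xN hx] s0; split; first exact: (stays_flow F xN (ltW s0)).
move=> t t0; rewrite -(flowD F).
have := hx (s + t) (addr_ge0 (ltW s0) t0).
have := u_ge0 (psi x (s + t)); rewrite le_eqVlt => /predU1P[<-|up].
  by rewrite !mulr0.
move=> h; apply: (lt_le_trans _ h); rewrite ltr_pM2r//; apply: weight_lt => //.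
by rewrite ltrDr.
Qed.

Lemma sublevel_backward x s : sublevel x -> ~ strict_sublevel x -> 0 < s -> ~ sublevel (psi x (- s)).
Proof.
move=> [xN hx] nx s0 [_ hs]; apply: nx; split=> // t t0.
have := hs (t + s) (addr_ge0 t0 (ltW s0)); rewrite -(flowD F) (_ : - s + (t + s) = t); last by ring.
have := u_ge0 (psi x t); rewrite le_eqVlt => /predU1P[<-|up]; first by rewrite !mulr0.
by move=> h; apply: (lt_le_trans _ h); rewrite ltr_pM2r//; apply: weight_lt => //; rewrite ltrDl.
Qed.

Lemma sub_strict_sublevel : K `<=` strict_sublevel.
Proof.
move=> x Kx; split; first exact: (sub_stays iN).
by move=> t _; rewrite u0 ?mulr0//; exact: (isolates_invariant iN).
Qed.

Lemma sublevel_le x : sublevel x -> u x <= e.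
Proof. by move=> [_ /(_ 0 (lexx _))]; rewrite (flow0 F) weight0 mul1r. Qed.

Lemma sublevel_stays x : sublevel x -> forall t, 0 <= t -> sublevel (psi x t).
Proof.
move=> Nx t; rewrite le_eqVlt => /predU1P[<-|t0]; first by rewrite (flow0 F).
by apply: strict_sublevel_sub; exact: sublevel_forward.
Qed.
End Sublevel.
Arguments sublevel : clear implicits.
Arguments strict_sublevel : clear implicits.

Section Block.
Context {phi : M -> R -> M} (F : is_flow phi) {N K V : set M} (iN : isolates phi N K).
Context (VN : V `<=` stays phi N `|` stays (reverse phi) N).
Context {u : M -> R} (u_cont : continuous u) (u_ge0 : forall x, 0 <= u x).
Context (u0 : forall x, K x -> u x = 0) (e : R) (e0 : 0 < e) (uV : [set x | u x <= e] `<=` V°).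

Let clN : closed N. Proof. by apply: compact_closed => //; exact: (isolates_compact iN). Qed.

Let L := sublevel phi N u e `|` sublevel (reverse phi) N u e.

Let sub_both : sublevel phi N u e `&` sublevel (reverse phi) N u e `<=` K.
Proof. by move=> x [[xp _] [xm _]]; exact: (stays_both F iN). Qed.

(** Near [x] every point stays in [N] forwards or backwards. If [x] does not stay backwards, neither
    do nearby points, so they all stay forwards and [strict_sublevel_near] applies. If it does, [x]
    lies in [K] and the lemma applies in both directions. *)
Let strict_interior : strict_sublevel phi N u e `<=` L°.
Proof.
move=> x Sx; have Vx : V° x.
  by apply: uV; apply: (sublevel_le F); exact: (strict_sublevel_sub Sx).
have n1 := strict_sublevel_near F iN u_cont u_ge0 u0 e0 Sx.
have [xm|nxm] := pselect (stays (reverse phi) N x).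
  have Kx : K x by apply: (stays_both F iN); split=> //; case: Sx.
  have Sx' := sub_strict_sublevel (isolates_reverse iN) u0 e0 Kx.
  have n2 := strict_sublevel_near (reverse_flow F) (isolates_reverse iN) u_cont u_ge0 u0 e0 Sx'.
  apply: filterS (filterI Vx (filterI n1 n2)) => y [/VN[yp|ym] [h1 h2]].
    by left; apply: strict_sublevel_sub; exact: h1.
  by right; apply: strict_sublevel_sub; exact: h2.
have n2 : nbhs x (~` stays (reverse phi) N).
  apply: open_nbhs_nbhs; split=> //; apply: closed_openC.
  exact: (stays_closed (reverse_flow F)).
apply: filterS (filterI Vx (filterI n1 n2)) => y [/VN[yp|ym] [h1 h2]] //.
by left; apply: strict_sublevel_sub; exact: h1.
Qed.

Lemma sublevel_entrance x : frontier L x -> sublevel phi N u e x ->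
  exists2 a : R, 0 < a & forall t, - a <= t < 0 -> ~ L (phi x t).
Proof.
have clL : closed L by apply: closedU; apply: sublevel_closed => //; exact: reverse_flow.
move=> /(frontierP _ clL)[Lx nLx] Sx.
have nSx : ~ strict_sublevel phi N u e x by move=> /strict_interior.
have nSx' : ~ sublevel (reverse phi) N u e x.
  by move=> Sx'; apply: nSx; apply: (sub_strict_sublevel iN u0 e0); exact: sub_both.
have : nbhs (0 : R) [set t | (~` sublevel (reverse phi) N u e) (phi x t)].
  apply: (flow_nbhs_time F); rewrite (flow0 F); apply: open_nbhs_nbhs; split=> //.
  by apply: closed_openC; apply: sublevel_closed => //; exact: reverse_flow.
move=> /nbhs_ballP[a /= a0 ha]; exists (a / 2); first by rewrite divr_gt0.
move=> t /andP[at_ t0] [|].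
  by rewrite -(opprK t); apply: (sublevel_backward F u_ge0 e0 Sx nSx); rewrite oppr_gt0.
by apply: ha; rewrite /ball /= sub0r normrN ltr0_norm//; lra.
Qed.

Lemma sublevel_inward x : sublevel phi N u e x -> forall t, 0 < t -> L° (phi x t).
Proof. by move=> Sx t t0; apply: strict_interior; exact: sublevel_forward. Qed.

Lemma sub_sublevel_interior : K `<=` L°.
Proof. by move=> x Kx; apply: strict_interior; exact: (sub_strict_sublevel iN). Qed.
End Block.

(** The block is the union of the sublevel sets for the forward and the backward flow; frontier
    points in the former are entrance points, those in the latter exit points. *)
Lemma block_exists phi N0 K U : loc_compact M -> (forall N, compact N -> exists d : M -> M -> R, gauge d N) ->
  is_flow phi -> isolates phi N0 K -> compact K -> K !=set0 -> non_saddle phi K -> open U -> K `<=` U ->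
  exists N, [/\ isolating_block phi N K, N `<=` U & N `<=` stays phi N `|` stays (reverse phi) N].
Proof.
move=> lc hG F iN0 cK K0 ns oU KU; have [d dG] := hG _ (isolates_compact iN0).
have KN0 : K `<=` N0 by move=> x Kx; apply: interior_subset; exact: (isolates_nbhd iN0).
have [||N [r0 [cN NU r00 rN]]] := near_set_compact dG lc cK KN0 (U := N0° `&` U).
- by apply: openI => //; exact: open_interior.
- by move=> x Kx; split; [exact: (isolates_nbhd iN0)|exact: KU].
have KN : K `<=` N°.
  move=> x Kx; apply: filterS rN _; apply: open_nbhs_nbhs; split; first exact: (near_set_open dG).
  exact: (sub_near_set dG).
have iN : isolates phi N K.
  by apply: (isolates_sub iN0) => // x /NU[/interior_subset].
have [V KV VN] := non_saddle_stays iN ns.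
have [||r r_gt0 rV] := near_set_sub dG cK KN0 (U := V°) => //; first exact: open_interior.
pose u := dist_to (d := d) K; pose e := r / 2.
have e0 : 0 < e by rewrite divr_gt0.
have uV : [set x | u x <= e] `<=` V°.
  move=> x /= ux; apply: rV; apply: (dist_to_lt dG K0); apply: (le_lt_trans ux).
  by rewrite /e; lra.
have u_cont := dist_to_continuous dG K0; have u_ge0 := dist_to_ge0 dG K0.
have u0 := dist_to0 dG K0; have clN : closed N by exact: compact_closed.
pose S := sublevel phi N u e; pose S' := sublevel (reverse phi) N u e.
have F' := reverse_flow F; have iN' := isolates_reverse iN.
have VN' : V `<=` stays (reverse phi) N `|` stays (reverse (reverse phi)) N by rewrite reverseK setUC.
have clS : closed S by exact: sublevel_closed.
have clS' : closed S' by exact: sublevel_closed.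
have KL := sub_sublevel_interior F iN VN u_cont u_ge0 u0 e0 uV.
have SN : S `|` S' `<=` N by move=> x [[/(stays_sub F)]|[/(stays_sub F')]].
have cL : compact (S `|` S') by apply: (subclosed_compact _ cN) => //; exact: closedU.
have clL : closed (S `|` S') by exact: closedU.
have iL : isolates phi (S `|` S') K by exact: (isolates_sub iN).
exists (S `|` S'); split.
- split=> //; exists (frontier (S `|` S') `&` S), (frontier (S `|` S') `&` S'); split.
    have fL : closed (frontier (S `|` S')).
      by apply: closedI; [exact: closed_closure|apply: open_closedC; exact: open_interior].
    have fN : frontier (S `|` S') `<=` N by move=> x /(frontierP _ clL)[/SN].
    split.
    + by apply: (subclosed_compact _ cN); [exact: closedI|move=> x [/fN]].
    + by apply: (subclosed_compact _ cN); [exact: closedI|move=> x [/fN]].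
    + by rewrite -setIUr; apply/esym/setIidl => x /(frontierP _ clL)[].
  split.
  + by move=> x [fx Sx]; exact: (sublevel_entrance F iN VN).
  + move=> x [fx Sx]; have := sublevel_entrance F' iN' VN' u_cont u_ge0 u0 e0 uV (x := x).
    rewrite reverseK setUC => /(_ fx Sx)[a a0 ha]; exists a => // t /andP[t0 ta].
    by rewrite -(opprK t); apply: (ha (- t)); rewrite lerN2 ta oppr_lt0.
  + move=> x [fx nx]; exists 1 => // t /andP[_ t0].
    have Sx : S' x by have [[Sx|//] _] := (frontierP x clL).1 fx; case: nx.
    have := sublevel_inward F' iN' VN' u_cont u_ge0 u0 e0 uV Sx (t := - t).
    by rewrite reverseK setUC /reverse opprK oppr_gt0; exact.
  + move=> x [fx nx]; exists 1 => // t /andP[t0 _].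
    have Sx : S x by have [[//|Sx] _] := (frontierP x clL).1 fx; case: nx.
    exact: (sublevel_inward F iN VN).
- by move=> x /SN/NU[].
- move=> x [Sx|Sx]; [left|right] => t t0; [left|right].
    exact: (sublevel_stays F).
  exact: (sublevel_stays F').
Qed.
End Lyapunov.

(** * Cochains pushed along flows *)

Section Uniform.
Context {R : realType} {T : topologicalType} {d : T -> T -> R} {G : set T} (dG : gauge d G).

Let gauge_prod : gauge (fun p q : T * R => d p.1 q.1 + `|p.2 - q.2|) (G `*` setT).
Proof.
split.
- by move=> x; rewrite (gauge_xx dG) subrr normr0 addr0.
- by move=> x y; rewrite (gauge_sym dG) distrC.
- move=> x y z; rewrite addrACA lerD ?(gauge_tri dG)//.
  by rewrite (le_trans _ (ler_normD _ _))// addrA subrK.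
- move=> [p q]; have h : {for (p.1, q.1), continuous (fun p : T * T => d p.1 p.2)}.
    exact: gauge_continuous dG (p.1, q.1).
  apply: cvgD.
    apply: (@cvg_comp _ _ _ (fun z : (T * R) * (T * R) => (z.1.1, z.2.1)) (fun z => d z.1 z.2) _
      (nbhs (p.1, q.1))); last exact: h.
    apply: (@cvg_pair _ _ _ (nbhs (p, q)) (nbhs p.1) (nbhs q.1) _ _ _
      (fun z : (T * R) * (T * R) => z.1.1) (fun z => z.2.1)).
      by apply: (@cvg_comp _ _ _ fst fst _ (nbhs p)); exact: cvg_fst.
    by apply: (@cvg_comp _ _ _ snd fst _ (nbhs q)); [exact: cvg_snd|exact: cvg_fst].
  apply: cvg_norm; apply: cvgB.
    by apply: (@cvg_comp _ _ _ fst snd _ (nbhs p)); [exact: cvg_fst|exact: cvg_snd].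
  by apply: (@cvg_comp _ _ _ snd snd _ (nbhs q)); exact: cvg_snd.
- move=> [x t] V [Gx _] [[U W] /= [Ux Wt] UW].
  have [r r0 hr] := gauge_nbhs dG Gx Ux; have /nbhs_ballP[q /= q0 hq] := Wt.
  exists (Num.min r q); first by rewrite lt_min r0.
  move=> [y s] /=; rewrite lt_min => /andP[h1 h2]; apply: UW; split=> /=.
    by apply: hr; apply: le_lt_trans h1; rewrite lerDl.
  by apply: hq; apply: le_lt_trans h2; rewrite lerDr (gauge_ge0 dG).
Qed.

Lemma gauge_uniform (F : T * R -> T) C (a b e : R) : compact C -> C `<=` G -> continuous F -> 0 < e ->
  exists2 r : R, 0 < r & forall x y s t, C x -> a <= s <= b -> d x y < r -> `|s - t| < r ->
    d (F (x, s)) (F (y, t)) < e.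
Proof.
move=> cC CG cF e0.
have [| |x [Cx _]|r r0 hr] := lebesgue_number gauge_prod (C := C `*` `[a, b])
    (P := fun p q => d (F p) (F q) < e).
- by apply: compact_setX => //; exact: segment_compact.
- by move=> x [/CG].
- have e2 : 0 < e / 2 by rewrite divr_gt0.
  exists [set q | d (F x) (F q) < e / 2]; first exact: (cF x _ (gauge_ball dG (F x) e2)).
  move=> y z /= xy xz; apply: le_lt_trans (gauge_tri dG _ (F x) _) _.
  by rewrite (gauge_sym dG); lra.
exists (r / 2); first by rewrite divr_gt0.
move=> x y s t Cx st xy sst; apply: hr; first by split=> //=; rewrite in_itv.
by rewrite /=; lra.
Qed.
End Uniform.

Section Push.
Context {R : realType} {M : topologicalType}.

(* Homotope the identity of [N] backwards along the flow: the prisms of [f] are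
   carried by the orbit segment of [p], and the final map avoids [p]. *)
Lemma push_cochain (d : M -> M -> R) (N O : set M) psi p (b : R) n f : gauge d N -> compact N ->
  is_flow psi -> N p -> 0 <= b -> closed N -> ~ N (psi p b) -> open O ->
  (forall t, 0 <= t <= b -> O (psi p t)) ->
  hom n.+1 f -> supported d [set p] f -> germ d setT (fun s => coboundary f s = 0) ->
  exists a, [/\ hom n a, germ d N (fun s => coboundary a s = f s)
    & germ d N (fun s => a s != 0 -> forall x, x \in s -> O x)].
Proof.
move=> dN cN F Np b0 clN npb oO pO hf sf [q q0 df].
(* Points near [p] are outside [N] at time [b], so the last map of the chain sends no point of [N]
   near [p]. *)
have [r1 r10 hr1] : exists2 r : R, 0 < r & forall y, d p y < r -> ~ N (psi y b).
  apply: (gauge_nbhs dN Np); apply: (flow_nbhs_space F (A := ~` N)); apply: open_nbhs_nbhs; split=> //.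
  exact: closed_openC.
have [r2 r20 hr2] := gauge_nbhs dN Np (flow_tube F oO pO).
have near r : 0 < r -> germ d setT (fun s => f s != 0 -> forall y, y \in s -> d p y < r).
  by move=> r0; apply: germS (sf r r0) => s _ h nz y ys; have [_ -> ] := h nz y ys.
have [g1 g10 hg1] := near _ r10; have [g2 g20 hg2] := near _ r20.
pose e := Num.min q (Num.min g1 g2).
have e0 : 0 < e by rewrite !lt_min q0 g10.
pose H (z : M * R) := psi z.1 (- (b * z.2)).
have cH : continuous H.
  move=> z; have h : {for (z.1, - (b * z.2)), continuous (fun p : M * R => psi p.1 p.2)}.
    exact: (flow_continuous F).
  apply: (@cvg_comp _ _ _ (fun z : M * R => (z.1, - (b * z.2)))
    (fun p : M * R => psi p.1 p.2) _ (nbhs (z.1, - (b * z.2)))); last exact: h.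
  apply: (@cvg_pair _ _ _ (nbhs z) (nbhs z.1) (nbhs (- (b * z.2))) _ _ _ fst (fun z : M * R => - (b * z.2))).
    exact: cvg_fst.
  by apply: (@cvg_comp _ _ _ (fun z : M * R => b * z.2) -%R _ (nbhs (b * z.2)));
    [apply: cvgM; [exact: cvg_cst|exact: cvg_snd]|exact: opp_continuous].
have [r r0 hr] := gauge_uniform dN 0 1 cN (@subset_refl _ N) cH e0.
pose m := (Num.truncn r^-1).+1.
have m0 : 0 < m%:R :> R by rewrite ltr0n.
have mr : m%:R^-1 < r by rewrite invf_plt ?posrE// /m truncnS_gt.
pose g (i : nat) x := H (x, i%:R / m%:R).
have i01 i : (i <= m)%N -> 0 <= (i%:R / m%:R : R) <= 1.
  by move=> im; rewrite divr_ge0 ?ler0n//= ler_pdivrMr// mul1r ler_nat.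
have smallt i s t : (i < m)%N -> (forall x, x \in s -> N x) -> small d r s ->
    (forall y, y \in t -> exists2 x, x \in s & y = g i x \/ y = g i.+1 x) -> small d e t.
  move=> im sN ss ht y z /ht[x xs hy] /ht[x' xs' hz].
  have st (j j' : nat) : (j == i) || (j == i.+1) -> (j' == i) || (j' == i.+1) ->
      d (g j x) (g j' x') < e.
    move=> hj hj'; apply: hr; [exact: sN| |exact: ss|].
      by apply: i01; case/orP: hj => /eqP->; rewrite // ltnW.
    have E : i.+1%:R / m%:R = i%:R / m%:R + m%:R^-1 :> R by rewrite -natr1 mulrDl mul1r.
    have mi : 0 < m%:R^-1 :> R by rewrite invr_gt0.
    case/orP: hj => /eqP->; case/orP: hj' => /eqP->; rewrite ?E ltr_norml; apply/andP; split; lra.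
  by case: hy => ->; case: hz => ->; apply: st; rewrite eqxx ?orbT.
have eq_ : e <= q by rewrite ge_min lexx.
have e1_ : e <= g1 by rewrite !ge_min lexx orbT.
have e2_ : e <= g2 by rewrite !ge_min lexx !orbT.
exists (prisms g m f); split; first exact: hom_prisms.
- exists r => // s sN ss; have := prisms_homotopy g m f s.
  rewrite (_ : prisms g m (coboundary f) s = 0); last first.
    apply/eqP; apply: contraT => /prisms_neq0[i im /prism_neq0[t [ft _ ht _]]].
    rewrite df ?eqxx// in ft; apply: small_le eq_ _; exact: smallt ht.
  rewrite (_ : f (map (g m) s) = 0); last first.
    apply/eqP; apply: contraT => fm; case: s sN ss fm => [|x s] sN ss fm.
      by rewrite (hom_nil hf) eqxx in fm.
    exfalso; apply: (hr1 (g m x)).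
      apply: (hg1 (map (g m) (x :: s))) => //; last exact: mem_head.
      apply: small_le e1_ _; move=> y z /mapP[y' ys ->] /mapP[z' zs ->].
      by apply: hr; [exact: sN|exact: i01|exact: ss|rewrite subrr normr0].
    rewrite /g /H /= divff ?gt_eqF// mulr1 -(flowD F) addNr (flow0 F).
    by apply: sN; exact: mem_head.
  rewrite addr0 add0r => ->; congr f; rewrite -[RHS]map_id; apply: eq_map => x.
  by rewrite /g /H /= mul0r mulr0 oppr0 (flow0 F).
- exists r => // s sN ss /prisms_neq0[i im /prism_neq0[t [ft _ ht ts]]] x xs.
  (* [x] is recovered from [g j x] by flowing forwards, and orbits starting near [p] remain in [O]
     up to time [b]. *)
  have near_p j : (j <= m)%N -> g j x \in t -> O x.
    move=> jm jt; have /hr2/(_ (b * (j%:R / m%:R))) : d p (g j x) < r2.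
      by apply: (hg2 t) => //; apply: small_le e2_ _; exact: smallt ht.
    rewrite /g /H /= -(flowD F) addNr (flow0 F); apply.
    have /andP[j0 j1] := i01 j jm; rewrite mulr_ge0//= ler_piMr//.
  by case: (ts x xs); apply: near_p => //; exact: ltnW.
Qed.
End Push.

(** * Deformations and the restriction of cohomology classes *)

Section Deformation.
Context {R : realType} {M : topologicalType} {d : M -> M -> R} {G : set M} (dG : gauge d G).
Implicit Types (P K : set M).

(* The maps [g i] need not be continuous: the last one ends with a choice of
   nearby points of [K], and closeness of images at scale [r] replaces continuity. *)
Definition deforms P K := forall r : R, 0 < r -> exists q m (g : nat -> M -> M),
  [/\ 0 < q, (forall x, g 0%N x = x) /\ (forall x, P x -> K (g m x)),
    forall i x, P x -> P (g i x), forall i x, K x -> g i x = x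
  & forall i x y, P x -> P y -> d x y < q -> d (g i x) (g i y) < r /\ d (g i x) (g i.+1 y) < r].

(** The pullback along the last map is a cocycle, since that map takes small tuples of [P] to small
    tuples of [K]. *)
Lemma deforms_extend P K k f : deforms P K -> cocycle_on d K k f ->
  exists2 h, cocycle_on d P k h & germ d K (fun s => h s = f s).
Proof.
move=> PK [hf [r r0 df]]; have [q [m [g [q0 [g0 gm] gP gK gq]]]] := PK _ r0.
exists (fun s => f (map (g m) s)).
  split; first by move=> s sk; apply: hf; rewrite size_map.
  exists q => // s sP ss; rewrite coboundary_map; apply: df.
    by move=> _ /mapP[x /sP/gm Kx ->].
  move=> _ _ /mapP[x xs ->] /mapP[y ys ->].
  by apply: (gq m x y _ _ _).1; [exact: sP|exact: sP|exact: ss].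
exists 1 => // s sK _; congr f; rewrite -[RHS]map_id; apply/eq_in_map => x /sK; exact: gK.
Qed.

(** The prisms of the chain join [f] to its pullback along the last map, which lands in [K], where
    [f] has a primitive. *)
Lemma deforms_injective P K k f : deforms P K -> K `<=` P -> cocycle_on d P k f ->
  cohomologous d K k f (fun=> 0) -> cohomologous d P k f (fun=> 0).
Proof.
move=> PK KP [hf [r1 r10 df]] [e he [r2 r20 fe]].
pose r := Num.min r1 r2; have r0 : 0 < r by rewrite lt_min r10.
have rr1 : r <= r1 by rewrite ge_min lexx.
have rr2 : r <= r2 by rewrite ge_min lexx orbT.
have [q [m [g [q0 [g0 gm] gP gK gq]]]] := PK _ r0.
exists (fun s => prisms g m f s + e (map (g m) s)).
  apply: homD; first exact: hom_prisms.
  by move=> s sk; apply: he; rewrite size_map.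
exists (Num.min q r); first by rewrite lt_min q0.
move=> s sP ss; have ssq : small d q s by apply: small_le ss; rewrite ge_min lexx.
rewrite add0r coboundaryD coboundary_map; have := prisms_homotopy g m f s.
rewrite (_ : prisms g m (coboundary f) s = 0); last first.
  apply/eqP; apply: contraT => /prisms_neq0[i im /prism_neq0[t [ft _ ht _]]].
  rewrite df ?eqxx// in ft.
    by move=> y /ht[x xs [->|->]]; apply: gP; exact: sP.
  apply: small_le rr1 _ => y z /ht[x xs hy] /ht[x' xs' hz].
  have Px := sP _ xs; have Px' := sP _ xs'.
  case: hy => ->; case: hz => ->.
  - by case: (gq i x x') => //; exact: ssq.
  - by case: (gq i x x') => //; exact: ssq.
  - by rewrite (gauge_sym dG); case: (gq i x' x) => //; exact: ssq.
  - by case: (gq i.+1 x x') => //; exact: ssq.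
rewrite addr0 (_ : map (g 0%N) s = s); last by rewrite -[RHS]map_id; exact: eq_map.
move=> ->; have := fe (map (g m) s); rewrite add0r => <-.
- by rewrite addrAC addF2 add0r.
- by move=> _ /mapP[x /sP/gm Kx ->].
- apply: small_le rr2 _ => _ _ /mapP[x xs ->] /mapP[y ys ->].
  by apply: (gq m x y _ _ _).1; [exact: sP|exact: sP|exact: ssq].
Qed.
End Deformation.

Section FlowDeformation.
Context {R : realType} {M : topologicalType} (hM : hausdorff_space M).
Context {d : M -> M -> R} {N : set M} (dN : gauge d N) {K : set M} (K0 : K !=set0) (cK : compact K).

Context {phi : M -> R -> M} (F : is_flow phi) (iN : isolates phi N K).

Let KN : K `<=` N.
Proof. by move=> x Kx; apply: interior_subset; exact: (isolates_nbhd iN). Qed.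

Let clN : closed N. Proof. by apply: compact_closed => //; exact: (isolates_compact iN). Qed.

Section Slide.
Context (c : R).

(** The flow time is proportional to the distance to [K], so that points of [K] do not move. *)
Let slide (psi : M -> R -> M) (z : M * R) := psi z.1 (c * dist_to (d := d) K z.1 * z.2).

Let slide_continuous psi : is_flow psi -> continuous (slide psi).
Proof.
move=> F1 z; pose t := c * dist_to (d := d) K z.1 * z.2.
have h : {for (z.1, t), continuous (fun p : M * R => psi p.1 p.2)} by exact: (flow_continuous F1).
apply: (@cvg_comp _ _ _ (fun z : M * R => (z.1, c * dist_to (d := d) K z.1 * z.2))
  (fun p : M * R => psi p.1 p.2) _ (nbhs (z.1, t))); last exact: h.
apply: (@cvg_pair _ _ _ (nbhs z) (nbhs z.1) (nbhs t) _ _ _ fst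
  (fun z : M * R => c * dist_to (d := d) K z.1 * z.2)); first exact: cvg_fst.
apply: cvgM; last exact: cvg_snd.
apply: cvgM; first exact: cvg_cst.
apply: (@cvg_comp _ _ _ fst (dist_to (d := d) K) _ (nbhs z.1)); first exact: cvg_fst.
exact: (dist_to_continuous dN).
Qed.

Let slide_fix psi x s : is_flow psi -> K x -> slide psi (x, s) = x.
Proof. by move=> F1 Kx; rewrite /slide /= (dist_to0 dN K0 Kx) mulr0 mul0r (flow0 F1). Qed.

Let slide_stays psi x s : is_flow psi -> 0 <= c -> 0 <= s -> stays psi N x -> stays psi N (slide psi (x, s)).
Proof.
move=> F1 c0 s0 xN; apply: (stays_flow F1) => //.
by rewrite !mulr_ge0//; exact: (dist_to_ge0 dN K0).
Qed.

Let P := stays phi N `|` stays (reverse phi) N.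

(* On [K], where both formulas apply, they agree. *)
Definition retract_flow (x : M) (s : R) :=
  if `[<stays phi N x>] then slide phi (x, s) else slide (reverse phi) (x, s).

Let F' := reverse_flow F.

Lemma retract_flow_fix x s : K x -> retract_flow x s = x.
Proof. by move=> Kx; rewrite /retract_flow; case: ifP => _; exact: slide_fix. Qed.

Lemma retract_flow0 x : retract_flow x 0 = x.
Proof.
by rewrite /retract_flow /slide /= mulr0 (flow0 F) (flow0 F') if_same.
Qed.

Lemma retract_flow_stays x s : 0 <= c -> 0 <= s -> P x -> P (retract_flow x s).
Proof.
move=> c0 s0 Px; rewrite /retract_flow; case: ifP => [/asboolP|/asboolP nx].
  by move=> xN; left; exact: slide_stays.
by right; apply: slide_stays => //; case: Px.
Qed.

Let uniform psi (e : R) : is_flow psi -> 0 < e -> exists2 r : R, 0 < r &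
  forall x y s t, N x -> 0 <= s <= 1 -> d x y < r -> `|s - t| < r -> d (slide psi (x, s)) (slide psi (y, t)) < e.
Proof.
move=> F1 e0; apply: (gauge_uniform dN) => //; last exact: slide_continuous.
exact: (isolates_compact iN).
Qed.

Let PN : P `<=` N. Proof. by move=> x [/(stays_sub F)|/(stays_sub F')]. Qed.

Lemma retract_flow_time (e : R) : 0 < e -> exists2 r : R, 0 < r &
  forall x s t, P x -> 0 <= s <= 1 -> `|s - t| < r -> d (retract_flow x s) (retract_flow x t) < e.
Proof.
move=> e0; have [r r0 hr] := uniform F e0; have [r' r'0 hr'] := uniform F' e0.
exists (Num.min r r'); first by rewrite lt_min r0.
move=> x s t /PN Nx st; rewrite lt_min => /andP[h1 h2]; rewrite /retract_flow.
by case: ifP => _; [apply: hr|apply: hr']; rewrite // (gauge_xx dN).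
Qed.

(** The two formulas are continuous on two closed sets and agree on their intersection, which lies
    in [K]. The cases are those of a point in only one of these sets and of a point of [K]. *)
Lemma retract_flow_space (e : R) : 0 < e -> exists2 r : R, 0 < r &
  forall x y s, P x -> P y -> d x y < r -> 0 <= s <= 1 -> d (retract_flow x s) (retract_flow y s) < e.
Proof.
move=> e0; have e2 : 0 < e / 2 by rewrite divr_gt0.
have [r r0 hr] := uniform F e2; have [r' r'0 hr'] := uniform F' e2.
have cP : compact P.
  apply: (subclosed_compact _ (isolates_compact iN)) => //.
  by apply: closedU; [exact: (stays_closed F)|exact: (stays_closed F')].
have [x Px|q q0 hq] := lebesgue_number dN (P := fun x y => P x -> P y -> forall s, 0 <= s <= 1 ->
    d (retract_flow x s) (retract_flow y s) < e) cP PN; last first.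
  by exists q => // x y s Px Py xy s01; exact: hq.
suff [V xV hV] : exists2 V, nbhs x V & forall y, V y -> P y -> forall s, 0 <= s <= 1 ->
    d (retract_flow x s) (retract_flow y s) < e / 2.
  exists V => // y z Vy Vz Py Pz s s01; apply: le_lt_trans (gauge_tri dN _ (retract_flow x s) _) _.
  have := hV y Vy Py s s01; have := hV z Vz Pz s s01; rewrite (gauge_sym dN _ (retract_flow x s)); lra.
have Nx := PN Px; have n1 := gauge_ball dN x r0; have n2 := gauge_ball dN x r'0.
have near y s : 0 <= s <= 1 -> d x y < r -> d x y < r' ->
    d (slide phi (x, s)) (slide phi (y, s)) < e / 2 /\
    d (slide (reverse phi) (x, s)) (slide (reverse phi) (y, s)) < e / 2.
  by move=> s01 h1 h2; split; [apply: hr|apply: hr'] => //; rewrite subrr normr0.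
have [xp|nxp] := pselect (stays phi N x); last first.
  have n3 : nbhs x (~` stays phi N).
    by apply: open_nbhs_nbhs; split=> //; apply: closed_openC; exact: (stays_closed F).
  exists ([set y | d x y < r] `&` [set y | d x y < r'] `&` ~` stays phi N).
    by apply: filterI => //; exact: filterI.
  move=> y [[/= h1 h2] ny] _ s s01; rewrite /retract_flow !asboolF//.
  exact: (near y s s01 h1 h2).2.
have [xm|nxm] := pselect (stays (reverse phi) N x); last first.
  have n3 : nbhs x (~` stays (reverse phi) N).
    by apply: open_nbhs_nbhs; split=> //; apply: closed_openC; exact: (stays_closed F').
  exists ([set y | d x y < r] `&` [set y | d x y < r'] `&` ~` stays (reverse phi) N).
    by apply: filterI => //; exact: filterI.
  move=> y [[/= h1 h2] ny] [yp|//] s s01; rewrite /retract_flow !asboolT//.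
  exact: (near y s s01 h1 h2).1.
have Kx : K x by apply: (stays_both F iN).
exists ([set y | d x y < r] `&` [set y | d x y < r']); first exact: filterI.
move=> y [/= h1 h2] Py s s01; rewrite retract_flow_fix//.
have [] := near y s s01 h1 h2; rewrite !(slide_fix (x := x))// => m1 m2.
by rewrite /retract_flow; case: ifP.
Qed.
End Slide.

Lemma retract_flow_end (e : R) : 0 < e -> exists2 c, 0 <= c &
  forall x, (stays phi N `|` stays (reverse phi) N) x -> near_set d e K (retract_flow c x 1).
Proof.
move=> e0; have oO := near_set_open dN e K; have KO := sub_near_set dN (D := K) e0.
have [T T0 hT] := leave_time F hM iN oO KO.
have [T' T'0 hT'] := leave_time (reverse_flow F) hM (isolates_reverse iN) oO KO.
pose T2 := Num.max T T'; have T20 : 0 <= T2 by rewrite le_max T0.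
have [||r r0 hr] := near_set_sub dN cK KN
    (U := [set y | forall t, - T2 <= t <= T2 -> near_set d e K (phi y t)]°).
- exact: open_interior.
- move=> x Kx; apply: (flow_tube F) => // t _; apply: KO.
  exact: (isolates_invariant iN).
(* With this speed points at distance at least [r] flow for time at least [T2] and are attracted,
   while nearer ones flow for at most [T2] and remain close to [K]. *)
exists (T2 / r); first by rewrite divr_ge0 // ltW.
move=> x Px; rewrite /retract_flow /= !mulr1.
set u := dist_to K x; have u0 : 0 <= u by exact: (dist_to_ge0 dN K0).
have [ru|ur] := leP r u.
  have Tu : T2 <= T2 / r * u by rewrite -mulrA ler_peMr// mulrC ler_pdivlMr// mul1r.
  case: ifP => /asboolP xN.
    by apply: (attract F hT) => //; apply: le_trans Tu; rewrite le_max lexx.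
  case: Px => // xm; apply: (attract (reverse_flow F) hT') => //.
  by apply: le_trans Tu; rewrite le_max lexx orbT.
have /hr/interior_subset /= hx : near_set d r K x by exact: (dist_to_lt dN K0).
have Tu0 : 0 <= T2 / r * u by rewrite mulr_ge0// divr_ge0// ltW.
have Tu : T2 / r * u <= T2 by rewrite -mulrA ler_piMr// mulrC ler_pdivrMr// mul1r ltW.
by case: ifP => _; apply: hx; rewrite ?lerN2 ?Tu ?andbT//; lra.
Qed.

Lemma flow_deforms : deforms (d := d) (stays phi N `|` stays (reverse phi) N) K.
Proof.
(* In the final stage three errors below [r / 4] add up: two jumps into [K] and the distance of the
   points flowed. *)
set P := stays phi N `|` _ => r r0; have r4 : 0 < r / 4 by rewrite divr_gt0.
have [c c0 hc] := retract_flow_end r4.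
have [q1 q10 hq1] := retract_flow_space c r4.
have [q2 q20 hq2] := retract_flow_time c r4.
have [k0 Kk0] := K0.
pose rho x := if `[<K x>] then x else xget k0 [set k | K k /\ d k x < r / 4].
have rhoK x : K (rho x).
  by rewrite /rho; case: ifP => [/asboolP//|_]; case: xgetP => // y _ [].
have rho_id x : K x -> rho x = x by move=> Kx; rewrite /rho asboolT.
have rho_near x : near_set d (r / 4) K x -> d x (rho x) < r / 4.
  move=> [k Kk kx]; rewrite /rho; case: ifP => _; first by rewrite (gauge_xx dN).
  by rewrite (gauge_sym dN); case: xgetP => [y _ [_ //]|/(_ k)]; case.
pose m := (Num.truncn q2^-1).+1.
have m0 : 0 < m%:R :> R by rewrite ltr0n.
have mr : m%:R^-1 < q2 by rewrite invf_plt ?posrE// /m truncnS_gt.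
pose g (i : nat) x := if (i <= m)%N then retract_flow c x (i%:R / m%:R) else rho (retract_flow c x 1).
have i01 i : (i <= m)%N -> 0 <= (i%:R / m%:R : R) <= 1.
  by move=> im; rewrite divr_ge0 ?ler0n//= ler_pdivrMr// mul1r ler_nat.
have KP : K `<=` P by move=> x Kx; left; exact: (sub_stays iN).
have gm x : g m x = retract_flow c x 1 by rewrite /g leqnn divff// gt_eqF.
exists q1, m.+1, g; split=> //.
- by split=> x; rewrite /g ?ltnn//= mul0r retract_flow0.
- move=> i x Px; rewrite /g; case: ifP => [im|_]; last exact/KP/rhoK.
  by apply: retract_flow_stays => //; case/andP: (i01 i im).
- by move=> i x Kx; rewrite /g !retract_flow_fix// rho_id// if_same.
have end_near x : P x -> d (retract_flow c x 1) (rho (retract_flow c x 1)) < r / 4.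
  by move=> Px; apply: rho_near; exact: hc.
move=> i x y Px Py xy; rewrite /g; case: ifP => im.
  have h1 := hq1 x y _ Px Py xy (i01 i im); split; first by lra.
  have [im'|] := ltnP i m.
    have h2 : d (retract_flow c y (i%:R / m%:R)) (retract_flow c y (i.+1%:R / m%:R)) < r / 4.
      apply: hq2 => //; first exact: i01.
      by rewrite -natr1 mulrDl mul1r opprD addrA subrr add0r normrN ger0_norm// invr_ge0 ltW.
    have := gauge_tri dN (retract_flow c x (i%:R / m%:R)) (retract_flow c y (i%:R / m%:R))
      (retract_flow c y (i.+1%:R / m%:R)); lra.
  move=> mi; have mE : i = m by apply/eqP; rewrite eqn_leq im.
  move: h1; rewrite mE divff ?gt_eqF// => h1.
  have := gauge_tri dN (retract_flow c x 1) (retract_flow c y 1) (rho (retract_flow c y 1)).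
  have := end_near y Py; lra.
rewrite ifF; last by apply/negbTE; rewrite -ltnNge; apply: leqW; rewrite ltnNge im.
have h1 := hq1 x y 1 Px Py xy; rewrite ler01 lexx in h1; have {}h1 := h1 isT.
set a := retract_flow c x 1 in h1 *; set b := retract_flow c y 1 in h1 *.
have hx : d a (rho a) < r / 4 := end_near x Px; have hy : d b (rho b) < r / 4 := end_near y Py.
suff : d (rho a) (rho b) < r by split.
apply: le_lt_trans (gauge_tri dN _ a _) _; have := gauge_tri dN a b (rho b).
rewrite (gauge_sym dN (rho a)); lra.
Qed.
End FlowDeformation.

Lemma gauge_subset {R : realType} {M : topologicalType} (d : M -> M -> R) (G N : set M) :
  N `<=` G -> gauge d G -> gauge d N.
Proof. by move=> NG [h1 h2 h3 h4 h5]; split=> // x V /NG; exact: h5. Qed.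

(** * The two implications *)

Section Transverse.
Context {R : realType} {n : nat} {M : topologicalType} {d : M -> M -> R} {N : set M} (dN : gauge d N).
Context (lc : loc_compact M) (hM : hausdorff_space M) (cN : compact N).
Implicit Types (C D U : set M).

Lemma near_set_separate C D : compact C -> compact D -> D `<=` N -> C `&` D = set0 ->
  exists2 r, 0 < r & near_set d r C `&` near_set d r D = set0.
Proof.
move=> cC cD DN CD; have [||r r0 hr] := near_set_sub dN cD DN (U := ~` C).
- by apply: closed_openC; exact: compact_closed.
- by move=> x Dx Cx; have : (C `&` D) x by []; rewrite CD.
exists (r / 2); first by rewrite divr_gt0.
rewrite -subset0 => y [[c Cc cy] [x Dx xy]]; apply: (hr c) => //; exists x => //.
apply: le_lt_trans (gauge_tri dN x y c) _; rewrite (gauge_sym dN y c); lra.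
Qed.

(* Cutting off [e] near the exit set turns [a] into a cochain with compact
   support in the interior of [N], so the point class would be a boundary. *)
Lemma point_class_not_split (Ni No O O' B : set M) h p f a a' e (r : R) :
  frontier N = Ni `|` No -> compact Ni -> compact No -> Ni `&` No = set0 ->
  (forall x, N° x -> exists C (k : M -> 'rV[R]_n), [/\ convex_chart (G := N) C k, C x & C `<=` N°]) ->
  convex_chart (G := N) B h -> B p -> B `<=` N° -> point_class d (n := n) B h p f ->
  hom n a -> germ d N (fun s => coboundary a s = f s) ->
  germ d N (fun s => a s != 0 -> forall x, x \in s -> O x) ->
  germ d N (fun s => a' s != 0 -> forall x, x \in s -> O' x) ->
  0 < r -> O `&` near_set d r Ni = set0 -> O' `&` near_set d r No = set0 ->
  e [::] = 0 -> (forall th, hom n (coboundary (cut th e))) ->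
  germ d N (fun s => a s + a' s = coboundary e s) -> False.
Proof.
move=> fN cNi cNo Nio charts cB Bp BN pf ha da aO aO' r0 ONi ONo e0 he ae.
have clN : closed N by exact: compact_closed.
have fNN : Ni `|` No `<=` N by rewrite -fN => x /(frontierP _ clN)[].
have [q1 q10 q1N] := near_set_separate cNi cNo (fun x h => fNN x (or_intror h)) Nio.
pose q := Num.min r q1; have q0 : 0 < q by rewrite lt_min r0.
have q2 : 0 < q / 2 by rewrite divr_gt0.
have nr S : near_set d q S `<=` near_set d r S by apply: near_setS => //; rewrite ge_min lexx.
have nq S : near_set d q S `<=` near_set d q1 S by apply: near_setS => //; rewrite ge_min lexx orbT.
pose th y := `[< near_set d q No y >].
(* On small tuples near [No] the cutoff is 1 and [eta] equals [a'], which vanishes there; near [Ni]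
   the cutoff is 0 and [eta] equals [a], which vanishes there. *)
pose eta s := a s + coboundary (cut th e) s.
have heta : hom n eta by apply: homD.
have coNi : compact (frontier N) by rewrite fN; exact: compactU.
have frontierN : frontier N `<=` N by rewrite fN.
have eta_off : germ d N (fun s => eta s != 0 -> forall y, y \in s -> ~ near_set d (q / 2) (frontier N) y).
  apply: germS (germI (germ_small d N q2) (germI aO (germI aO' ae))) => s _ [ss [sO [sO' se]]] nz y ys.
  move=> [z fz zy]; move/negP: nz; apply; apply/eqP.
  have zs y' : y' \in s -> d z y' < q.
    by move=> y's; apply: le_lt_trans (gauge_tri dN z y y') _; have := ss y y' ys y's; lra.
  move: fz; rewrite fN => -[iz|oz]; rewrite /eta.
    have iy y' : y' \in s -> near_set d q Ni y' by move=> /zs zy'; exists z.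
    rewrite (_ : a s = 0) ?add0r; last first.
      apply/eqP; apply: contraT => /sO/(_ y ys) Oy.
      have : (O `&` near_set d r Ni) y by split=> //; apply: nr; exact: iy.
      by rewrite ONi.
    rewrite (coboundary_eq_faces (g := fun=> 0)) ?coboundary0// => i _.
    case E: (_ ++ _) => [//|y' t] /=; rewrite ifF//; apply/negbTE/asboolPn => oy'.
    have ys' : y' \in s by apply: (@mem_face _ i); rewrite E mem_head.
    have : (near_set d q1 Ni `&` near_set d q1 No) y' by split; apply: nq => //; exact: iy.
    by rewrite q1N.
  have oy y' : y' \in s -> near_set d q No y' by move=> /zs zy'; exists z.
  rewrite (coboundary_eq_faces (g := e)) => [|i _].
    rewrite -se addrA addF2 add0r; apply/eqP; apply: contraT => /sO'/(_ y ys) Oy.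
    have : (O' `&` near_set d r No) y by split=> //; apply: nr; exact: oy.
    by rewrite ONo.
  case E: (_ ++ _) => [|y' t] /=; first by rewrite e0.
  rewrite ifT//; apply/asboolP/oy; apply: (@mem_face _ i); by rewrite E mem_head.
pose D := N `\` near_set d (q / 2) (frontier N).
have cD : compact D.
  apply: (subclosed_compact _ cN); last by move=> x [].
  by apply: closedI => //; apply: open_closedC; exact: (near_set_open dN).
have DN : D `<=` N°.
  move=> x [Nx nx]; apply: contrapT => nNx; apply: nx; apply: (sub_near_set dN) => //.
  exact/(frontierP _ clN).
(* [eta] is controlled on tuples of [N] only; discarding all tuples outside [D] gives a cochain on
   [M] with compact support. *)
pose eta' s := if `[< forall y, y \in s -> D y >] then eta s else 0.
have heta' : hom n eta' by move=> s /heta; rewrite /eta'; case: ifP.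
have eta'0 s y : y \in s -> ~ D y -> eta' s = 0.
  by move=> ys nDy; rewrite /eta' asboolF// => sD; apply: nDy; exact: sD.
have etaE : germ d N (fun s => eta' s = eta s).
  apply: germS (germI (germ_mem d N) eta_off) => s _ [sN off].
  rewrite /eta'; case: ifPn => // /asboolPn nD; apply/esym/eqP; apply: contraT => /off off'.
  by exfalso; apply: nD => y ys; split; [exact: sN|exact: off'].
have [k1 k10 hk1] := near_set_sub dN cD (fun x h => (interior_subset (DN x h))) (open_interior N) DN.
have Np : N° p := BN p Bp.
have [k2 k20 hk2] := gauge_nbhs dN (interior_subset Np) (Np : nbhs p N).
have [hf sf cf] := pf.
have k22 : 0 < k2 / 2 by rewrite divr_gt0.
apply: (point_class_not_boundary dN lc hM charts cB Bp BN pf heta').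
  exists D; split=> // k k0; apply: germW => s nz x xs; apply: (sub_near_set dN) => //.
  by apply: contrapT => nD; move: nz; rewrite (eta'0 s x)// eqxx.
have [k3 k30 hk3] : germ d N (fun s => coboundary eta' s = f s).
  apply: germS (germI da (germ_coboundary etaE)) => s _ [<- ->].
  by rewrite coboundaryD coboundaryK addr0.
apply: germS (germI (germ_small d setT k30) (germI (sf _ k22)
  (germI (germ_small d setT k10) (germ_small d setT k22)))) => s _ [s3 [fs [s1 s2]]].
(* A small tuple not contained in [N] is close neither to [p] nor to [D], so both sides vanish on
   it. *)
have [sN|nsN] := pselect (forall x, x \in s -> N x); first by rewrite hk3.
rewrite [LHS](_ : _ = 0); last first.
  apply/eqP; apply: contraT => fs0; exfalso; apply: nsN => x xs; apply: hk2.
  by have [_ -> px] := fs fs0 x xs; lra.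
apply/esym/eqP; apply: contraT => /(coboundary_neq0 (hom_nil heta'))[[|y t] [t0 // _ ts _]].
exfalso; apply: nsN => x xs; apply: interior_subset; apply: hk1; exists y.
  by apply: contrapT => nDy; rewrite (eta'0 _ y (mem_head _ _) nDy) eqxx in t0.
by apply: s1 => //; apply: ts; exact: mem_head.
Qed.
End Transverse.

Section Family.
Context {R : realType} {M : topologicalType} (hM : hausdorff_space M) (lc : loc_compact M).
Context (hG : forall N : set M, compact N -> exists d : M -> M -> R, gauge d N).
Context {psi : R -> M -> R -> M} (F : forall l, is_flow (psi l)).
Context (psi_cont : continuous (fun q : M * R * R => psi q.2 q.1.1 q.1.2)).
Context {K : R -> set M} (K0_nonempty : K 0 !=set0) (K0_compact : compact (K 0)).
Context (K0_non_saddle : non_saddle (psi 0) (K 0)).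
Context {delta : R} (delta_gt0 : 0 < delta).
Context (K_nonempty : forall l, 0 < l < delta -> K l !=set0).
Context (K_compact : forall l, 0 < l < delta -> compact (K l)).
Context (K_cont : forall N, isolates (psi 0) N (K 0) ->
  exists2 e, 0 < e & forall l, 0 < l < e -> isolates (psi l) N (K l)).

Lemma block_passes N N' Ni No : closed N -> closed N' -> N' `<=` N° -> frontier N = Ni `|` No ->
  compact Ni -> compact No ->
  (forall x, Ni x -> exists2 e : R, 0 < e & forall t, - e <= t < 0 -> ~ N (psi 0 x t)) ->
  (forall x, No x -> exists2 e : R, 0 < e & forall t, 0 < t <= e -> ~ N (psi 0 x t)) ->
  exists2 e, 0 < e & forall l, 0 < l < e ->
    passes (reverse (psi l)) N N' Ni /\ passes (psi l) N N' No.
Proof.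
move=> clN clN' NN fN cNi cNo hi ho.
have rev_cont : continuous (fun q : M * R * R => reverse (psi q.2) q.1.1 q.1.2).
  move=> q; have h : {for (q.1.1, - q.1.2, q.2), continuous (fun q : M * R * R => psi q.2 q.1.1 q.1.2)}.
    exact: psi_cont.
  apply: (@cvg_comp _ _ _ (fun q : M * R * R => (q.1.1, - q.1.2, q.2))
    (fun q : M * R * R => psi q.2 q.1.1 q.1.2) _ (nbhs (q.1.1, - q.1.2, q.2))); last exact: h.
  apply: (@cvg_pair _ _ _ (nbhs q) (nbhs (q.1.1, - q.1.2)) (nbhs q.2) _ _ _
    (fun q : M * R * R => (q.1.1, - q.1.2)) snd); last exact: cvg_snd.
  apply: (@cvg_pair _ _ _ (nbhs q) (nbhs q.1.1) (nbhs (- q.1.2)) _ _ _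
    (fun q : M * R * R => q.1.1) (fun q => - q.1.2)).
    by apply: (@cvg_comp _ _ _ fst fst _ (nbhs q.1)); exact: cvg_fst.
  apply: (@cvg_comp _ _ _ (fun q : M * R * R => q.1.2) -%R _ (nbhs q.1.2)); last exact: opp_continuous.
  by apply: (@cvg_comp _ _ _ fst snd _ (nbhs q.1)); [exact: cvg_fst|exact: cvg_snd].
have [e e0 he] : exists2 e, 0 < e & forall l, `|l| < e -> passes (psi l) N N' No.
  apply: passes_stable => //; apply: (exits_pass (F 0)) => //; rewrite fN; exact: subsetUr.
have [e' e'0 he'] : exists2 e, 0 < e & forall l, `|l| < e -> passes (reverse (psi l)) N N' Ni.
  apply: (passes_stable rev_cont) => //; apply: (exits_pass (reverse_flow (F 0))) => //.
    by rewrite fN; exact: subsetUl.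
  move=> x /hi[u u0 hu]; exists u => // t /andP[t0 tu]; apply: hu; lra.
exists (Num.min e e'); first by rewrite lt_min e0.
by move=> l /andP[l0]; rewrite lt_min => /andP[h1 h2]; split; [apply: he'|apply: he]; rewrite ger0_norm ?ltW.
Qed.

Lemma continuation_iso N0 : isolates (psi 0) N0 (K 0) -> connected (K 0) ->
  (exists2 e, 0 < e & forall l, 0 < l < e -> non_saddle (psi l) (K l)) ->
  exists N, [/\ connected N, isolating_block (psi 0) N (K 0)
    & exists2 e, 0 < e & forall l, 0 < l < e -> isolates (psi l) N (K l) /\
        exists KN : K l `<=` N, inclusion_cech_iso KN 'F_2].
Proof.
move=> iN0 cK [e1 e10 ns].
have block U : open U -> K 0 `<=` U -> exists N, [/\ isolating_block (psi 0) N (K 0), N `<=` U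
    & N `<=` stays (psi 0) N `|` stays (reverse (psi 0)) N].
  by move=> oU KU; exact: (block_exists hM lc hG (F 0) iN0).
have [N2 [b2 _ _]] := block setT openT (@subsetT _ _); have i2 := block_isolates b2.
have [N [b N_N2 NP]] := block _ (open_interior N2) (isolates_nbhd i2); have i := block_isolates b.
have [N1 [b1 N1_N NP1]] := block _ (open_interior N) (isolates_nbhd i); have i1 := block_isolates b1.
have cN2 := isolates_compact i2; have cN := isolates_compact i; have cN1 := isolates_compact i1.
have clN2 : closed N2 by exact: compact_closed.
have clN : closed N by exact: compact_closed.
have clN1 : closed N1 by exact: compact_closed.
have coN := stays_connected hM (F 0) i cK K0_nonempty NP.
have coN1 := stays_connected hM (F 0) i1 cK K0_nonempty NP1.
exists N; split=> //.
have pass A A' : isolating_block (psi 0) A (K 0) -> closed A -> closed A' -> A' `<=` A° -> connected A' ->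
    isolates (psi 0) A' (K 0) ->
    exists2 e, 0 < e & forall l, 0 < l < e -> K l `<=` A' /\ A' `<=` stays (psi l) A `|` stays (reverse (psi l)) A.
  move=> bA clA clA' AA coA' iA'; have [iA [Ni [No [[cNi cNo fA] [hi ho _ _]]]]] := bA.
  have [u u0 hu] := block_passes clA clA' AA fA cNi cNo hi ho.
  have [v v0 hv] := K_cont iA; have [v' v'0 hv'] := K_cont iA'.
  exists (Num.min delta (Num.min e1 (Num.min u (Num.min v v')))).
    by rewrite !lt_min delta_gt0 e10 u0 v0.
  move=> l /andP[l0]; rewrite !lt_min => /and5P[ld le1 lu lv lv'].
  have [pi po] := hu l (introT andP (conj l0 lu)).
  have KA' : K l `<=` A'.
    move=> x Kx; apply: interior_subset; apply: (isolates_nbhd (hv' l _)) => //; exact/andP.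
  split=> //; apply: (passes_stays hM (F l) clA fA pi po AA coA' (hv l _) KA').
  - by apply/andP.
  - by apply: K_nonempty; apply/andP.
  - by apply: ns; apply/andP.
have [u u0 hu] := pass _ _ b2 clN2 clN N_N2 coN i.
have [v v0 hv] := pass _ _ b clN clN1 N1_N coN1 i1.
have [w w0 hw] := K_cont i; have [w' w'0 hw'] := K_cont i2.
exists (Num.min delta (Num.min u (Num.min v (Num.min w w')))).
  by rewrite !lt_min delta_gt0 u0 v0 w0.
move=> l /andP[l0]; rewrite !lt_min => /and5P[ld lu lv lw lw'].
have [KN NP2] := hu l (introT andP (conj l0 lu)).
have [KN1 N1P] := hv l (introT andP (conj l0 lv)).
have il := hw l (introT andP (conj l0 lw)); have il2 := hw' l (introT andP (conj l0 lw')).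
have neK := K_nonempty (introT andP (conj l0 ld)); have cKl := K_compact (introT andP (conj l0 ld)).
split=> //; exists KN.
have [d dN2] := hG cN2; have NN2 : N `<=` N2 by move=> x /N_N2/interior_subset.
have dN : gauge d N by exact: gauge_subset dN2.
apply: (inclusion_iso_of_cocycles dN KN cKl cN (@subset_refl _ _) neK).
  (* Surjectivity: a cocycle of [K l] extends to the points staying in [N2] in one direction, and
     these include all of [N]. *)
  move=> k g cg; have [h [hh dh] hg] := deforms_extend (flow_deforms hM dN2 neK cKl (F l) il2) cg.
  exists h; first by split=> //; exact: germ_subset dh.
  exists (fun=> 0); first exact: hom_zero.
  by apply: germS hg => s _ ->; rewrite coboundary0 addr0.
move=> k f [hf df] f0.
have PN : stays (psi l) N `|` stays (reverse (psi l)) N `<=` N.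
  by move=> x [/(stays_sub (F l))|/(stays_sub (reverse_flow (F l)))].
(* Injectivity: a class vanishing on [K l] vanishes on the points staying in [N], hence on [K 0]
   inside [N1], and so on [N], which deforms into [K 0] under [psi 0]. *)
have [e he fe] : cohomologous d (stays (psi l) N `|` stays (reverse (psi l)) N) k f (fun=> 0).
  apply: (deforms_injective dN (flow_deforms hM dN neK cKl (F l) il)) => //.
    by move=> x /KN1/N1P.
  by split=> //; exact: germ_subset df.
have f0' : cohomologous d (K 0) k f (fun=> 0).
  exists e => //; apply: germ_subset fe => x Kx; apply: N1P.
  by apply: interior_subset; exact: (isolates_nbhd i1).
have NE : stays (psi 0) N `|` stays (reverse (psi 0)) N = N.
  apply/seteqP; split=> // x [/(stays_sub (F 0))|/(stays_sub (reverse_flow (F 0)))] //.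
have := deforms_injective dN (flow_deforms hM dN K0_nonempty K0_compact (F 0) i); rewrite NE.
apply=> //; by move=> x Kx; apply: interior_subset; exact: (isolates_nbhd i).
Qed.

Lemma iso_non_saddle n N : (forall x, N° x -> exists C (k : M -> 'rV[R]_n),
    [/\ convex_chart (G := N) C k, C x & C `<=` N°]) ->
  connected N -> isolating_block (psi 0) N (K 0) ->
  (exists2 e, 0 < e & forall l, 0 < l < e -> isolates (psi l) N (K l) /\
    exists KN : K l `<=` N, inclusion_cech_iso KN 'F_2) ->
  exists2 e, 0 < e & forall l, 0 < l < e -> non_saddle (psi l) (K l).
Proof.
move=> charts coN b [e1 e10 iso].
have [i [Ni [No [[cNi cNo fN] [hi ho _ _]]]]] := b.
have cN := isolates_compact i; have clN : closed N by exact: compact_closed.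
have NP := block_stays hM (F 0) b coN K0_nonempty K0_non_saddle.
have fNN : Ni `|` No `<=` N by rewrite -fN => x /(frontierP _ clN)[].
(* A point of both sets would leave [N] at once in both directions, but every point of [N] stays in
   one of them. *)
have Nio : Ni `&` No = set0.
  rewrite -subset0 => x [Nix Nox]; case: (NP x (fNN _ (or_introl Nix))) => xN.
    have [u u0 hu] := ho x Nox; apply: (hu u); first by rewrite u0 lexx.
    exact/xN/ltW.
  have [u u0 hu] := hi x Nix; apply: (hu (- u)); first by rewrite lexx oppr_lt0.
  exact/xN/ltW.
have [d dN] := hG cN.
have KN0 : K 0 `<=` N by move=> x Kx; apply: interior_subset; exact: (isolates_nbhd i).
(* Every point of this compact neighbourhood of [K 0] will be shown to stay in [N] in one direction;
   for small [l] it is also a neighbourhood of [K l]. *)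
have [N' [r0 [cN' N'N r00 rN']]] := near_set_compact dN lc K0_compact KN0 (open_interior N) (isolates_nbhd i).
have clN' : closed N' by exact: compact_closed.
have i' : isolates (psi 0) N' (K 0).
  apply: (isolates_sub i) => //; last by move=> x /N'N/interior_subset.
  move=> x Kx; apply: filterS rN' _; apply: open_nbhs_nbhs; split; first exact: (near_set_open dN).
  exact: (sub_near_set dN).
have [u u0 hu] := block_passes clN clN' N'N fN cNi cNo hi ho.
have [v v0 hv] := K_cont i'.
exists (Num.min delta (Num.min e1 (Num.min u v))); first by rewrite !lt_min delta_gt0 e10 u0.
move=> l /andP[l0]; rewrite !lt_min => /and4P[ld le1 lu lv].
have [pi po] := hu l (introT andP (conj l0 lu)).
have il' := hv l (introT andP (conj l0 lv)).
have [il [KN iK]] := iso l (introT andP (conj l0 le1)).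
have neK := K_nonempty (introT andP (conj l0 ld)); have cKl := K_compact (introT andP (conj l0 ld)).
apply: (stays_non_saddle hM (F l) il (isolates_nbhd il')) => x N'x; apply: contrapT => nx.
have Nx : N x by apply: interior_subset; exact: N'N.
(* The orbit of [x] leaves [N] along an open set that avoids both the wrong
   part of the frontier and [K l]. *)
have leave phi Q : is_flow phi -> passes (reverse phi) N N' Q -> compact Q -> Q `<=` N ->
    flow_invariant phi (K l) -> ~ stays phi N x ->
    exists O t r, [/\ open O, 0 <= t /\ ~ N (phi x t), forall s, 0 <= s <= t -> O (phi x s),
      O `&` K l = set0 & 0 < r /\ O `&` near_set d r Q = set0].
  move=> F1 pQ cQ QN iK1 nxN.
  have [t1 t10 nN] : exists2 t, 0 <= t & ~ N (phi x t).
    by apply: contrapT => h; apply: nxN => t t0; apply: contrapT => nN; apply: h; exists t.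
  have clQ : closed Q by exact: compact_closed.
  have [s [/andP[s0 st] sN _ nxt]] := first_exit F1 clN Nx t10 nN.
  have avoid a : 0 <= a <= s -> ~ Q (phi x a).
    move=> /andP[a0 as_]; apply: (passes_avoid F1 pQ) => // c /andP[c0 ca].
    by apply: sN; rewrite c0 (le_trans ca).
  have : nbhs s [set a | ~ Q (phi x a)].
    apply: (flow_nbhs_time F1 (A := ~` Q)); apply: open_nbhs_nbhs; split; first exact: closed_openC.
    by apply: avoid; rewrite s0 lexx.
  move=> /nbhs_ballP[c /= c0 hc]; have c2 : 0 < c / 2 by rewrite divr_gt0.
  (* The time [t] follows [s] so closely that the orbit has not yet reached [Q]. *)
  have [t /andP[st' tc] nNt] := nxt _ c2; have t0 : 0 <= t by apply: le_trans s0 (ltW st').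
  pose C := phi x @` `[0, t].
  have cC : compact C.
    apply: continuous_compact; last exact: segment_compact.
    by apply: continuous_subspaceT; exact: (flow_cont_time F1).
  have [|q q0 qCQ] := near_set_separate dN hM cC cQ QN.
    rewrite -subset0 => _ [[a /= /[!in_itv]/= /andP[a0 at_] <-]].
    have [as_|sa] := leP a s; first by apply: avoid; rewrite a0.
    by apply: hc; rewrite /ball /= ltr0_norm ?subr_lt0//; lra.
  exists (near_set d q C `&` ~` K l), t, q; split=> //.
  - apply: openI; first exact: (near_set_open dN).
    by apply: closed_openC; exact: compact_closed.
  - move=> a at_; split; first by apply: (sub_near_set dN) => //; exists a => //=; rewrite in_itv.
    move=> Ka; apply: nxN; have Kx : K l x.
      by have := iK1 _ (- a) Ka; rewrite -(flowD F1) subrr (flow0 F1).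
    move=> y _.
    exact/KN/iK1.
  - by rewrite -subset0 => y [[]].
  - by split=> //; rewrite -subset0 => y [[yC _] yQ]; rewrite -qCQ.
have iKl := isolates_invariant il.
have [W [t [r [oW [t0 nt] tW WK [r0' WNi]]]]] : exists O t r, [/\ open O, 0 <= t /\ ~ N (psi l x t),
    forall s, 0 <= s <= t -> O (psi l x s), O `&` K l = set0 & 0 < r /\ O `&` near_set d r Ni = set0].
  by apply: leave => // [y h|h]; [apply: fNN; left|apply: nx; left].
have [W' [t' [r' [oW' [t'0 nt'] tW' WK' [r'0 WNo]]]]] : exists O t r, [/\ open O,
    0 <= t /\ ~ N (reverse (psi l) x t), forall s, 0 <= s <= t -> O (reverse (psi l) x s),
    O `&` K l = set0 & 0 < r /\ O `&` near_set d r No = set0].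
  apply: leave => //; [exact: reverse_flow|by rewrite reverseK|by move=> y h; apply: fNN; right| |].
    exact: flow_invariant_reverse.
  by move=> h; apply: nx; right.
have [B [h [cB Bx BN]]] := charts x (N'N x N'x).
have [B' [h' [H BG _]]] := cB.
have [f pf] := point_class_exists dN lc H BG Bx.
have df := point_class_cocycle dN H BG Bx pf; have [hf sf _] := pf.
have [a [ha da aW]] := push_cochain dN cN (F l) Nx t0 clN nt oW tW hf sf df.
have [a' [ha' da' aW']] := push_cochain dN cN (reverse_flow (F l)) Nx t'0 clN nt' oW' tW' hf sf df.
have [e [en he ae]] : exists e, [/\ e [::] = 0, forall th, hom n (coboundary (cut th e))
    & germ d N (fun s => a s + a' s = coboundary e s)].
  have dal : germ d N (fun s => coboundary (fun s => a s + a' s) s = 0).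
    by apply: germS (germI da da') => s _ [h1 h2]; rewrite coboundaryD h1 h2 addF2.
  have off g A : hom n g -> germ d N (fun s => g s != 0 -> forall x, x \in s -> A x) -> A `&` K l = set0 ->
      germ d (K l) (fun s => g s = 0).
    move=> hg gA AK; apply: germS (germI (germ_mem d (K l)) (germ_subset KN gA)) => -[|y s] _ [sK sA].
      exact: (hom_nil hg).
    apply/eqP; apply: contraT => /sA/(_ y (mem_head _ _)) Ay.
    have : (A `&` K l) y by split=> //; apply: sK; exact: mem_head.
    by rewrite AK.
  have al0 : germ d (K l) (fun s => a s + a' s = 0).
    by apply: germS (germI (off _ _ ha aW WK) (off _ _ ha' aW' WK')) => s _ [-> ->]; rewrite addr0.
  (* In dimension zero [a] and [a'] vanish by [hom 0] and the zero primitive serves; the hypothesis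
     on cohomology would concern degree [- 1]. *)
  case: n ha ha' {off hf pf f sf df h h' B' H BG da da' charts cB} => [|k] ha ha'.
    exists (fun=> 0); split=> // [th s _|]; last first.
      by apply: germW => s; rewrite (hom0 ha) (hom0 ha') coboundary0 addr0.
    apply: big1 => j _; rewrite (_ : cut _ _ _ = 0) ?mulr0//.
    by case: (_ ++ _) => //= y s'; rewrite if_same.
  have [e he ae] := cocycles_of_inclusion_iso dN cKl cN (@subset_refl _ _) neK iK
    (conj (homD ha ha') dal) (ex_intro2 _ _ (fun=> 0) (@hom_zero _ _)
      (germS (fun s _ h => etrans h (esym (etrans (add0r _) (coboundary0 s)))) al0)).
  exists e; split; first exact: (hom_nil he).
    by move=> th; apply: hom_coboundary; exact: hom_cut.
  by apply: germS ae => s _ ->; rewrite add0r.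
have rr : 0 < Num.min r r' by rewrite lt_min r0'.
have near S : near_set d (Num.min r r') S `<=` near_set d r S.
  by apply: near_setS => //; rewrite ge_min lexx.
have near' S : near_set d (Num.min r r') S `<=` near_set d r' S.
  by apply: near_setS => //; rewrite ge_min lexx orbT.
apply: (point_class_not_split dN lc hM cN fN cNi cNo Nio charts cB Bx BN pf ha da aW aW' rr _ _ en he ae).
  by rewrite -subset0 => y [Wy /near Ny]; rewrite -WNi.
by rewrite -subset0 => y [Wy /near' Ny]; rewrite -WNo.
Qed.
End Family.

(** * Extension of the family to all real parameters *)

Section Clamp.
Context {R : realType}.

(** Truncation to the unit interval, written with absolute values so that continuity is
    immediate. *)
Definition clamp (l : R) : R := (`|l| - `|l - 1| + 1) / 2.

Lemma clamp_id l : 0 <= l <= 1 -> clamp l = l.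
Proof. by move=> /andP[l0 l1]; rewrite /clamp ger0_norm// ler0_norm ?subr_le0//; lra. Qed.

Lemma clamp01 l : 0 <= clamp l <= 1.
Proof.
rewrite /clamp; have [l0|l0] := leP 0 l; have [l1|l1] := leP 1 l.
- by rewrite (ger0_norm l0) ger0_norm ?subr_ge0//; lra.
- by rewrite (ger0_norm l0) ltr0_norm ?subr_lt0//; lra.
- by lra.
- by rewrite (ltr0_norm l0) ltr0_norm ?subr_lt0//; lra.
Qed.

Lemma clamp_continuous : continuous clamp.
Proof.
move=> l; apply: cvgM; last exact: cvg_cst.
apply: cvgD; last exact: cvg_cst.
apply: cvgB; first exact: (@norm_continuous R R^o l).
apply: (@cvg_norm R R^o); apply: cvgB; [exact: cvg_id|exact: cvg_cst].
Qed.

Lemma near_right0 (P : R -> Prop) :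
  (\forall l \near 0^'+, P l) <-> exists2 e : R, 0 < e & forall l, 0 < l < e -> P l.
Proof.
split=> [[e /= e0 he]|[e e0 he]].
  exists e => // l /andP[l0 le]; apply: he => //=.
  by rewrite sub0r normrN gtr0_norm.
exists e => // l /=; rewrite sub0r normrN => le l0; apply: he; rewrite l0 /=.
by rewrite gtr0_norm in le.
Qed.
End Clamp.

Theorem theorem4p5 (R : realType) (n : nat) (M : topologicalType)
    (A : set (chart R n M)) (M_manifold : smooth_manifold A)
    (M_connected : connected [set: M])
    (phi : R -> M -> R -> M) (phi_diff : differentiable_family A phi)
    (delta : R) (delta_gt0 : 0 < delta) (K : R -> set M)
    (K0_connected : connected (K 0))
    (K0_isolated : isolated_invariant (phi 0) (K 0))
    (K0_non_saddle : non_saddle (phi 0) (K 0))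
    (K_continuation : is_continuation phi 0 delta K) :
  (\forall l \near (0 : R)^'+, non_saddle (phi l) (K l)) <->
  (exists N : set M,
    [/\ connected N, isolating_block (phi 0) N (K 0)
      & \forall l \near (0 : R)^'+,
          isolates (phi l) N (K l) /\
          exists KN : K l `<=` N, inclusion_cech_iso KN 'F_2]).
Proof.
have hM := manifold_hausdorff M_manifold; have lc := manifold_loc_compact M_manifold.
have hG := manifold_gauge M_manifold.
pose psi l := phi (clamp l).
have F l : is_flow (psi l) by apply: (family_flow phi_diff); exact: clamp01.
have psi_cont : continuous (fun q : M * R * R => psi q.2 q.1.1 q.1.2).
  have /subspace_continuousP cphi := family_continuous phi_diff.
  move=> q V Vq; have Vc := cphi (q.1, clamp q.2) (clamp01 _) V Vq.
  have gc : (fun z : M * R * R => (z.1, clamp z.2)) @ q --> nbhs (q.1, clamp q.2).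
    apply: (@cvg_pair _ _ _ (nbhs q) (nbhs q.1) (nbhs (clamp q.2)) _ _ _ fst (fun z : M * R * R => clamp z.2)).
      exact: cvg_fst.
    by apply: (@cvg_comp _ _ _ snd clamp _ (nbhs q.2)); [exact: cvg_snd|exact: clamp_continuous].
  have n1 : nbhs q _ := gc _ Vc; apply: filterS n1 => z /= h; apply: h; exact: clamp01.
have [_ _ d1 Kiso Kcont] := K_continuation.
have psiE l : 0 <= l <= 1 -> psi l = phi l by move=> l01; rewrite /psi clamp_id.
have psi0 : psi 0 = phi 0 by apply: psiE; rewrite lexx ler01.
have [K0n _ K0c _ [N0 iN0]] := K0_isolated.
have psi_small l : 0 < l < delta -> psi l = phi l.
  by move=> /andP[l0 ld]; apply: psiE; rewrite (ltW l0) (le_trans (ltW ld)).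
have K_iso l : 0 < l < delta -> isolated_invariant (phi l) (K l).
  by move=> /andP[l0 ld]; apply: Kiso; rewrite !ltW.
have K_n l : 0 < l < delta -> K l !=set0 by move=> /K_iso[].
have K_c l : 0 < l < delta -> compact (K l) by move=> /K_iso[].
have K_cont N : isolates (psi 0) N (K 0) ->
    exists2 e, 0 < e & forall l, 0 < l < e -> isolates (psi l) N (K l).
  rewrite psi0 => iN; have [|e e0 he] := Kcont 0 _ N iN; first by rewrite lexx ltW.
  exists (Num.min e delta); first by rewrite lt_min e0.
  move=> l /andP[l0]; rewrite lt_min => /andP[le ld]; rewrite psi_small ?l0//.
  by apply: he; rewrite ?(ltW l0) ?(ltW ld)// sub0r add0r le andbT (lt_trans _ l0)// oppr_lt0.
have transfer (P P' : R -> Prop) : (forall l, 0 < l < delta -> P l -> P' l) ->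
    (exists2 e, 0 < e & forall l, 0 < l < e -> P l) -> exists2 e, 0 < e & forall l, 0 < l < e -> P' l.
  move=> PP [e e0 he]; exists (Num.min e delta); first by rewrite lt_min e0.
  move=> l /andP[l0]; rewrite lt_min => /andP[le ld]; apply: PP; rewrite ?l0//.
  by apply: he; rewrite l0.
rewrite -psi0 in K0_non_saddle iN0 *; split.
  move=> /near_right0 ns.
  have [|N [coN bN iN]] := continuation_iso hM lc hG F psi_cont K0n K0c K0_non_saddle delta_gt0
      K_n K_c K_cont iN0 K0_connected.
    by apply: transfer ns => l ld; rewrite psi_small.
  exists N; split=> //; apply/near_right0; apply: transfer iN => l ld.
  by rewrite psi_small.
move=> [N [coN bN /near_right0 iN]]; apply/near_right0.
have [x Nx||e e0 he] := iso_non_saddle hM lc hG F psi_cont K0n K0c K0_non_saddle delta_gt0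
    K_n K_c K_cont (n := n) (N := N) _ coN bN.
- exact: (manifold_convex_chart M_manifold (open_interior N) (@interior_subset _ N) Nx).
- by apply: transfer iN => l ld; rewrite psi_small.
- by apply: (transfer (fun l => non_saddle (psi l) (K l))); [move=> l ld; rewrite psi_small|exists e].
Qed.
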